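(* Let $S=(S_u;u\in\mathbf T)$ be the discrete solution and let $C=(C_u;u\in\mathbf T)$, $C_u=\mathbb P(S_u=1\mid N_v;v\in\mathbf T)$, be the corresponding conditional probability solution to the RDE $X_u=1-\prod_{i=1}^{N_u}X_{ui}$, $u\in\mathbf T$. Let $\mu^1=\mathbb E[S_u]$. Then: (1) $S$ is endogenous if and only if $H'(\mu^1)\le 1$; (2) $C$ is the unique endogenous tree-indexed solution to the RDE; (3) the only invariant distributions on $[0,1]$ for the RDE are those of $S_\emptyset$ and $C_\emptyset$.
   Context: $N$ is a random variable with values in $\{1,2,\dots\}\cup\{\infty\}$, and $H(s)=\mathbb E[s^N]$ for $s\in[0,1]$, with conventions $s^\infty=0$ for $0\le s<1$ and $1^\infty=1$; in particular $H(0)=0$. Standing assumption: $H$ is strictly convex (on $[0,1)$), i.e. $\mathbb P(2\le N<\infty)>0$. $\mathbf T=\bigcup_{n\ge0}\mathbb N^n$ is the tree of finite sequences of positive integers, $\emptyset$ its root, $|u|$ the length of $u$, and $u1,u2,\dots$ the daughters of $u$. $(N_u;u\in\mathbf T)$ are i.i.d. copies of $N$. A product $\prod_{i=1}^{\infty}$ of numbers in $[0,1]$ is the limit of its partial products. A tree-indexed solution to the RDE is a family $X=(X_u;u\in\mathbf T)$ of $[0,1]$-valued random variables such that (i) for every $n$ the $(X_u;|u|=n)$ are mutually independent and independent of $(N_v;|v|\le n-1)$; (ii) for every $u$, $X_u=1-\prod_{i=1}^{N_u}X_{ui}$, and all the $X_u$ have the same law. It is endogenous if it is measurable with respect to (the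 completion of) $\sigma(N_u;u\in\mathbf T)$. Uniqueness of solutions on the tree is up to almost sure equality. A probability measure $\nu$ on $[0,1]$ is invariant for the RDE if, whenever $X_1,X_2,\dots$ are i.i.d. with law $\nu$, independent of $N$, the variable $1-\prod_{i=1}^N X_i$ has law $\nu$. There is a unique invariant probability measure on $\{0,1\}$; it gives mass $\mu^1$ to $1$, where $\mu^1$ is the unique root in $(0,1)$ of $H(x)+x=1$. The discrete solution $S$ is the tree-indexed solution with values in $\{0,1\}$, each $S_u$ having this law. *)

(* Defs.v *)
From HB Require Import structures.
From mathcomp Require Export all_boot all_order all_algebra finmap.
From mathcomp Require Export all_classical all_reals all_analysis.
Export Order.TTheory GRing.Theory Num.Theory numFieldNormedType.Exports.

#[export] Set Implicit Arguments.
#[export] Unset Strict Implicit.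
#[export] Unset Printing Implicit Defensive.

Global Open Scope classical_set_scope.
Global Open Scope ring_scope.

(* An offspring number in {0, 1, 2, ...} u {oo} has type [option nat], with
   [None] standing for oo; [option nat] carries the discrete sigma-algebra. *)
HB.instance Definition _ := @isMeasurable.Build default_measure_display
  (option nat) discrete_measurable discrete_measurable0
  discrete_measurableC discrete_measurableU.

(* Vertices are finite sequences of positive integers, shifted down by one:
   the daughters u1, u2, ... of u are [rcons u 0], [rcons u 1], ...
   and |u| is [size u]. *)
Notation tree := (seq nat).

Definition pow_ext {R : realType} (s : R) (n : option nat) : R :=
  if n is Some k then s ^+ k else (s == 1)%:R.

Definition prod_ext {R : realType} (n : option nat) (x : nat -> R) : R :=
  if n is Some k then \prod_(i < k) x i
  else limn (fun m => \prod_(i < m) x i).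

Definition strictly_convex_on {R : realType} (D : set R) (f : R -> R) : Prop :=
  forall x y t, D x -> D y -> x != y -> 0 < t < 1 ->
    f (t * x + (1 - t) * y) < t * f x + (1 - t) * f y.

Section independence.
Context {d d'} {Omega : measurableType d} {R : realType}
  (P : probability Omega R)
  {T : measurableType d'}.

(* sigma(X_i; i in D) *)
Definition joint_sigma {I : Type} (D : set I) (X : I -> {RV P >-> T}) :
    set (set Omega) :=
  <<s \bigcup_(i in D) g_sigma_algebra_preimage (X i) >>.

Definition mutually_independent {I : choiceType} (D : set I)
    (X : I -> {RV P >-> T}) : Prop :=
  forall (J : {fset I}) (A : I -> set T), [set` J] `<=` D ->
    (forall i, measurable (A i)) ->
    P (\bigcap_(i in [set` J]) (X i @^-1` A i)) =
      (\prod_(i <- J) fine (P (X i @^-1` A i)))%:E.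

Definition independent_sigma (F G : set (set Omega)) : Prop :=
  forall A B, F A -> G B -> P (A `&` B) = (P A * P B)%E.

End independence.

Definition same_law {d} {T : measurableType d} {R : realType}
    (p q : set T -> \bar R) : Prop :=
  forall A, measurable A -> p A = q A.

Section pgf.
Context {d} {Omega : measurableType d} {R : realType} (P : probability Omega R).

(* Only the values on [0, 1] are meaningful. *)
Definition pgf (N : {RV P >-> option nat}) (s : R) : R :=
  fine 'E_P[fun w => pow_ext s (N w)].

End pgf.

Section rde.
Context {d} {Omega : measurableType d} {R : realType} (P : probability Omega R).

Definition iid_copies (N : {RV P >-> option nat})
    (Nt : tree -> {RV P >-> option nat}) : Prop :=
  mutually_independent setT Nt /\
  forall u, same_law (distribution P (Nt u)) (distribution P N).

Record tree_solution (Nt : tree -> {RV P >-> option nat})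
    (X : tree -> {RV P >-> R}) : Prop := TreeSolution {
  ts_range : forall u, {ae P, forall w, 0 <= X u w <= 1} ;
  ts_indep : forall n, mutually_independent [set u : tree | size u = n] X ;
  ts_indep_past : forall n, independent_sigma P
    (joint_sigma [set u : tree | size u = n] X)
    (joint_sigma [set v : tree | (size v < n)%N] Nt) ;
  ts_rde : forall u, {ae P, forall w,
    X u w = 1 - prod_ext (Nt u w) (fun i => X (rcons u i) w)} ;
  ts_law : forall u v, same_law (distribution P (X u)) (distribution P (X v))
}.

(* The law of S_u is then forced: taking expectations in the recursion shows
   that x = P(S_u = 1) solves H(x) + x = 1. *)
Definition discrete_solution (Nt : tree -> {RV P >-> option nat})
    (S : tree -> {RV P >-> R}) : Prop :=
  tree_solution Nt S /\
  forall u, {ae P, forall w, S u w = 0 \/ S u w = 1}.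

(* The completion adds every P-negligible set, so that measurability with
   respect to it is invariant under almost sure equality. *)
Definition completed_sigma (F : set (set Omega)) : set (set Omega) :=
  <<s F `|` [set A | P.-negligible A] >>.

Definition endogenous (Nt : tree -> {RV P >-> option nat})
    (X : tree -> {RV P >-> R}) : Prop :=
  forall u, g_sigma_algebra_preimage (X u) `<=`
    completed_sigma (joint_sigma setT Nt).

(* Y is a version of P(E | F). *)
Definition is_cond_prob (F : set (set Omega)) (E : set Omega)
    (Y : {RV P >-> R}) : Prop :=
  g_sigma_algebra_preimage Y `<=` F /\
  forall A, F A -> (\int[P]_(w in A) (Y w)%:E)%E = P (A `&` E).

End rde.

(* The quantification is over all probability spaces carrying such N', X; the
   law of 1 - prod_{i <= N'} X_i does not depend on the choice. *)
Definition invariant_law {d} {Omega : measurableType d} {R : realType}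
    (P : probability Omega R) (N : {RV P >-> option nat})
    (nu : probability R R) : Prop :=
  forall d' (Omega' : measurableType d') (P' : probability Omega' R)
    (N' : {RV P' >-> option nat}) (X : nat -> {RV P' >-> R}),
    same_law (distribution P' N') (distribution P N) ->
    (forall i w, 0 <= X i w <= 1) ->
    mutually_independent setT X ->
    (forall i, same_law (distribution P' (X i)) nu) ->
    independent_sigma P' (joint_sigma setT X) (g_sigma_algebra_preimage N') ->
    same_law (pushforward P' (fun w => 1 - prod_ext (N' w) (fun i => X i w))) nu.

(* Main.v *)
(** Expanding [E (1 - prod X_i)^p] turns invariance of a law on [0, 1] into
    recursive equations for its moments, and moments determine a law on
    [0, 1].  The first moment must be the root [mu] of [H x + x = 1]; the
    second is then a root of [H x - x = H mu - mu], which by strict convexity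
    has at most one root below [mu].  The root [mu] forces the discrete law;
    given the lower root, all higher moments are determined, since
    [H x + x] is increasing and [H x - x] is injective to the left of that
    root.  Hence there are at most two invariant laws.

    Given the first [n] generations of [N], the conditional mean of any tree
    solution is obtained by replacing the variables at level [n] by their mean
    [mu] and running the recursion, since the recursion is affine in each
    variable.  These conditional means thus do not depend on the solution;
    they converge in L2 to [C], so that [C] is a solution and agrees with every
    endogenous one.  Their second moments start at [mu^2] and iterate the
    increasing map [x |-> 1 - 2 H mu + H x], so [E C^2] is bounded by any
    point [x >= mu^2] that the map does not increase; if [H' mu > 1], such a
    point exists below [mu], so [C] is not discrete and [S] is not endogenous.
    If [H' mu <= 1], the lower root does not exist, so [E C^2 = mu = E C],
    [C] takes values in {0, 1} and equals [S].

    Using that a law is invariant requires independent variables with that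
    law; these are built on the given space from the independent Bernoulli
    variables [S [:: i]]. *)

From HB Require Import structures.
From mathcomp Require Import measurable_realfun ring lra.
Require Import Defs.

(** * Expectation of bounded random variables *)

(** No conditional expectation is ever constructed: [E[X | F] = E[Y | F]] is stated as equality of
    [E[X 1_A]] and [E[Y 1_A]] for all [A] in [F], and conditioning on an offspring number as an
    identity on each event [N = o]. Infinite offspring numbers would put a limit into the recursion.
    Since the mean of a solution is below 1, the infinite product vanishes almost surely; replacing
    it by 0 ([prod_fin]) leaves countably many polynomial cases. The main obstacle is independence.
    [C u] is given as a function of all of [Nt], so nothing in its definition makes the [C u] of one
    level independent. The L2 convergence shows that [C u] is a limit of functions of the subtree of
    [u], hence measurable for that subtree up to null sets; the class [approx] carries independence
    through such limits. Solutions and conditional probabilities lie in [0, 1] almost surely only,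
    so the work is done on clamped versions and transferred at the end. *)

Lemma eq_cvgn_lim {R : realType} (u v : nat -> R) (a b : R) :
  u n @[n --> \oo] --> a -> v n @[n --> \oo] --> b -> u =1 v -> a = b.
Proof. by move=> ua vb /funext uv; move: ua; rewrite uv => va; exact: cvg_unique va vb. Qed.

Definition mfun_of {d d'} {T : measurableType d} {T' : measurableType d'}
    (f : T -> T') (mf : measurable_fun setT f) : {mfun T >-> T'} :=
  HB.pack f (isMeasurableFun.Build _ _ _ _ f mf).

Section expectation.
Context {d} {Omega : measurableType d} {R : realType} (P : probability Omega R).
Implicit Types f g : Omega -> R.

(** Closed under sums, products and powers, so that linearity of [Ex] carries no integrability side
    conditions. *)
Definition bmeas f := measurable_fun setT f /\ exists M, forall w, `|f w| <= M.

Definition Ex f : R := \int[P]_w f w.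

Definition pr (A : set Omega) : R := fine (P A).

Lemma bmeas_integrable f : bmeas f -> P.-integrable setT (EFin \o f).
Proof.
move=> [mf [M fM]]; apply: measurable_bounded_integrable => //.
  by rewrite (le_lt_trans (probability_le1 _ _))// ltry.
by exists M; split => //= x Mx y _; exact: le_trans (fM y) (ltW Mx).
Qed.

Lemma bmeas_cst c : bmeas (cst c).
Proof. by split => //; exists `|c|. Qed.

Lemma bmeasN f : bmeas f -> bmeas (fun w => - f w).
Proof.
move=> [mf [M fM]]; split; first exact: measurableT_comp.
by exists M => w; rewrite normrN.
Qed.

Lemma bmeasD f g : bmeas f -> bmeas g -> bmeas (fun w => f w + g w).
Proof.
move=> [mf [M fM]] [mg [M' gM]]; split; first exact: measurable_funD.
by exists (M + M') => w; rewrite (le_trans (ler_normD _ _))// lerD.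
Qed.

Lemma bmeasB f g : bmeas f -> bmeas g -> bmeas (fun w => f w - g w).
Proof. by move=> bf bg; apply: bmeasD => //; exact: bmeasN. Qed.

Lemma bmeasM f g : bmeas f -> bmeas g -> bmeas (fun w => f w * g w).
Proof.
move=> [mf [M fM]] [mg [M' gM]]; split; first exact: measurable_funM.
by exists (M * M') => w; rewrite normrM ler_pM.
Qed.

Lemma bmeasX f n : bmeas f -> bmeas (fun w => f w ^+ n).
Proof.
move=> bf; elim: n => [|n IH].
  by under eq_fun do rewrite expr0; exact: bmeas_cst.
by under eq_fun do rewrite exprS; exact: bmeasM.
Qed.

Lemma bmeas_norm f : bmeas f -> bmeas (fun w => `|f w|).
Proof.
move=> [mf [M fM]]; split; first exact: measurableT_comp.
by exists M => w; rewrite normr_id.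
Qed.

Lemma bmeas_indic A : measurable A -> bmeas \1_A.
Proof.
move=> mA; split; first exact: measurable_indic.
by exists 1 => w; rewrite indicE; case: (_ \in _); rewrite /= ?normr1 ?normr0.
Qed.

Lemma bmeas_prod I (s : seq I) (F : I -> Omega -> R) : (forall i, bmeas (F i)) ->
  bmeas (fun w => \prod_(i <- s) F i w).
Proof.
move=> bF; elim: s => [|i s IH].
  by under eq_fun do rewrite big_nil; exact: bmeas_cst.
by under eq_fun do rewrite big_cons; exact: bmeasM.
Qed.

Lemma bmeas_sum I (s : seq I) (F : I -> Omega -> R) : (forall i, bmeas (F i)) ->
  bmeas (fun w => \sum_(i <- s) F i w).
Proof.
move=> bF; elim: s => [|i s IH].
  by under eq_fun do rewrite big_nil; exact: bmeas_cst.
by under eq_fun do rewrite big_cons; exact: bmeasD.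
Qed.

Lemma bmeas01 f : measurable_fun setT f -> (forall w, 0 <= f w <= 1) -> bmeas f.
Proof.
move=> mf f01; split => //; exists 1 => w.
by case/andP: (f01 w) => f0 f1; rewrite ger0_norm.
Qed.

Lemma eq_Ex f g : f =1 g -> Ex f = Ex g.
Proof. by move=> /funext ->. Qed.

Lemma ExD f g : bmeas f -> bmeas g -> Ex (fun w => f w + g w) = Ex f + Ex g.
Proof. by move=> /bmeas_integrable ? /bmeas_integrable ?; exact: RintegralD. Qed.

Lemma ExB f g : bmeas f -> bmeas g -> Ex (fun w => f w - g w) = Ex f - Ex g.
Proof. by move=> /bmeas_integrable ? /bmeas_integrable ?; exact: RintegralB. Qed.

Lemma ExZ c f : bmeas f -> Ex (fun w => c * f w) = c * Ex f.
Proof. by move=> /bmeas_integrable ?; exact: RintegralZl. Qed.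

Lemma Ex_cst c : Ex (cst c) = c.
Proof.
rewrite /Ex Rintegral_cst//.
by have := @probability_setT _ _ _ P => /= ->; rewrite mulr1.
Qed.

Lemma Ex_sum I (s : seq I) (F : I -> Omega -> R) : (forall i, bmeas (F i)) ->
  Ex (fun w => \sum_(i <- s) F i w) = \sum_(i <- s) Ex (F i).
Proof.
move=> bF; elim: s => [|i s IH].
  by rewrite big_nil; under eq_fun do rewrite big_nil; exact: Ex_cst.
rewrite big_cons -IH -ExD//; last exact: bmeas_sum.
by apply: eq_Ex => w; rewrite big_cons.
Qed.

Lemma Ex_indic A : measurable A -> Ex \1_A = pr A.
Proof. by move=> mA; rewrite /Ex /Rintegral integral_indic// setIT. Qed.

Lemma prE A : measurable A -> P A = (pr A)%:E.
Proof. by move=> mA; rewrite fineK// fin_num_measure. Qed.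

Lemma Ex_ge0 f : (forall w, 0 <= f w) -> 0 <= Ex f.
Proof. by move=> f0; apply: Rintegral_ge0. Qed.

Lemma Ex_le f g : bmeas f -> bmeas g -> (forall w, f w <= g w) -> Ex f <= Ex g.
Proof.
by move=> bf bg fg; apply: le_Rintegral => //; exact: bmeas_integrable.
Qed.

Lemma Ex_norm f : bmeas f -> `|Ex f| <= Ex (fun w => `|f w|).
Proof. by move=> bf; apply: le_normr_Rintegral => //; exact: bmeas_integrable. Qed.

Lemma Ex_norm_le f e : bmeas f -> (forall w, `|f w| <= e) -> `|Ex f| <= e.
Proof.
move=> bf fe; rewrite (le_trans (Ex_norm bf))// -[leRHS]Ex_cst.
by apply: Ex_le => //; [exact: bmeas_norm|exact: bmeas_cst].
Qed.

Lemma Ex_ae f g : measurable_fun setT f -> measurable_fun setT g ->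
  {ae P, forall w, f w = g w} -> Ex f = Ex g.
Proof.
move=> mf mg fg; rewrite /Ex /Rintegral; congr fine.
apply: ae_eq_integral => //; [exact/measurable_EFinP|exact/measurable_EFinP|].
by apply: filterS fg => w /= ->.
Qed.

Lemma Ex_cvg (F : nat -> Omega -> R) f M :
  (forall n, measurable_fun setT (F n)) -> measurable_fun setT f ->
  (forall n w, `|F n w| <= M) ->
  {ae P, forall w, F n w @[n --> \oo] --> f w} ->
  Ex (F n) @[n --> \oo] --> Ex f.
Proof.
move=> mF mf FM Ff.
have [] := @dominated_convergence _ _ _ P setT measurableT
  (fun n => EFin \o F n) (EFin \o f) (cst M%:E).
- by move=> n; exact/measurable_EFinP.
- exact/measurable_EFinP.
- by apply: filterS Ff => w Fw _; apply: cvg_EFin; [exact: nearW|exact: Fw].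
- apply/integrableP; split => //.
  rewrite integral_cst//= probability_setT mule1.
  by rewrite ltry.
- by apply: aeW => w n _; rewrite /= lee_fin.
move=> intf _ /=; rewrite /Ex /Rintegral => cv.
have fi : (\int[P]_x (f x)%:E)%E \is a fin_num by exact: integrable_fin_num.
by apply: fine_cvg; rewrite fineK.
Qed.

Lemma Ex_eq0 f : measurable_fun setT f -> (forall w, 0 <= f w) ->
  (exists M, forall w, `|f w| <= M) ->
  Ex f = 0 -> {ae P, forall w, f w = 0}.
Proof.
move=> mf f0 fM Ef.
have bf : bmeas f by [].
have h : (\int[P]_w `|(f w)%:E| = 0)%E.
  under eq_integral do rewrite gee0_abs ?lee_fin//.
  have := integrable_fin_num measurableT (bmeas_integrable bf).
  by move=> /fineK <-; congr EFin.
have mf' : measurable_fun setT (EFin \o f) by exact/measurable_EFinP.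
have [/(_ h) h2 _] := ae_eq_integral_abs P measurableT mf'.
by apply: filterS h2 => w /= /(_ I) [].
Qed.

Lemma pr_ge0 A : 0 <= pr A.
Proof. by rewrite fine_ge0. Qed.

Lemma pr_setT : pr setT = 1.
Proof. by rewrite /pr probability_setT. Qed.

Lemma pr_setC A : measurable A -> pr (~` A) = 1 - pr A.
Proof. by move=> mA; rewrite /pr probability_setC// prE//. Qed.

Lemma pr_le A B : measurable A -> measurable B -> A `<=` B -> pr A <= pr B.
Proof.
by move=> mA mB AB; rewrite fine_le// ?fin_num_measure// le_measure// inE.
Qed.

Lemma pr_le1 A : measurable A -> pr A <= 1.
Proof. by move=> mA; rewrite -pr_setT pr_le. Qed.

Lemma pr_negligible A B : measurable A -> measurable B ->
  P.-negligible (A `+` B) -> pr A = pr B.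
Proof.
move=> mA mB nAB; rewrite -!Ex_indic//; apply: Ex_ae; [exact: measurable_indic..|].
apply: negligibleS nAB => w /= h; rewrite /setY /=; apply: contrapT => h2; apply: h.
rewrite !indicE; congr (_%:R : R); congr nat_of_bool; apply/idP/idP; rewrite !inE => h3.
  by apply: contrapT => h4; apply: h2; left.
by apply: contrapT => h4; apply: h2; right.
Qed.

End expectation.
Arguments bmeas {d Omega R} f.

(** * Moments determine a law on [0, 1] *)

Section bernstein.
Context {R : realType}.
Implicit Types (g : nat -> R) (y : R).

(* The value at [y] is the expectation of [g] under the binomial law B(n, y),
   conditioning on the first trial. *)
Fixpoint binom_mean (n : nat) g y : R :=
  if n is m.+1 then y * binom_mean m (g \o succn) y + (1 - y) * binom_mean m g y
  else g 0%N.

Lemma binom_mean_cst n c y : binom_mean n (fun=> c) y = c.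
Proof. by elim: n => //= n IH; rewrite IH; ring. Qed.

Lemma binom_meanD n g h y :
  binom_mean n (fun k => g k + h k) y = binom_mean n g y + binom_mean n h y.
Proof. by elim: n g h => //= n IH g h; rewrite !IH; ring. Qed.

Lemma binom_meanZ n c g y :
  binom_mean n (fun k => c * g k) y = c * binom_mean n g y.
Proof. by elim: n g => //= n IH g; rewrite !IH; ring. Qed.

Lemma binom_mean_le n g h y : 0 <= y <= 1 -> (forall k, g k <= h k) ->
  binom_mean n g y <= binom_mean n h y.
Proof.
move=> /andP[y0 y1]; elim: n g h => [|n IH] g h gh /=; first exact: gh.
by apply: lerD; apply: ler_wpM2l; rewrite ?subr_ge0// IH// => k; exact: gh.
Qed.

Lemma binom_mean_norm n g y : 0 <= y <= 1 ->
  `|binom_mean n g y| <= binom_mean n (fun k => `|g k|) y.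
Proof.
move=> /andP[y0 y1]; elim: n g => [|n IH] g //=.
rewrite (le_trans (ler_normD _ _))// !normrM (ger0_norm y0).
rewrite (ger0_norm (_ : 0 <= 1 - y)) ?subr_ge0//.
by apply: lerD; apply: ler_wpM2l; rewrite ?subr_ge0//; exact: IH.
Qed.

(** Variance plus squared bias. The centre [c] is arbitrary because conditioning on a successful
    first trial shifts it by 1. *)
Lemma binom_mean_sqr n c y :
  binom_mean n (fun k => (k%:R - c) ^+ 2) y = n%:R * y * (1 - y) + (n%:R * y - c) ^+ 2.
Proof.
elim: n c => [|n IH] c /=; first by ring.
have -> : (fun k => (k%:R - c) ^+ 2) \o succn = fun k => (k%:R - (c - 1)) ^+ 2 :> R.
  by apply/funext => k /=; rewrite -natr1; ring.
by rewrite !IH -natr1; ring.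
Qed.

Lemma binom_mean_lipschitz (f : R -> R) L eta n y :
  0 <= L -> 0 < eta -> (forall a b, `|f a - f b| <= L * `|a - b|) -> 0 <= y <= 1 ->
  `|binom_mean n.+1 (fun k => f (k%:R / n.+1%:R)) y - f y| <=
     L * (eta + (eta * n.+1%:R)^-1).
Proof.
move=> L0 eta0 fL y01; set N : R := n.+1%:R.
have N0 : 0 < N by rewrite ltr0n.
rewrite -[f y in leLHS](binom_mean_cst n.+1 _ y) -mulN1r -binom_meanZ -binom_meanD.
rewrite (le_trans (binom_mean_norm _ _ y01))//.
(* Chebyshev without splitting the sum: [a <= eta + a ^+ 2 / eta] for the deviation [a], whose
   second moment is the binomial variance. *)
pose h k : R := L * eta + L / (eta * N ^+ 2) * (k%:R - N * y) ^+ 2.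
apply: (@le_trans _ _ (binom_mean n.+1 h y)).
  apply: binom_mean_le => // k; rewrite mulN1r (le_trans (fL _ _))//.
  rewrite /h -mulrA -mulrDr ler_wpM2l//.
  have -> : (eta * N ^+ 2)^-1 * (k%:R - N * y) ^+ 2 = `|k%:R / N - y| ^+ 2 / eta.
    by rewrite real_normK ?num_real//; field; rewrite !gt_eqF.
  set a := `| _ |; have a0 : 0 <= a by exact: normr_ge0.
  rewrite -(ler_pM2r eta0) mulrDl -mulrA mulVf ?gt_eqF// mulr1.
  nra.
rewrite binom_meanD binom_mean_cst binom_meanZ binom_mean_sqr subrr expr0n/= addr0.
rewrite [leRHS]mulrDr lerD2l.
have -> : L / (eta * N ^+ 2) * (N * y * (1 - y)) = L / (eta * N) * (y * (1 - y)).
  by field; rewrite !gt_eqF.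
rewrite ler_piMr//; first by rewrite mulr_ge0// invr_ge0 mulr_ge0// ltW.
by case/andP: y01 => y0 y1; nra.
Qed.

(** The Bernstein polynomial of [g], by the recursion of [binom_mean] so that evaluation is
    immediate. *)
Fixpoint binom_poly (n : nat) g : {poly R} :=
  if n is m.+1 then 'X * binom_poly m (g \o succn) + (1 - 'X) * binom_poly m g
  else (g 0%N)%:P.

Lemma horner_binom_poly n g y : (binom_poly n g).[y] = binom_mean n g y.
Proof. by elim: n g => [|n IH] g; rewrite /= ?hornerE// !IH. Qed.

End bernstein.

Section moments.
Context {R : realType}.
Context {d} {Omega : measurableType d} (P : probability Omega R).
Context {d'} {Omega' : measurableType d'} (Q : probability Omega' R).
Variables (X : Omega -> R) (Y : Omega' -> R).
Hypotheses (mX : measurable_fun setT X) (mY : measurable_fun setT Y).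
Hypotheses (X01 : forall w, 0 <= X w <= 1) (Y01 : forall w, 0 <= Y w <= 1).
Hypothesis XY : forall n, Ex P (fun w => X w ^+ n) = Ex Q (fun w => Y w ^+ n).

Lemma Ex_horner d0 (T : measurableType d0) (M : probability T R) (Z : T -> R)
    (p : {poly R}) : bmeas Z ->
  Ex M (fun w => p.[Z w]) = \sum_(i < size p) p`_i * Ex M (fun w => Z w ^+ i).
Proof.
move=> bZ; under eq_fun do rewrite horner_coef.
rewrite Ex_sum; last by move=> i; apply: bmeasM; [exact: bmeas_cst|exact: bmeasX].
by apply: eq_bigr => i _; rewrite ExZ//; exact: bmeasX.
Qed.

(** A Bernstein polynomial is uniformly within [e / 2] of [f] on [0, 1], and its expectation is the
    same for [X] and [Y] because their moments agree. *)
Lemma Ex_lipschitz_eq (f : R -> R) L : 0 <= L ->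
  (forall a b, `|f a - f b| <= L * `|a - b|) ->
  measurable_fun setT f ->
  Ex P (f \o X) = Ex Q (f \o Y).
Proof.
move=> L0 fL mf.
have bX := bmeas01 mX X01; have bY := bmeas01 mY Y01.
have bf d0 (T : measurableType d0) (Z : T -> R) : measurable_fun setT Z ->
    (forall w, 0 <= Z w <= 1) -> bmeas (f \o Z).
  move=> mZ Z01; split; first exact: measurableT_comp.
  exists (`|f 0| + L) => w /=; rewrite -(subrK (f 0) (f (Z w))) addrC.
  rewrite (le_trans (ler_normD _ _))// lerD2l (le_trans (fL _ _))// subr0 ler_piMr//.
  by case/andP: (Z01 w) => ? ?; rewrite ger0_norm.
apply/eqP; rewrite -subr_eq0 -normr_eq0 eq_le normr_ge0 andbT.
apply/ler_addgt0Pr => e e0; rewrite add0r.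
(* The error bound of [binom_mean_lipschitz] becomes at most [2 * L * eta <= e / 2] once [n + 1]
   exceeds [eta ^- 2]; the [+ 1] covers [L = 0]. *)
pose eta := e / (4 * (L + 1)).
have eta0 : 0 < eta by rewrite divr_gt0// mulr_gt0// ltr_wpDl.
pose n := Num.truncn (eta ^- 2).
have nE : (eta * n.+1%:R)^-1 <= eta.
  have h : eta ^- 2 <= n.+1%:R by apply/ltW/truncnS_gt.
  have h' : 1 <= eta ^+ 2 * n.+1%:R.
    by move: h; rewrite -(ler_pM2l (exprn_gt0 2 eta0)) mulfV// expf_neq0// gt_eqF.
  rewrite -[leLHS]mul1r ler_pdivrMr; last by rewrite mulr_gt0.
  by rewrite mulrA -expr2.
pose p := binom_poly n.+1 (fun k => f (k%:R / n.+1%:R)).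
have pf y : 0 <= y <= 1 -> `|p.[y] - f y| <= e / 2.
  move=> y01; rewrite horner_binom_poly (le_trans (binom_mean_lipschitz n L0 eta0 fL y01))//.
  apply: (@le_trans _ _ (L * (eta + eta))); first by apply: ler_wpM2l => //; rewrite lerD2l.
  have -> : L * (eta + eta) = L / (L + 1) * (e / 2).
    by rewrite /eta; field; rewrite gt_eqF// ltr_wpDl.
  apply: ler_piMl; first by rewrite divr_ge0// ltW.
  by rewrite ler_pdivrMr ?mul1r ?lerDl// ltr_wpDl.
have bp d0 (T : measurableType d0) (Z : T -> R) : bmeas Z -> bmeas (fun w => p.[Z w]).
  move=> bZ; under eq_fun do rewrite horner_coef.
  by apply: bmeas_sum => i; apply: bmeasM; [exact: bmeas_cst|exact: bmeasX].
have close d0 (T : measurableType d0) (M : probability T R) (Z : T -> R) : measurable_fun setT Z ->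
    (forall w, 0 <= Z w <= 1) -> `|Ex M (fun w => p.[Z w]) - Ex M (f \o Z)| <= e / 2.
  move=> mZ Z01; have bZ := bmeas01 mZ Z01.
  rewrite -ExB//; [|exact: bp|exact: bf].
  apply: Ex_norm_le => [|w]; last exact: pf.
  by apply: bmeasB; [exact: bp|exact: bf].
have : Ex P (fun w => p.[X w]) = Ex Q (fun w => p.[Y w]).
  by rewrite !Ex_horner//; apply: eq_bigr => i _; rewrite XY.
have := close _ _ P _ mX X01; have := close _ _ Q _ mY Y01.
move=> h1 h2 h3; move: h2; rewrite h3 distrC => h2.
rewrite [leRHS]splitr.
by rewrite (le_trans (ler_distD (Ex Q (fun w => p.[Y w])) _ _))// lerD.
Qed.

Lemma moments_cdf t : P (X @^-1` `]-oo, t]) = Q (Y @^-1` `]-oo, t]).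
Proof.
(* A ramp equal to 1 up to [t] and falling to 0 with slope [-m]: Lipschitz for each [m], with the
   indicator of []-oo, t]] as pointwise limit. *)
pose f (m : nat) (y : R) := Num.min 1 (Num.max 0 (1 - m%:R * (y - t))).
have clip_le (u v : R) : u <= v ->
    0 <= Num.min 1 (Num.max 0 v) - Num.min 1 (Num.max 0 u) <= v - u.
  move=> uv; rewrite minC (minC 1).
  case: (leP 0 u) => u0; case: (leP 0 v) => v0.
  - by case: (leP u 1) => u1; case: (leP v 1) => v1; lra.
  - by case: (leP u 1) => u1; case: (leP 0 1) => v1; lra.
  - by case: (leP v 1) => u1; case: (leP 0 1) => v1; lra.
  - by case: (leP 0 1) => v1; lra.
have fL m a b : `|f m a - f m b| <= m%:R * `|a - b|.
  have m0 : 0 <= m%:R :> R by [].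
  wlog ab : a b / a <= b.
    move=> h; have [/h//|/ltW/h] := leP a b.
    by rewrite distrC (distrC a).
  rewrite distrC (distrC a) (ger0_norm (_ : 0 <= b - a)) ?subr_ge0//.
  have h1 : m%:R * (a - t) <= m%:R * (b - t) by rewrite ler_wpM2l// lerD2r.
  have uv : 1 - m%:R * (b - t) <= 1 - m%:R * (a - t) by lra.
  have /andP[c0 c1] := clip_le _ _ uv.
  rewrite distrC /f (ger0_norm c0) (le_trans c1)//.
  by rewrite le_eqVlt; apply/orP; left; apply/eqP; ring.
have mf m : measurable_fun setT (f m).
  apply: measurable_minr => //; apply: measurable_maxr => //.
  apply: measurable_funB => //; apply: measurable_funM => //.
  exact: measurable_funB.
have f1 m y : `|f m y| <= 1.
  rewrite /f ler_norml; apply/andP; split.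
    by rewrite le_min; apply/andP; split; rewrite ?le_max ?lerN10//; lra.
  by rewrite ge_min lexx.
have fcv y : f n y @[n --> \oo] --> (\1_(`]-oo, t]) y : R).
  rewrite indicE; have [yt|ty] := leP y t.
    rewrite mem_set; last by rewrite /= in_itv.
    apply: cvg_near_cst; near=> n; rewrite /f max_r ?min_l//.
      by rewrite lerDl oppr_ge0 mulr_ge0_le0// subr_le0.
    by rewrite subr_ge0 (@le_trans _ _ 0)// mulr_ge0_le0// subr_le0.
  rewrite memNset; last by rewrite /= in_itv/= leNgt ty.
  apply: cvg_near_cst; near=> n; rewrite /f.
  have yt0 : 0 < y - t by rewrite subr_gt0.
  have h : 1 <= n%:R * (y - t).
    rewrite -ler_pdivrMr// mul1r ltW//; near: n; exact: nbhs_infty_gtr.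
  by rewrite max_l ?subr_le0// min_r.
have cv d0 (T : measurableType d0) (M : probability T R) (Z : T -> R) : measurable_fun setT Z ->
    Ex M (f n \o Z) @[n --> \oo] --> pr M (Z @^-1` `]-oo, t]).
  move=> mZ; have mt : measurable (Z @^-1` `]-oo, t]) by rewrite -[X in measurable X]setTI; apply: mZ.
  rewrite -Ex_indic//; apply: (@Ex_cvg _ _ _ _ _ _ 1) => //.
    by move=> n; exact: measurableT_comp.
    by move=> n w; exact: f1.
  by apply: aeW => w; exact: fcv.
have mPX : measurable (X @^-1` `]-oo, t]) by rewrite -[X in measurable X]setTI; apply: mX.
have mPY : measurable (Y @^-1` `]-oo, t]) by rewrite -[X in measurable X]setTI; apply: mY.
rewrite !prE//; congr EFin.
have cX := cv _ _ P _ mX; have cY := cv _ _ Q _ mY.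
have E n : Ex P (f n \o X) = Ex Q (f n \o Y) by apply: (@Ex_lipschitz_eq _ n%:R).
exact: eq_cvgn_lim cX cY E.
Unshelve. all: by end_near.
Qed.


Lemma cdf_law (m1 m2 : probability R R) :
  (forall t, m1 `]-oo, t]%classic = m2 `]-oo, t]%classic) -> same_law m1 m2.
Proof.
move=> m12 A mA.
pose g (i : nat) : set R := `](- i%:R), +oo[%classic.
apply: (@measure_unique _ R R (@RGenOInfty.G R) g) => //.
- exact: RGenOInfty.measurableE.
- move=> _ _ [x ->] [y ->]; exists (Num.max x y); apply/seteqP; split => z /=;
  rewrite !in_itv/= !andbT gt_max; first by case=> -> ->.
  by case/andP.
- by move=> i; exists (- i%:R).
- rewrite -subTset => x _; exists (Num.truncn `|x|).+1 => //; rewrite /g /= in_itv/= andbT.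
  rewrite ltrNl (le_lt_trans (ler_norm _))// normrN; exact: truncnS_gt.
- move=> _ [x ->]; have -> : `]x, +oo[%classic = ~` `]-oo, x] :> set R by rewrite setCitvl.
  transitivity (1 - m1 `]-oo, x]%classic)%E; first exact: probability_setC.
  rewrite m12; apply/esym; exact: probability_setC.
- move=> k; apply: (@le_lt_trans _ _ 1%E); last exact: ltry.
  by apply: (@probability_le1 _ _ _ m1); rewrite /g; exact: measurable_itv.
Qed.

Lemma moments_law A : measurable A -> P (X @^-1` A) = Q (Y @^-1` A).
Proof.
move: A; apply: (@cdf_law (distribution P (mfun_of mX)) (distribution Q (mfun_of mY))).
exact: moments_cdf.
Qed.

End moments.

(** * Measurability and independence with respect to sub-sigma-algebras *)

Section sub_sigma.
Context {d} {Omega : measurableType d} {R : realType} (P : probability Omega R).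
Implicit Types (F G : set (set Omega)) (f g X Y : Omega -> R).

(** [F] is a bare set of sets, so several sub-sigma-algebras can live on one space; [smeasP] gives
    access to the library's measurability when [F] is generated. *)
Definition smeas F f := forall B : set R, measurable B -> F (f @^-1` B).

Lemma smeasP G f : smeas <<s G>> f <->
  measurable_fun [set: g_sigma_algebraType G] (f : g_sigma_algebraType G -> R).
Proof.
split=> [mf _ B mB|mf B mB]; first by rewrite setTI; exact: mf.
by rewrite -[X in _ X]setTI; exact: mf.
Qed.

Lemma smeasW F f : F `<=` measurable -> smeas F f -> measurable_fun setT f.
Proof. by move=> Fm Ff _ B mB; rewrite setTI; apply: Fm; exact: Ff. Qed.

Lemma sigma_algebra_gen_measurable G : G `<=` measurable -> <<s G>> `<=` @measurable d Omega.
Proof.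
move=> Gm; apply: smallest_sub => //; split => //.
  by move=> A mA; exact: measurableD.
by move=> A mA; exact: bigcupT_measurable.
Qed.

(** The range is cut into cells of width [e], and [f] is replaced by the lower end of its cell. *)
Lemma indic_approx F f e : sigma_algebra setT F -> smeas F f ->
  (exists M, forall w, `|f w| <= M) -> 0 < e ->
  exists n (A : nat -> set Omega) (c : nat -> R), (forall i, F (A i)) /\
    forall w, `|f w - \sum_(i < n) c i * \1_(A i) w| <= e.
Proof.
move=> sF Ff [M fM] e0.
pose c i : R := - M + i%:R * e.
pose A i := f @^-1` `[c i, c i.+1[.
(* This many cells starting at [- M] cover the interval [[- M, M]]. *)
exists (Num.truncn (2 * M / e)).+1, A, c; split=> [i|w]; first exact: Ff.
have [fl fu] : - M <= f w /\ f w <= M by have := fM w; rewrite ler_norml => /andP.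
pose y := (f w + M) / e.
have y0 : 0 <= y by rewrite divr_ge0 ?(ltW e0)//; lra.
pose k := Num.truncn y.
have kn : (k < (Num.truncn (2 * M / e)).+1)%N.
  by rewrite ltnS; apply: le_truncn; rewrite ler_pM2r ?invr_gt0//; lra.
have /andP[ky yk] := truncn_itv y0.
have fE : f w = y * e - M by rewrite /y divfK ?gt_eqF//; lra.
have Aw i : A i w -> i = k.
  rewrite /A /= in_itv/= /c fE => /andP[h1 h2].
  apply/esym/truncn_def/andP; split.
    by rewrite -(ler_pM2r e0); lra.
  by rewrite -(ltr_pM2r e0); lra.
have kw : A k w.
  rewrite /A /= in_itv/= /c fE; apply/andP; split.
    by move: ky; rewrite -/k -(ler_pM2r e0); lra.
  by move: yk; rewrite -/k -(ltr_pM2r e0); lra.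
rewrite (bigD1 (Ordinal kn))//= big1 => [|i ik]; last first.
  rewrite indicE memNset ?mulr0// => /Aw ki; move/eqP: ik; apply.
  by apply: val_inj.
rewrite addr0 indicE mem_set// mulr1 /c fE.
have -> : y * e - M - (- M + k%:R * e) = (y - k%:R) * e by ring.
rewrite normrM (gtr0_norm e0) ler_piMl ?(ltW e0)// ger0_norm ?subr_ge0//.
by rewrite lerBlDl natr1 ltW.
Qed.

(** Equality of conditional expectations, tested on sets, passes to bounded [F]-measurable test
    functions by uniform approximation with simple functions. *)
Lemma Ex_agree F X Y f : sigma_algebra setT F -> F `<=` measurable ->
  bmeas X -> bmeas Y ->
  (forall A, F A -> Ex P (fun w => X w * \1_A w) = Ex P (fun w => Y w * \1_A w)) ->
  smeas F f -> bmeas f ->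
  Ex P (fun w => X w * f w) = Ex P (fun w => Y w * f w).
Proof.
move=> sF Fm bX bY XY Ff bf.
have [_ [M1 XM]] := bX; have [_ [M2 YM]] := bY.
pose K := `|M1| + `|M2| + 1.
have K0 : 0 < K by rewrite ltr_wpDl// addr_ge0.
have XK w : `|X w| <= K by have := XM w; have := ler_norm M1; have := normr_ge0 M2; rewrite /K; lra.
have YK w : `|Y w| <= K by have := YM w; have := ler_norm M2; have := normr_ge0 M1; rewrite /K; lra.
apply/eqP; rewrite -subr_eq0 -normr_eq0 eq_le normr_ge0 andbT.
apply/ler_addgt0Pr => e e0; rewrite add0r.
have [n [A [c [FA fA]]]] := indic_approx sF Ff bf.2 (divr_gt0 e0 (mulr_gt0 (ltr0Sn R 1) K0)).
pose g w := \sum_(i < n) c i * \1_(A i) w : R.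
have b1 i : bmeas (\1_(A i) : Omega -> R) by apply: bmeas_indic; exact: Fm.
have bc i : bmeas (fun w => c i * \1_(A i) w : R) by apply: bmeasM => //; exact: bmeas_cst.
have bg : bmeas g by apply: bmeas_sum => i.
have Eg Z : bmeas Z -> Ex P (fun w => Z w * g w) = \sum_(i < n) c i * Ex P (fun w => Z w * \1_(A i) w).
  move=> bZ; transitivity (Ex P (fun w => \sum_(i < n) c i * (Z w * \1_(A i) w))).
    by apply: eq_Ex => w; rewrite mulr_sumr; apply: eq_bigr => i _; rewrite mulrCA.
  rewrite Ex_sum; last first.
    by move=> i; apply: bmeasM; [exact: bmeas_cst|exact: bmeasM].
  by apply: eq_bigr => i _; rewrite ExZ//; exact: bmeasM.
have gXY : Ex P (fun w => X w * g w) = Ex P (fun w => Y w * g w).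
  by rewrite !Eg//; apply: eq_bigr => i _; rewrite XY.
have cl Z : bmeas Z -> (forall w, `|Z w| <= K) ->
    `|Ex P (fun w => Z w * f w) - Ex P (fun w => Z w * g w)| <= e / 2.
  move=> bZ ZK; rewrite -ExB//; [|exact: bmeasM..].
  apply: Ex_norm_le; first by apply: bmeasB; exact: bmeasM.
  move=> w; rewrite -mulrBr normrM.
  have -> : e / 2 = K * (e / (2 * K)) by field; rewrite gt_eqF.
  by apply: ler_pM => //; exact: fA.
have := cl _ bX XK; have := cl _ bY YK; rewrite gXY => h1 h2.
rewrite [leRHS]splitr (le_trans (ler_distD (Ex P (fun w => Y w * g w)) _ _))//.
by rewrite lerD// distrC.
Qed.

(** [Ex_agree] is applied once per factor: [f] and the constant [E f] agree when tested on [G],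
    because [\1_B] and the constant [P B] agree when tested on [F]. *)
Lemma Ex_indep F G f g : sigma_algebra setT F -> sigma_algebra setT G ->
  F `<=` measurable -> G `<=` measurable -> independent_sigma P F G ->
  smeas F f -> bmeas f -> smeas G g -> bmeas g ->
  Ex P (fun w => f w * g w) = Ex P f * Ex P g.
Proof.
move=> sF sG Fm Gm FG Ff bf Gg bg.
rewrite -(ExZ _ _ bg); apply: (Ex_agree sG Gm bf (bmeas_cst _) _ Gg bg) => B GB.
have mB : measurable B by exact: Gm.
rewrite (ExZ _ _ (bmeas_indic mB)) Ex_indic// [RHS]mulrC -(ExZ _ _ bf).
under eq_Ex do rewrite mulrC.
apply: (Ex_agree sF Fm (bmeas_indic mB) (bmeas_cst _) _ Ff bf) => A FA.
have mA : measurable A by exact: Fm.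
rewrite (ExZ _ _ (bmeas_indic mA)) Ex_indic//.
transitivity (Ex P \1_(A `&` B)).
  by apply: eq_Ex => w; rewrite indicI/= mulrC.
rewrite Ex_indic; last exact: measurableI.
by rewrite /pr (FG _ _ FA GB) !prE// -EFinM/= mulrC.
Qed.

(** Dynkin's theorem for conditional expectations. The equality of the full expectations is a
    separate hypothesis because [G] need not contain the whole space. *)
Lemma Ex_pi G X Y : setI_closed G -> G `<=` measurable -> bmeas X -> bmeas Y ->
  Ex P X = Ex P Y ->
  (forall A, G A -> Ex P (fun w => X w * \1_A w) = Ex P (fun w => Y w * \1_A w)) ->
  forall A, <<s G>> A -> Ex P (fun w => X w * \1_A w) = Ex P (fun w => Y w * \1_A w).
Proof.
move=> GI Gm bX bY XY XYG.
have sm := sigma_algebra_gen_measurable Gm.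
apply: (@dynkin_induction _ (g_sigma_algebraType G)) => //.
- by rewrite indicT; under eq_Ex do rewrite mulr1; under [RHS]eq_Ex do rewrite mulr1.
- move=> A /sm mA h.
  have E Z : bmeas Z -> Ex P (fun w => Z w * \1_(~` A) w) = Ex P Z - Ex P (fun w => Z w * \1_A w).
    move=> bZ; rewrite -ExB//; last by apply: bmeasM => //; exact: bmeas_indic.
    apply: eq_Ex => w; rewrite !indicE in_setC.
    by case: (w \in A); rewrite /= ?mulr0 ?mulr1 ?subrr ?subr0.
  by rewrite !E// h XY.
- move=> A mA tA h.
  have mAk k : d.-measurable (A k) by apply: sm; exact: mA.
  have cv Z : bmeas Z -> \sum_(k < n) Ex P (fun w => Z w * \1_(A k) w) @[n --> \oo]
       --> Ex P (fun w => Z w * \1_(\bigcup_k A k) w).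
    move=> bZ; have [mZ [M ZM]] := bZ.
    have bA k : bmeas (fun w => Z w * \1_(A k) w).
      by apply: bmeasM => //; exact: bmeas_indic.
    under eq_fun do rewrite -Ex_sum//.
    have sE n w : \sum_(k < n) Z w * \1_(A k) w = Z w * \1_(\bigcup_(k < n) A k) w.
      rewrite -mulr_sumr; congr (_ * _).
      elim: n => [|n IH]; first by rewrite big_ord0 bigcup_mkord big_ord0 indic0.
      have -> : \bigcup_(k < n.+1) A k = \bigcup_(k < n) A k `|` A n.
        by rewrite !bigcup_mkord big_ord_recr.
      rewrite big_ord_recr/= IH !indicE in_setU.
      case: (boolP (w \in A n)) => wn; last by rewrite orbF addr0.
      rewrite orbT memNset ?add0r// => -[k kn wk].
      have kn' := tA k n I I (ex_intro _ w (conj wk (set_mem wn))).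
      by move: kn; rewrite /= kn' ltnn.
    apply: (@Ex_cvg _ _ _ _ _ _ M).
    + by move=> n; case: (@bmeas_sum _ _ _ _ (index_enum 'I_n) (fun k w => Z w * \1_(A k) w)).
    + apply: measurable_funM => //; apply: measurable_indic.
      exact: bigcupT_measurable.
    + move=> n w; rewrite sE normrM (le_trans _ (ZM w))// ler_piMr// indicE.
      by case: (_ \in _); rewrite /= ?normr1 ?normr0.
    + apply: aeW => w.
      under eq_fun do rewrite sE.
      apply: cvgMr; have [[k _ wk]|nw] := pselect ((\bigcup_k A k) w).
        apply: cvg_near_cst; near=> n; rewrite !indicE !mem_set//; first by exists k.
        by exists k => //=; near: n; exact: nbhs_infty_gt.
      apply: cvg_near_cst; near=> n; rewrite !indicE !memNset//.
      by move=> [k _ wk]; apply: nw; exists k.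
  apply: eq_cvgn_lim (cv X bX) (cv Y bY) _ => n.
  by apply: eq_bigr => k _; exact: h.
Unshelve. all: by end_near.
Qed.

End sub_sigma.

(** * Families of random variables: cylinders and generated sigma-algebras *)

Section families.
Context {d d'} {Omega : measurableType d} {R : realType} {P : probability Omega R}
  {T : measurableType d'} {I : choiceType}.
Implicit Types (X : I -> {RV P >-> T}) (D : set I).

Lemma preimage_measurable (f : {RV P >-> T}) A : measurable A -> measurable (f @^-1` A).
Proof. by move=> mA; rewrite -[X in measurable X]setTI; exact: measurable_funP. Qed.

Lemma joint_sigma_sigma_algebra D X : sigma_algebra setT (joint_sigma D X).
Proof. exact: smallest_sigma_algebra. Qed.

Lemma joint_sigmaS D1 D2 X : D1 `<=` D2 -> joint_sigma D1 X `<=` joint_sigma D2 X.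
Proof. by move=> D12; apply: sub_sigma_algebra2; exact: bigcup_subset. Qed.

Lemma joint_sigma_measurable D X : joint_sigma D X `<=` measurable.
Proof.
apply: sigma_algebra_gen_measurable => _ [i _ [A mA <-]].
by rewrite setTI; exact: preimage_measurable.
Qed.

Lemma joint_sigma_preimage D X i A : D i -> measurable A -> joint_sigma D X (X i @^-1` A).
Proof.
move=> Di mA; apply: sub_sigma_algebra; exists i => //.
by exists A => //; rewrite setTI.
Qed.

(** Exactly the events that [mutually_independent] speaks of: a pi-system generating
    [joint_sigma D X]. *)
Definition cylinder D X := [set C | exists (J : {fset I}) (A : I -> set T),
  [/\ [set` J] `<=` D, (forall i, measurable (A i)) &
      C = \bigcap_(i in [set` J]) X i @^-1` A i] ].

Lemma cylinder_setI D X : setI_closed (cylinder D X).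
Proof.
move=> _ _ [J1 [A1 [JD1 mA1 ->]]] [J2 [A2 [JD2 mA2 ->]]].
exists (J1 `|` J2)%fset, (fun i => (if i \in J1 then A1 i else setT) `&`
   (if i \in J2 then A2 i else setT)); split.
- by move=> i /=; rewrite in_fsetU => /orP[/JD1|/JD2].
- by move=> i; apply: measurableI; case: ifP.
apply/seteqP; split=> [w [h1 h2] i /= iJ|w h].
  by split; case: ifPn => // iJ'; [exact: h1|exact: h2].
split=> i /= iJ; have [] := h i; rewrite /= ?in_fsetU ?iJ ?orbT//.
Qed.

Lemma cylinder_measurable D X : cylinder D X `<=` measurable.
Proof.
move=> _ [J [A [_ mA ->]]]; apply: fin_bigcap_measurable => //.
by move=> i _; exact: preimage_measurable.
Qed.

Lemma cylinder_joint_sigma D X : cylinder D X `<=` joint_sigma D X.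
Proof.
move=> _ [J [A [JD mA ->]]].
pose TG := g_sigma_algebraType (\bigcup_(i in D) g_sigma_algebra_preimage (X i)).
apply: (@fin_bigcap_measurable _ TG) => //.
by move=> i iJ; apply: joint_sigma_preimage => //; exact: JD.
Qed.

Lemma gen_cylinder D X : <<s cylinder D X>> = joint_sigma D X.
Proof.
apply/seteqP; split.
  apply: smallest_sub; first exact: joint_sigma_sigma_algebra.
  exact: cylinder_joint_sigma.
apply: sub_sigma_algebra2 => _ [i Di [A mA <-]]; rewrite setTI.
exists [fset i]%fset, (fun=> A); split => //.
  by move=> j /=; rewrite in_fset1 => /eqP ->.
apply/seteqP; split=> [w h j /=|w /(_ i)]; first by rewrite in_fset1 => /eqP ->.
by apply; rewrite /= in_fset1.
Qed.

Lemma cylinder_indep D D1 D2 X C1 C2 : mutually_independent D X ->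
  D1 `<=` D -> D2 `<=` D -> D1 `&` D2 = set0 ->
  cylinder D1 X C1 -> cylinder D2 X C2 -> P (C1 `&` C2) = (P C1 * P C2)%E.
Proof.
move=> indX D1D D2D D120 [J1 [A1 [JD1 mA1 ->]]] [J2 [A2 [JD2 mA2 ->]]].
(* The index sets are disjoint, so the two families of sets glue to a single one, to which mutual
   independence applies. *)
pose A i := if i \in J1 then A1 i else A2 i.
have A1E i : i \in J1 -> A i = A1 i by rewrite /A => ->.
have J12 i : i \in J2 -> i \notin J1.
  move=> /JD2 D2i; apply/negP => /JD1 D1i.
  by have : (D1 `&` D2) i by []; rewrite D120.
have A2E i : i \in J2 -> A i = A2 i by move=> /J12; rewrite /A => /negbTE ->.
have -> : \bigcap_(i in [set` J1]) X i @^-1` A1 i `&` \bigcap_(i in [set` J2]) X i @^-1` A2 i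
    = \bigcap_(i in [set` (J1 `|` J2)%fset]) X i @^-1` A i.
  apply/seteqP; split=> [w [h1 h2] i /=|w h].
    by rewrite in_fsetU => /orP[iJ|iJ]; [rewrite A1E//; exact: h1|rewrite A2E//; exact: h2].
  split=> i /= iJ; have := h i; rewrite /= in_fsetU iJ ?orbT.
    by rewrite A1E//; exact.
  by rewrite A2E//; exact.
have mA i : measurable (A i) by rewrite /A; case: ifP.
have JD : [set` (J1 `|` J2)%fset] `<=` D.
  by move=> i /=; rewrite in_fsetU => /orP[/JD1/D1D|/JD2/D2D].
rewrite (indX _ _ JD mA) (indX _ _ (subset_trans JD1 D1D) mA1).
rewrite (indX _ _ (subset_trans JD2 D2D) mA2) -EFinM; congr EFin.
rewrite (perm_big (enum_fset J1 ++ enum_fset J2))/=; last first.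
  apply: uniq_perm; first exact: fset_uniq.
    rewrite cat_uniq !fset_uniq andbT/=; apply/hasPn => i; exact: J12.
  by move=> i; rewrite mem_cat in_fsetU.
rewrite big_cat/=; congr (_ * _); rewrite big_seq [RHS]big_seq; apply: eq_bigr => i iJ.
  by rewrite A1E.
by rewrite A2E.
Qed.

Lemma joint_sigma_indep D D1 D2 X : mutually_independent D X ->
  D1 `<=` D -> D2 `<=` D -> D1 `&` D2 = set0 ->
  independent_sigma P (joint_sigma D1 X) (joint_sigma D2 X).
Proof.
move=> indX D1D D2D D120.
(* With [B] fixed, the product rule is an equality of [E[1_B 1_A]] and [E[P(B) 1_A]], so [Ex_pi]
   extends it in [A]; this is done for one argument after the other. *)
have ext (E : set I) (B : set Omega) : measurable B ->
    (forall A, cylinder E X A -> P (A `&` B) = (P A * P B)%E) ->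
    forall A, joint_sigma E X A -> P (A `&` B) = (P A * P B)%E.
  move=> mB h A EA.
  have key A' : measurable A' -> (P (A' `&` B) = (P A' * P B)%E) <->
      Ex P (fun w => \1_B w * \1_A' w) = Ex P (fun w => pr P B * \1_A' w).
    move=> mA'.
    have -> : Ex P (fun w => \1_B w * \1_A' w) = pr P (A' `&` B).
      rewrite -Ex_indic; last exact: measurableI.
      by apply: eq_Ex => w; rewrite indicI/= mulrC.
    rewrite (ExZ _ _ (bmeas_indic mA')) Ex_indic// !prE//; last exact: measurableI.
    by rewrite -EFinM mulrC; split=> [[]//|->].
  apply/key; first exact: joint_sigma_measurable EA.
  apply: (Ex_pi (cylinder_setI (D:=E) (X:=X))).
  - exact: cylinder_measurable.
  - exact: bmeas_indic.
  - exact: bmeas_cst.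
  - by rewrite Ex_indic// Ex_cst.
  - by move=> A' cA'; apply/key; [exact: cylinder_measurable cA'|exact: h].
  - by rewrite gen_cylinder.
move=> A B; move: A.
have comm A B' : P (A `&` B') = (P A * P B')%E <-> P (B' `&` A) = (P B' * P A)%E.
  by rewrite setIC muleC.
move=> A DA DB.
apply: (ext D1 B _ _ A DA); first exact: joint_sigma_measurable DB.
move=> A' cA'; apply/comm.
apply: (ext D2 A' _ _ B DB); first exact: cylinder_measurable cA'.
by move=> B' cB'; apply/comm; exact: cylinder_indep indX D1D D2D D120 cA' cB'.
Qed.

End families.

Lemma smeas_comp {d} {Omega : measurableType d} {R : realType} (F : set (set Omega))
    (g : R -> R) (f : Omega -> R) : measurable_fun setT g -> smeas F f -> smeas F (g \o f).
Proof.
move=> mg Ff B mB; rewrite comp_preimage; apply: Ff.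
by rewrite -[X in measurable X]setTI; exact: mg.
Qed.

Section expectation_product.
Context {d d'} {Omega : measurableType d} {R : realType} {P : probability Omega R}
  {T : measurableType d'} {I : choiceType}.

Lemma joint_sigma_smeas (D : set I) (X : I -> {RV P >-> R}) i :
  D i -> smeas (joint_sigma D X) (X i).
Proof. by move=> Di B mB; exact: joint_sigma_preimage. Qed.

Lemma smeas_prod (F : set (set Omega)) (J : eqType) (s : seq J) (f : J -> Omega -> R) :
  sigma_algebra setT F -> (forall i, i \in s -> smeas F (f i)) ->
  smeas F (fun w => \prod_(i <- s) f i w).
Proof.
move=> sF; rewrite -(sigma_algebra_id sF) => Ff.
apply/smeasP; elim: s Ff => [|i s IH] Ff.
  by under eq_fun do rewrite big_nil; exact: measurable_cst.
under eq_fun do rewrite big_cons; apply: measurable_funM.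
  by apply/smeasP; apply: Ff; rewrite mem_head.
by apply: IH => j js; apply: Ff; rewrite inE js orbT.
Qed.

Lemma Ex_prod_indep (D : set I) (X : I -> {RV P >-> T}) (f : I -> Omega -> R) (s : seq I) :
  mutually_independent D X -> uniq s -> [set` s] `<=` D -> (forall i, bmeas (f i)) ->
  (forall i, smeas (joint_sigma [set i] X) (f i)) ->
  Ex P (fun w => \prod_(i <- s) f i w) = \prod_(i <- s) Ex P (f i).
Proof.
move=> indX + + bf Xf; elim: s => [|i s IH].
  by move=> _ _; rewrite big_nil; under eq_fun do rewrite big_nil; exact: Ex_cst.
move=> /= /andP[his us] sD.
rewrite big_cons -IH//; last by move=> j /= js; apply: sD => /=; rewrite inE js orbT.
under eq_fun do rewrite big_cons.
have Di : D i by apply: sD => /=; rewrite mem_head.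
apply: (Ex_indep (joint_sigma_sigma_algebra [set i] X) (joint_sigma_sigma_algebra [set` s] X)).
- exact: joint_sigma_measurable.
- exact: joint_sigma_measurable.
- apply: joint_sigma_indep indX _ _ _.
  + by move=> j ->.
  + by move=> j js; apply: sD => /=; rewrite inE; apply/orP; right.
  + by rewrite -subset0 => j [-> /= js]; rewrite js in his.
- exact: Xf.
- exact: bf.
- apply: smeas_prod; first exact: joint_sigma_sigma_algebra.
  by move=> j js B mB; apply: (joint_sigmaS _ (Xf j B mB)) => ? ->.
- exact: bmeas_prod.
Qed.

End expectation_product.

(** * Approximation by sets of a sub-sigma-algebra *)

Section approximation.
Context {d} {Omega : measurableType d} {R : realType} (P : probability Omega R).
Implicit Types (A B : set Omega) (F : set (set Omega)).

(** The probability of the symmetric difference, written as an L1 distance so that the triangle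
    inequality and dominated convergence apply. *)
Definition sdist A B : R := Ex P (fun w => `|\1_A w - \1_B w|).

(* For a sigma-algebra [F] this is its completion among measurable sets; for a
   set algebra it contains the generated sigma-algebra. *)
Definition approx F := [set A | measurable A /\
  forall e : R, 0 < e -> exists2 A', F A' & sdist A A' <= e].

Definition set_algebra F :=
  [/\ F set0, setC_closed F, setU_closed F & F `<=` measurable].

Lemma sigma_set_algebra F : sigma_algebra setT F -> F `<=` measurable -> set_algebra F.
Proof.
move=> sF Fm; rewrite -(sigma_algebra_id sF) in Fm *; split => //.
- exact: sigma_algebra0.
- exact: sigma_algebraC.
- by move=> A B; apply: (@measurableU _ (g_sigma_algebraType F)).
Qed.

Lemma bmeas_sdist A B : measurable A -> measurable B ->
  bmeas (fun w => `|\1_A w - \1_B w| : R).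
Proof. by move=> mA mB; apply: bmeas_norm; apply: bmeasB; exact: bmeas_indic. Qed.

Lemma sdistxx A : sdist A A = 0.
Proof. by rewrite /sdist; under eq_Ex do rewrite subrr normr0; exact: Ex_cst. Qed.

Lemma sdist_triangle B A C : measurable A -> measurable B -> measurable C ->
  sdist A C <= sdist A B + sdist B C.
Proof.
move=> mA mB mC; rewrite /sdist -ExD; [|exact: bmeas_sdist..].
apply: Ex_le; [exact: bmeas_sdist|by apply: bmeasD; exact: bmeas_sdist|].
by move=> w; exact: ler_distD.
Qed.

Lemma sub_approx F : F `<=` measurable -> F `<=` approx F.
Proof.
by move=> Fm A FA; split; [exact: Fm|move=> e e0; exists A => //; rewrite sdistxx ltW].
Qed.

Lemma approxS F G : F `<=` G -> approx F `<=` approx G.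
Proof.
move=> FG A [mA h]; split => // e /h[A' FA' AA']; exists A' => //; exact: FG.
Qed.

Lemma approx_setC F : set_algebra F -> setC_closed (approx F).
Proof.
move=> [_ FC _ _] A [mA h]; split; first exact: measurableC.
move=> e /h[A' FA' AA']; exists (~` A'); first exact: FC.
apply: le_trans AA'; rewrite le_eqVlt; apply/orP; left; apply/eqP.
apply: eq_Ex => w; rewrite !indicE !in_setC.
by case: (w \in A); case: (w \in A'); rewrite /= ?subrr// distrC.
Qed.

Lemma approx_setU F : set_algebra F -> setU_closed (approx F).
Proof.
move=> [_ _ FU Fm] A B [mA hA] [mB hB]; split; first exact: measurableU.
move=> e e0; have e20 : 0 < e / 2 by rewrite divr_gt0.
have [A' FA' AA'] := hA _ e20; have [B' FB' BB'] := hB _ e20.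
exists (A' `|` B'); first exact: FU.
rewrite [leRHS]splitr; apply: le_trans (lerD AA' BB').
have mA' := Fm _ FA'; have mB' := Fm _ FB'.
rewrite /sdist -ExD; [|exact: bmeas_sdist..].
apply: Ex_le.
- by apply: bmeas_sdist; exact: measurableU.
- by apply: bmeasD; exact: bmeas_sdist.
move=> w; rewrite !indicE !in_setU.
case: (w \in A); case: (w \in B); case: (w \in A'); case: (w \in B') => /=;
  rewrite ?subrr ?subr0 ?sub0r ?normrN ?normr0 ?normr1; lra.
Qed.

(** For a countable union, the finite unions are approximable and converge to it in [sdist] by
    dominated convergence. *)
Lemma approx_sigma_algebra F : set_algebra F -> sigma_algebra setT (approx F).
Proof.
move=> aF; have [F0 FC FU Fm] := aF; split.
- exact: sub_approx.
- by move=> A; rewrite setTD; exact: approx_setC.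
- move=> A aA; have mA k : measurable (A k) by case: (aA k).
  have mUA : measurable (\bigcup_k A k) by exact: bigcupT_measurable.
  split => // e e0; pose B n := \bigcup_(k < n) A k.
  have aB n : approx F (B n).
    rewrite /B; elim: n => [|n IH].
      by rewrite bigcup_mkord big_ord0; exact: sub_approx.
    rewrite bigcup_mkord big_ord_recr/= -bigcup_mkord.
    exact: approx_setU.
  have cv : sdist (\bigcup_k A k) (B n) @[n --> \oo] --> (0 : R).
    rewrite -(Ex_cst P 0).
    apply: (@Ex_cvg _ _ _ _ _ _ 1) => //.
    + by move=> n; have [] := bmeas_sdist mUA (aB n).1.
    + move=> n w; rewrite normr_id !indicE.
      by case: (_ \in _); case: (_ \in _); rewrite /= ?subrr ?subr0 ?sub0r ?normrN ?normr0 ?normr1.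
    + apply: aeW => w; have [[k _ wk]|nw] := pselect ((\bigcup_k A k) w).
        apply: cvg_near_cst; near=> n; rewrite !indicE !mem_set ?subrr ?normr0//; last by exists k.
        by exists k => //=; near: n; exact: nbhs_infty_gt.
      apply: cvg_near_cst; near=> n; rewrite !indicE !memNset ?subrr ?normr0//.
      by move=> [k _ wk]; apply: nw; exists k.
  have e20 : 0 < e / 2 by rewrite divr_gt0.
  have /cvgrPdist_le /(_ _ e20)[n _ /(_ n (leqnn n))] := cv; rewrite /= sub0r normrN => hn.
  have [A' FA' BA'] := (aB n).2 _ e20; exists A' => //.
  apply: (le_trans (sdist_triangle mUA (aB n).1 (Fm _ FA'))).
  by rewrite [leRHS]splitr lerD// (le_trans _ hn)// ler_norm.
Unshelve. all: by end_near.
Qed.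

Lemma approx_gen F : set_algebra F -> <<s F>> `<=` approx F.
Proof.
move=> aF; apply: smallest_sub; first exact: approx_sigma_algebra.
by case: aF => _ _ _; exact: sub_approx.
Qed.

Lemma sdist_pr A A' : measurable A -> measurable A' ->
  `|pr P A - pr P A'| <= sdist A A'.
Proof.
move=> mA mA'; rewrite -!Ex_indic// -ExB; [|exact: bmeas_indic..].
by apply: Ex_norm; apply: bmeasB; exact: bmeas_indic.
Qed.

(** Both sides of the product rule are continuous in [A] for [sdist]. *)
Lemma approx_indep F B : F `<=` measurable -> measurable B ->
  (forall A, F A -> P (A `&` B) = (P A * P B)%E) ->
  forall A, approx F A -> P (A `&` B) = (P A * P B)%E.
Proof.
move=> Fm mB h A [mA aA].
have mI C : measurable C -> measurable (C `&` B) by move=> mC; exact: measurableI.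
rewrite !prE//; last exact: mI.
rewrite -EFinM; congr EFin.
apply/eqP; rewrite -subr_eq0 -normr_eq0 eq_le normr_ge0 andbT.
apply/ler_addgt0Pr => e e0; rewrite add0r.
have [A' FA' AA'] := aA _ (divr_gt0 e0 (ltr0Sn R 1)).
have mA' := Fm _ FA'.
have hA' : pr P (A' `&` B) = pr P A' * pr P B.
  by have := h _ FA'; rewrite !prE//; [move=> []|exact: mI].
have h1 : `|pr P (A `&` B) - pr P (A' `&` B)| <= e / 2.
  apply: le_trans (sdist_pr (mI _ mA) (mI _ mA')) _; apply: le_trans AA'.
  apply: Ex_le; [apply: bmeas_sdist; exact: mI|exact: bmeas_sdist|].
  move=> w; rewrite !indicI/= -mulrBl normrM ler_piMr// indicE.
  by case: (_ \in _); rewrite /= ?normr0 ?normr1.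
have h2 : `|pr P (A' `&` B) - pr P A * pr P B| <= e / 2.
  rewrite hA' -mulrBl normrM (le_trans _ AA')//.
  rewrite (@le_trans _ _ (`|pr P A' - pr P A|))//.
    by rewrite ler_piMr// ger0_norm ?pr_ge0 ?pr_le1.
  by rewrite distrC sdist_pr.
by rewrite [leRHS]splitr (le_trans (ler_distD (pr P (A' `&` B)) _ _))// lerD.
Qed.

(** The event [f > t] is approximated by [g > t + dl]. They differ only if [f] lies in []t, t + 2 *
    dl]], which is unlikely for small [dl], or if [f] and [g] are at least [dl] apart, which is
    controlled by Markov's inequality. *)
Lemma smeas_approx F (f : Omega -> R) : sigma_algebra setT F -> F `<=` measurable ->
  bmeas f ->
  (forall e, 0 < e -> exists2 g, smeas F g /\ bmeas g & Ex P (fun w => `|f w - g w|) <= e) ->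
  smeas (approx F) f.
Proof.
move=> sF Fm bf hf.
have aF := approx_sigma_algebra (sigma_set_algebra sF Fm).
rewrite -(sigma_algebra_id aF); apply/smeasP.
apply: (measurability _ (@RGenOInfty.measurableE R)) => _ [_ [t ->] <-].
rewrite setTI; apply: sub_sigma_algebra.
have mf (B : set R) : measurable B -> measurable (f @^-1` B).
  by move=> mB; rewrite -[X in measurable X]setTI; exact: bf.1.
split=> [|e e0]; first exact: mf.
(* These intervals decrease to the empty set as [n] grows. *)
have cv : pr P (f @^-1` `]t, t + 2 * n.+1%:R^-1]) @[n --> \oo] --> (0 : R).
  have mI n : measurable (f @^-1` `]t, t + 2 * n.+1%:R^-1]) by apply: mf; exact: measurable_itv.
  under eq_fun do rewrite -Ex_indic//.
  rewrite -(Ex_cst P 0).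
  apply: (@Ex_cvg _ _ _ _ _ _ 1) => //.
  - by move=> n w; rewrite indicE; case: (_ \in _); rewrite /= ?normr0 ?normr1.
  - apply: aeW => w; apply: cvg_near_cst; near=> n; rewrite indicE memNset//=.
    rewrite in_itv/= => /andP[tf].
    apply/negP; rewrite -ltNge -ltrBrDl -ltr_pdivlMl// mulrC.
    rewrite invf_plt ?posrE// ?divr_gt0 ?subr_gt0//.
    near: n; apply: filterS (nbhs_infty_gtr ((f w - t) / 2)^-1) => n.
    by move=> /lt_trans; apply; rewrite ltr_nat.
have e20 : 0 < e / 2 by rewrite divr_gt0.
have /cvgrPdist_le /(_ _ e20)[n _ /(_ n (leqnn n))] := cv; rewrite /= sub0r normrN => hn.
set dl := n.+1%:R^-1 in hn; have dl0 : 0 < dl by rewrite invr_gt0.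
have [g [Fg bg] fg] := hf _ (mulr_gt0 dl0 e20).
exists (g @^-1` `]t + dl, +oo[); first by apply: Fg; exact: measurable_itv.
have mg (B : set R) : measurable B -> measurable (g @^-1` B).
  by move=> mB; rewrite -[X in measurable X]setTI; exact: bg.1.
have mS : measurable (f @^-1` `]t, t + 2 * dl]) by exact: mf.
have bfg : bmeas (fun w => `|f w - g w|) by apply: bmeas_norm; exact: bmeasB.
have bfg' : bmeas (fun w => dl^-1 * `|f w - g w|) by apply: bmeasM => //; exact: bmeas_cst.
apply: (@le_trans _ _ (Ex P (fun w => \1_(f @^-1` `]t, t + 2 * dl]) w + dl^-1 * `|f w - g w|))).
  apply: Ex_le.
  - by apply: bmeas_sdist; [exact: mf|exact: mg].
  - by apply: bmeasD => //; exact: bmeas_indic.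
  move=> w.
  have k0 : 0 <= dl^-1 * `|f w - g w| by rewrite mulr_ge0// invr_ge0 ltW.
  have k1 : dl <= `|f w - g w| -> 1 <= dl^-1 * `|f w - g w|.
    by move=> h; rewrite -ler_pdivrMl ?invr_gt0// invrK mulr1.
  rewrite !indicE; set a := (w \in f @^-1` `]t, +oo[); set b := (w \in g @^-1` _).
  set c := (w \in f @^-1` `]t, t + _]).
  have aE : a = (t < f w) by rewrite /a; apply/idP/idP; rewrite inE /= in_itv/= andbT.
  have bE : b = (t + dl < g w) by rewrite /b; apply/idP/idP; rewrite inE /= in_itv/= andbT.
  have cE : c = (t < f w <= t + 2 * dl) by rewrite /c; apply/idP/idP; rewrite inE /= in_itv/=.
  rewrite aE bE cE.
  have n1 := ler_norm (f w - g w); have n2 := ler_norm (g w - f w).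
  rewrite distrC in n2.
  case: (ltP t (f w)) => /= h1; case: (ltP (t + dl) (g w)) => /= h2.
  - by rewrite subrr normr0 addr_ge0.
  - rewrite subr0 normr1; case: (leP (f w) (t + 2 * dl)) => h3; first by rewrite lerDl.
    by rewrite add0r; apply: k1; lra.
  - by rewrite sub0r normrN normr1 add0r; apply: k1; lra.
  - by rewrite subrr normr0 add0r.
rewrite ExD//; last exact: bmeas_indic.
rewrite Ex_indic// ExZ// [leRHS]splitr lerD//; first by rewrite (le_trans (ler_norm _)).
by rewrite ler_pdivrMl.
Unshelve. all: by end_near.
Qed.

End approximation.

(** * Variables that depend on disjoint blocks of an independent family *)

Section approximation_families.
Context {d d'} {Omega : measurableType d} {R : realType} {P : probability Omega R}
  {T : measurableType d'} {I I' : choiceType}.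
Variables (X : I -> {RV P >-> T}) (D : set I) (Y : I' -> {RV P >-> R}) (E : set I')
  (block : I' -> set I).
Hypotheses (indX : mutually_independent D X)
  (blockD : forall i, E i -> block i `<=` D)
  (Yblock : forall i, E i -> smeas (approx P (joint_sigma (block i) X)) (Y i)).

Lemma approx_joint_sigma_sigma_algebra (B : set I) :
  sigma_algebra setT (approx P (joint_sigma B X)).
Proof.
apply: approx_sigma_algebra; apply: sigma_set_algebra.
  exact: joint_sigma_sigma_algebra.
exact: joint_sigma_measurable.
Qed.

Lemma approx_joint_sigma (F : set I') : F `<=` E ->
  joint_sigma F Y `<=` approx P (joint_sigma (\bigcup_(i in F) block i) X).
Proof.
move=> FE; apply: smallest_sub; first exact: approx_joint_sigma_sigma_algebra.
move=> _ [i Fi [A mA <-]]; rewrite setTI.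
apply: (approxS _ (Yblock (FE _ Fi) mA)).
by apply: joint_sigmaS => j ij; exists i.
Qed.

Lemma approx_independent (B C : set I) : B `<=` D -> C `<=` D -> B `&` C = set0 ->
  independent_sigma P (approx P (joint_sigma B X)) (approx P (joint_sigma C X)).
Proof.
move=> BD CD BC; have ind := joint_sigma_indep indX BD CD BC.
move=> A A' aA aA'; apply: (approx_indep (joint_sigma_measurable (X:=X)) aA'.1 _ aA) => {aA}A BA.
have mA := joint_sigma_measurable BA.
rewrite setIC muleC; apply: (approx_indep (joint_sigma_measurable (X:=X)) mA _ aA') => {aA'}A' CA'.
by rewrite setIC muleC; exact: ind.
Qed.

Hypothesis block_disjoint : forall i j, E i -> E j -> i != j -> block i `&` block j = set0.

Lemma approx_mutually_independent : mutually_independent E Y.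
Proof.
move=> J A JE mA.
(* The induction also carries that the intersection belongs to the union of its blocks up to null
   sets: this makes it independent of the next block. *)
suff h (s : seq I') : uniq s -> [set` s] `<=` E ->
    approx P (joint_sigma (\bigcup_(i in [set` s]) block i) X)
      (\bigcap_(i in [set` s]) Y i @^-1` A i) /\
    P (\bigcap_(i in [set` s]) Y i @^-1` A i) = (\prod_(i <- s) fine (P (Y i @^-1` A i)))%:E.
  by have [] := h (enum_fset J) (fset_uniq J) JE.
elim: s => [|i s IH] /=.
  move=> _ _; have -> : \bigcap_(i in [set` [::]]) Y i @^-1` A i = setT.
    by apply/seteqP; split => // w _ i.
  rewrite big_nil probability_setT; split => //.
  have [h0 hC _] := approx_joint_sigma_sigma_algebra (\bigcup_(i in [set` [::]]) block i).
  by rewrite -(setD0 setT); exact: hC.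
move=> /andP[his us] sE.
have sE' : [set` s] `<=` E by move=> j js; apply: sE; rewrite /= inE; apply/orP; right.
have Ei : E i by apply: sE; rewrite /= mem_head.
have [ap Ps] := IH us sE'.
have capE : \bigcap_(j in [set` i :: s]) Y j @^-1` A j =
    (Y i @^-1` A i) `&` \bigcap_(j in [set` s]) Y j @^-1` A j.
  apply/seteqP; split=> [w h|w [h1 h2] j /=].
    by split=> [|j /= js]; apply: h; rewrite /= inE ?eqxx// js orbT.
  by rewrite inE => /orP[/eqP ->|]//; exact: h2.
have ai := Yblock Ei (mA i).
have blocks_cons : \bigcup_(j in [set` s]) block j `<=` \bigcup_(j in [set` i :: s]) block j.
  by move=> x [j js xj]; exists j => //=; rewrite inE; apply/orP; right.
split.
  rewrite capE.
  pose G := joint_sigma (\bigcup_(j in [set` i :: s]) block j) X.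
  have [a1 a2] : approx P G (Y i @^-1` A i) /\ approx P G (\bigcap_(j in [set` s]) Y j @^-1` A j).
    split; last by apply: (approxS _ ap); exact: joint_sigmaS.
    apply: (approxS _ ai); apply: joint_sigmaS => x xi.
    by exists i => //=; rewrite mem_head.
  have sG := approx_joint_sigma_sigma_algebra (\bigcup_(j in [set` i :: s]) block j).
  rewrite -(sigma_algebra_id sG) in a1 a2 *.
  exact: (@measurableI _ (g_sigma_algebraType (approx P G))).
have Dblocks : \bigcup_(j in [set` s]) block j `<=` D by move=> x [j /sE' Ej]; exact: blockD.
have disj : block i `&` \bigcup_(j in [set` s]) block j = set0.
  rewrite -subset0 => x [xi [j /= js xj]].
  have ij : i != j by apply: contraNneq his => ->.
  have : (block i `&` block j) x by [].
  by rewrite (block_disjoint Ei (sE' _ js) ij).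
rewrite capE (approx_independent (blockD Ei) Dblocks disj ai ap) Ps big_cons EFinM.
by rewrite fineK// fin_num_measure//; case: ai.
Qed.

End approximation_families.

(** * Generating functions *)

(* Unlike [prod_ext], infinite products count as 0: this is what they are
   almost surely for independent factors of mean [m < 1]. *)
Definition prod_fin {R : realType} (n : option nat) (x : nat -> R) : R :=
  if n is Some k then \prod_(i < k) x i else 0.

Section option_nat.
Context {d} {T : measurableType d} {R : realType}.

Lemma measurable_option_case (N : T -> option nat) (G : option nat -> T -> R) :
  measurable_fun setT N -> (forall o, measurable_fun setT (G o)) ->
  measurable_fun setT (fun w => G (N w) w).
Proof.
move=> mN mG _ B mB; rewrite setTI.
pose o k : option nat := if k is k'.+1 then Some k' else None.
rewrite (_ : _ @^-1` _ = \bigcup_k (N @^-1` [set o k] `&` G (o k) @^-1` B)); last first.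
  apply/seteqP; split=> [w h|w [k _ [/= <-]]//].
  exists (if N w is Some k then k.+1 else 0%N) => //.
  by have : o (if N w is Some k then k.+1 else 0%N) = N w; [case: (N w)|move=> ->].
apply: bigcupT_measurable => k; apply: measurableI.
  by rewrite -[X in measurable X]setTI; exact: mN.
by rewrite -[X in measurable X]setTI; exact: mG.
Qed.

Lemma measurable_prod I (s : seq I) (F : I -> T -> R) :
  (forall i, measurable_fun setT (F i)) -> measurable_fun setT (fun w => \prod_(i <- s) F i w).
Proof.
move=> mF; elim: s => [|i s IH].
  by under eq_fun do rewrite big_nil; exact: measurable_cst.
by under eq_fun do rewrite big_cons; exact: measurable_funM.
Qed.

Lemma measurable_prod_fin (N : T -> option nat) (Y : nat -> T -> R) :
  measurable_fun setT N -> (forall i, measurable_fun setT (Y i)) ->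
  measurable_fun setT (fun w => prod_fin (N w) (Y ^~ w)).
Proof.
move=> mN mY; apply: (@measurable_option_case N (fun o w => prod_fin o (Y ^~ w))) => // -[k|] /=.
  by apply: measurable_prod.
exact: measurable_cst.
Qed.

Lemma prod_fin01 n (x : nat -> R) : (forall i, 0 <= x i <= 1) -> 0 <= prod_fin n x <= 1.
Proof.
move=> x01; case: n => [k|] /=; last by rewrite lexx ler01.
apply/andP; split; first by apply: prodr_ge0 => i _; case/andP: (x01 i).
  by apply: prodr_ile1 => i _.
Qed.

End option_nat.

Section pieces.
Context {d} {Omega : measurableType d} {R : realType} (P : probability Omega R).
Variable N : {RV P >-> option nat}.
Implicit Types f g : Omega -> R.

Lemma measurable_fiber (A : set (option nat)) : measurable (N @^-1` A).
Proof. exact: preimage_measurable. Qed.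

Lemma Ex_series f : bmeas f -> (forall w, N w = None -> f w = 0) ->
  \sum_(k < n) Ex P (fun w => f w * \1_(N @^-1` [set Some (val k)]) w) @[n --> \oo] --> Ex P f.
Proof.
move=> bf f0; have [mf [M fM]] := bf.
have bk k : bmeas (fun w => f w * \1_(N @^-1` [set Some k]) w).
  by apply: bmeasM => //; apply: bmeas_indic; exact: measurable_fiber.
have -> : (fun n => \sum_(k < n) Ex P (fun w => f w * \1_(N @^-1` [set Some (val k)]) w))
    = (fun n => Ex P (fun w => \sum_(k < n) f w * \1_(N @^-1` [set Some (val k)]) w)).
  by apply/funext => n; rewrite Ex_sum.
have sE n w : \sum_(k < n) f w * \1_(N @^-1` [set Some (val k)]) w =
    if N w is Some k then if (k < n)%N then f w else 0 else 0.
  case NE : (N w) => [j|]; last first.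
    by rewrite big1// => k _; rewrite (f0 _ NE) mul0r.
  rewrite -mulr_sumr; case: ifPn => jn.
    rewrite (bigD1 (Ordinal jn))//= big1 => [|i ij].
      by rewrite indicE mem_set ?addr0 ?mulr1.
    rewrite indicE memNset//= NE => -[ji]; move/eqP: ij; apply.
    by apply: val_inj; rewrite /= ji.
  rewrite big1 ?mulr0// => i _; rewrite indicE memNset//= NE => -[ji].
  by move: jn; rewrite ji ltn_ord.
apply: (@Ex_cvg _ _ _ _ _ _ M) => //.
- by move=> n; case: (@bmeas_sum _ _ _ _ (index_enum 'I_n) (fun k w => f w * \1_(N @^-1` [set Some (val k)]) w)).
- move=> n w; rewrite sE; have M0 : 0 <= M by exact: le_trans (fM w).
  by case: (N w) => [k|]; [case: ifP => _|]; rewrite ?normr0.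
- apply: aeW => w; apply: cvg_near_cst; case NE : (N w) => [k|].
    by near=> n; rewrite sE NE ifT//; near: n; exact: nbhs_infty_gt.
  by apply: nearW => n; rewrite sE NE f0.
Unshelve. all: by end_near.
Qed.

(** The law of total expectation over the values of [N]. The value [None] is split off because
    [Ex_series] sums over finite values only. *)
Lemma Ex_pieces f g : bmeas f -> bmeas g ->
  (forall o, Ex P (fun w => f w * \1_(N @^-1` [set o]) w) =
             Ex P (fun w => g w * \1_(N @^-1` [set o]) w)) ->
  Ex P f = Ex P g.
Proof.
move=> bf bg fg.
have b1 o : bmeas (\1_(N @^-1` [set o]) : Omega -> R).
  by apply: bmeas_indic; exact: measurable_fiber.
have bn (h : Omega -> R) : bmeas h -> bmeas (fun w => h w * (1 - \1_(N @^-1` [set None]) w)).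
  by move=> bh; apply: bmeasM => //; apply: bmeasB; [exact: bmeas_cst|exact: b1].
have sp (h : Omega -> R) : bmeas h -> Ex P h = Ex P (fun w => h w * \1_(N @^-1` [set None]) w) +
    Ex P (fun w => h w * (1 - \1_(N @^-1` [set None]) w)).
  move=> bh; rewrite -ExD; [|exact: bmeasM|exact: bn].
  by apply: eq_Ex => w; ring.
rewrite (sp _ bf) (sp _ bg) fg; congr (_ + _).
have h0 (h : Omega -> R) w : N w = None -> h w * (1 - \1_(N @^-1` [set None]) w) = 0 :> R.
  by move=> NE; rewrite indicE mem_set ?subrr ?mulr0.
have hk (h : Omega -> R) k w : h w * (1 - \1_(N @^-1` [set None]) w) * \1_(N @^-1` [set Some k]) w =
    h w * \1_(N @^-1` [set Some k]) w :> R.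
  rewrite !indicE; have [NE|NE] := pselect (N w = Some k); last first.
    by rewrite (memNset (A:=N @^-1` [set Some k]))// !mulr0.
  by rewrite (memNset (A:=N @^-1` [set None])) ?subr0 ?mulr1//= NE.
apply: (eq_cvgn_lim (Ex_series (bn _ bf) (h0 f)) (Ex_series (bn _ bg) (h0 g)) _) => n.
apply: eq_bigr => k _; under eq_Ex do rewrite hk; under [RHS]eq_Ex do rewrite hk.
exact: fg.
Qed.

End pieces.

Section generating_function.
Context {d} {Omega : measurableType d} {R : realType} {P : probability Omega R}.
Implicit Types N : {RV P >-> option nat}.

Lemma pgfE N s : pgf N s = Ex P (fun w => pow_ext s (N w)).
Proof. by rewrite /pgf unlock. Qed.

Lemma pow_ext01 (s : R) n : 0 <= s <= 1 -> 0 <= pow_ext s n <= 1.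
Proof.
move=> /andP[s0 s1]; case: n => [k|] /=; first by rewrite exprn_ge0// exprn_ile1.
by case: (s == 1); rewrite /= ?lexx ?ler01.
Qed.

Lemma bmeas_pow_ext N (s : R) : 0 <= s <= 1 -> bmeas (fun w => pow_ext s (N w)).
Proof.
move=> s01; apply: bmeas01 => [|w]; last exact: pow_ext01.
by apply: (@measurable_option_case _ _ _ N (fun o _ => pow_ext s o)).
Qed.

Lemma pgf_le N (s t : R) : 0 <= s -> s <= t -> t < 1 -> pgf N s <= pgf N t.
Proof.
move=> s0 st t1; have s1 := le_lt_trans st t1.
rewrite !pgfE; apply: Ex_le.
- by apply: bmeas_pow_ext; rewrite s0 ltW.
- by apply: bmeas_pow_ext; rewrite (le_trans s0)// ltW.
move=> w; case: (N w) => [k|] /=; first by rewrite lerXn2r// nnegrE// (le_trans s0).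
by rewrite !lt_eqF.
Qed.

Lemma pgf0 N : {ae P, forall w, N w <> Some 0%N} -> pgf N 0 = 0.
Proof.
move=> N0; rewrite pgfE -[RHS](Ex_cst P 0); apply: Ex_ae => //.
  by have [] := @bmeas_pow_ext N 0 (introT andP (conj (lexx 0) ler01)).
by apply: filterS N0 => w; case: (N w) => [[|k]|] //= _; rewrite ?expr0n// eq_sym oner_eq0.
Qed.

Definition pmf_fin N k : R := pr P (N @^-1` [set Some k]).

Lemma pmf_fin01 N k : 0 <= pmf_fin N k <= 1.
Proof. by rewrite pr_ge0 pr_le1//; exact: measurable_fiber. Qed.

(** Since [m < 1], [pow_ext m None] is 0, in accordance with the convention of [prod_fin]; it
    remains to sum over the finite values of [N]. *)
Lemma pgf_prod_fin N (Y : nat -> Omega -> R) (m : R) : 0 <= m < 1 ->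
  (forall i, bmeas (Y i)) -> bmeas (fun w => prod_fin (N w) (Y ^~ w)) ->
  (forall k, Ex P (fun w => \prod_(i < k) Y i w * \1_(N @^-1` [set Some k]) w) =
     m ^+ k * pmf_fin N k) ->
  Ex P (fun w => prod_fin (N w) (Y ^~ w)) = pgf N m.
Proof.
move=> /andP[m0 m1] bY bpr h.
have f0 w : N w = None -> prod_fin (N w) (Y ^~ w) = 0 by move=> ->.
have g0 w : N w = None -> pow_ext m (N w) = 0 by move=> -> /=; rewrite lt_eqF.
have bp : bmeas (fun w => pow_ext m (N w)) by apply: bmeas_pow_ext; rewrite m0 ltW.
rewrite pgfE.
apply: (eq_cvgn_lim (Ex_series bpr f0) (Ex_series bp g0) _) => n.
apply: eq_bigr => -[k kn] _ /=.
have b1 := bmeas_indic (R:=R) (measurable_fiber N [set Some k]).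
transitivity (m ^+ k * pmf_fin N k); last first.
  rewrite /pmf_fin -Ex_indic; last exact: measurable_fiber.
  rewrite -ExZ//; apply: eq_Ex => w; rewrite indicE.
  by have [NE|NE] := pselect (N w = Some k); [rewrite NE|rewrite memNset// !mulr0].
rewrite -h; apply: eq_Ex => w; rewrite indicE.
by have [NE|NE] := pselect (N w = Some k); [rewrite NE|rewrite memNset// !mulr0].
Qed.

(** At [s = 1] the series sums to the probability that [N] is finite, whereas [pgf N 1 = 1]; hence
    the strict bound. *)
Lemma pgf_series N (s : R) : 0 <= s < 1 -> pseries (pmf_fin N) s @ \oo --> pgf N s.
Proof.
move=> /andP[s0 s1].
have g0 w : N w = None -> pow_ext s (N w) = 0 by move=> -> /=; rewrite lt_eqF.
have bp : bmeas (fun w => pow_ext s (N w)) by apply: bmeas_pow_ext; rewrite s0 ltW.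
rewrite pgfE.
have -> : pseries (pmf_fin N) s = fun n => \sum_(k < n) Ex P (fun w => pow_ext s (N w) * \1_(N @^-1` [set Some (val k)]) w).
  apply/funext => n; rewrite /pseries /series /= big_mkord; apply: eq_bigr => -[k kn] _ /=.
  rewrite mulrC /pmf_fin -Ex_indic; last exact: measurable_fiber.
  rewrite -ExZ; last by apply: bmeas_indic; exact: measurable_fiber.
  apply: eq_Ex => w; rewrite indicE.
  by have [NE|NE] := pselect (N w = Some k); [rewrite NE|rewrite memNset// !mulr0].
exact: Ex_series.
Qed.

Lemma cvg_pseries_geometric (c : nat -> R) C r x : (forall k, `|c k| <= C * r ^+ k) ->
  0 <= r -> 0 <= x -> r * x < 1 -> cvgn (pseries c x).
Proof.
move=> cC r0 x0 rx; apply: normed_cvg; rewrite /normed_series_of.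
apply: (@series_le_cvg _ _ (geometric C (r * x))).
- by move=> n; exact: normr_ge0.
- move=> n; rewrite /geometric /= exprMn mulrA mulr_ge0 ?exprn_ge0//.
  exact: le_trans (cC n).
- by move=> n; rewrite /geometric/= exprMn mulrA normrM normrX (ger0_norm x0) ler_wpM2r ?exprn_ge0.
- by apply: is_cvg_geometric_series; rewrite ger0_norm// mulr_ge0.
Qed.

(** Termwise differentiation needs the power series and its first two formal derivatives to converge
    at some [K > s]. Coefficients bounded by 1 grow at most like [r ^+ k], then [(r * r) ^+ k],
    under differentiation, for [r] slightly above 1. *)
Lemma pgf_derivable N (s : R) : 0 < s < 1 -> derivable (pgf N) s 1.
Proof.
move=> /andP[s0 s1].
pose K := (1 + s) / 2.
have K0 : 0 <= K by rewrite /K; lra.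
have sK : s < K by rewrite /K; lra.
have K1 : K < 1 by rewrite /K; lra.
(* Small enough that [(1 + e) ^+ 2 * K < 1], with [K] the midpoint of [s] and 1. *)
pose e := (1 - s) / 8.
have e0 : 0 < e by rewrite /e; lra.
pose r := 1 + e.
have r0 : 0 <= r by rewrite /r; lra.
have rK : r * r * K < 1 by rewrite /r /K /e; nra.
have q1 k : `|pmf_fin N k| <= 1 by have /andP[h0 h1] := pmf_fin01 N k; rewrite ger0_norm.
have dif (c : nat -> R) C r' : 0 <= C -> 1 <= r' -> (forall k, `|c k| <= C * r' ^+ k) ->
    forall k, `|pseries_diffs c k| <= (C * r' / e) * (r * r') ^+ k.
  move=> C0 r'1 cC k; rewrite /pseries_diffs normrM normr_nat.
  have bern : k.+1%:R <= e^-1 * r ^+ k.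
    rewrite -ler_pdivrMl ?invr_gt0// invrK.
    elim: k => [|k IH]; first by rewrite expr0 mulr1 /e; lra.
    rewrite exprS -natr1 mulrDr mulr1 {2}/r mulrDl mul1r lerD//.
    rewrite ler_peMr ?(ltW e0)//; elim: {IH}k => [|k IH]; first by rewrite expr0.
    by rewrite exprS mulr_ege1// /r; lra.
  apply: (le_trans (ler_pM _ _ bern (cC _))) => //.
  rewrite exprS exprMn le_eqVlt; apply/orP; left; apply/eqP; ring.
have h0 k : `|pmf_fin N k| <= 1 * 1 ^+ k by rewrite expr1n mulr1.
have h1 := dif _ _ _ ler01 (lexx 1) h0.
have C1 : 0 <= 1 * 1 / e by rewrite !mul1r invr_ge0 ltW.
have r1 : 1 <= r * 1 by rewrite /r; lra.
have h2 := dif _ _ _ C1 r1 h1.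
have c0 : cvgn (pseries (pmf_fin N) K).
  by apply: (cvg_pseries_geometric h0); rewrite ?mul1r.
have c1 : cvgn (pseries (pseries_diffs (pmf_fin N)) K).
  apply: (cvg_pseries_geometric h1) => //; rewrite mulr1//.
  by apply: le_lt_trans rK; rewrite ler_wpM2r// ler_peMr// -[r]mulr1.
have c2 : cvgn (pseries (pseries_diffs (pseries_diffs (pmf_fin N))) K).
  by apply: (cvg_pseries_geometric h2) => //; rewrite mulr1// mulr_ge0.
have sK' : `|s| < `|K| by rewrite !ger0_norm// ltW.
have [hd _] := pseries_snd_diffs c0 c1 c2 sK'.
apply: near_eq_derivable hd.
near=> x; apply: cvg_lim => //; apply: pgf_series.
apply/andP; split; first by apply: ltW; near: x; exact: lt_nbhsr.
by near: x; exact: lt_nbhsl.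
Unshelve. all: by end_near.
Qed.

End generating_function.

(** Only left difference quotients are used: the points to be compared with the mean lie below
    it. *)
Lemma derive1_left_slope {R : realType} (f : R -> R) (s a e : R) :
  derivable f s 1 -> a < s -> 0 < e ->
  exists2 x, a < x < s & `|(f s - f x) / (s - x) - derive1 f s| < e.
Proof.
move=> df as0 e0; rewrite derive1E.
have cv : (fun h : R => h^-1 *: ((f \o shift s) (h *: (1 : R)) - f s)) @ 0^' --> 'D_1 f s by exact: df.
have /cvgrPdist_lt /(_ e e0) := cv.
rewrite /dnbhs /= near_withinE => /nbhs_ballP[r /= r0 hr].
pose m := Num.min (r / 2) ((s - a) / 2).
have m0 : 0 < m by rewrite lt_min !divr_gt0// subr_gt0.
have mr : m < r by rewrite gt_min; apply/orP; left; lra.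
have ma : m < s - a by rewrite gt_min; apply/orP; right; lra.
exists (s - m); first lra.
have := hr (- m); rewrite /ball /= sub0r opprK gtr0_norm// => /(_ mr).
rewrite oppr_eq0 gt_eqF// => /(_ isT).
rewrite distrC; congr (`|_ - _| < _); rewrite /shift /= /GRing.scale /= mulr1.
rewrite addrC (addrC (- m) s); have -> : s - (s - m) = m by ring.
by field; rewrite gt_eqF.
Qed.

(** * One step of the recursion *)

Section laws.
Context {R : realType}.
Context {d} {Omega : measurableType d} (P : probability Omega R).
Context {d'} {Omega' : measurableType d'} (Q : probability Omega' R).

Lemma Ex_same_law (X : {RV P >-> R}) (Y : {RV Q >-> R}) (g : R -> R) :
  same_law (distribution P X) (distribution Q Y) -> measurable_fun setT g ->
  bmeas (g \o X) -> bmeas (g \o Y) -> Ex P (g \o X) = Ex Q (g \o Y).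
Proof.
move=> XY mg bX bY; rewrite /Ex /Rintegral; congr fine.
have mg' : measurable_fun setT (EFin \o g) by exact/measurable_EFinP.
have iX := bmeas_integrable P bX; have iY := bmeas_integrable Q bY.
rewrite -(@integral_distribution _ _ _ _ _ P X (EFin \o g))//.
rewrite -(@integral_distribution _ _ _ _ _ Q Y (EFin \o g))//.
by apply: eq_measure_integral => A mA _; exact: XY.
Qed.

Lemma pmf_fin_same_law (N : {RV P >-> option nat}) (N' : {RV Q >-> option nat}) k :
  same_law (distribution P N) (distribution Q N') -> pmf_fin N k = pmf_fin N' k.
Proof. by move=> NN'; rewrite /pmf_fin /pr; congr fine; exact: (NN' [set Some k]). Qed.

Lemma pgf_same_law (N : {RV P >-> option nat}) (N' : {RV Q >-> option nat}) (s : R) :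
  same_law (distribution P N) (distribution Q N') -> 0 <= s < 1 -> pgf N s = pgf N' s.
Proof.
move=> NN' s01.
have h := pgf_series (N:=N) s01; have h' := pgf_series (N:=N') s01.
apply: (@eq_cvgn_lim _ _ _ _ _ h h') => n.
by rewrite /pseries /series/=; apply: eq_bigr => k _; rewrite (pmf_fin_same_law _ NN').
Qed.

End laws.

Lemma prod_iota (R : pzSemiRingType) n (F : nat -> R) :
  \prod_(i <- iota 0 n) F i = \prod_(i < n) F i.
Proof. by rewrite -(big_mkord xpredT) /index_iota subn0. Qed.

(* The [p]-th moment of [1 - prod_(i < N) X_i] in terms of the moments of the
   independent [X_i], by the binomial formula. *)
Definition moment_step {d} {Omega : measurableType d} {R : realType}
    {P : probability Omega R} (N : {RV P >-> option nat}) (mom : nat -> R) p : R :=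
  \sum_(j < p.+1) (-1) ^+ j * pgf N (mom j) *+ 'C(p, j).

Lemma pgf1 {d} {Omega : measurableType d} {R : realType} {P : probability Omega R}
  (N : {RV P >-> option nat}) : pgf N 1 = 1.
Proof.
rewrite pgfE -[RHS](Ex_cst P 1); apply: eq_Ex => w.
by case: (N w) => [k|] /=; rewrite ?expr1n// eqxx.
Qed.

Lemma moment_step_same_law {R : realType}
    {d} {Omega : measurableType d} {P : probability Omega R} (N : {RV P >-> option nat})
    {d'} {Omega' : measurableType d'} {Q : probability Omega' R} (N' : {RV Q >-> option nat})
    (mom : nat -> R) p : same_law (distribution P N) (distribution Q N') ->
  mom 0%N = 1 -> (forall j, 0 <= mom j.+1 < 1) -> moment_step N mom p = moment_step N' mom p.
Proof.
move=> NN' mom0 mom1; apply: eq_bigr => -[[|j] jp] _ /=; first by rewrite mom0 !pgf1.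
by rewrite (pgf_same_law NN' (mom1 j)).
Qed.

Section one_step.
Context {d} {Omega : measurableType d} {R : realType} {P : probability Omega R}.
Variables (N : {RV P >-> option nat}) (Y : nat -> {RV P >-> R}).
Hypothesis Y01 : forall i w, 0 <= Y i w <= 1.
Hypothesis indY : mutually_independent setT Y.

Let bY i : bmeas (Y i).
Proof. by apply: bmeas01. Qed.

Lemma Ex_prod_pow (s : seq nat) p : uniq s ->
  Ex P (fun w => \prod_(i <- s) Y i w ^+ p) = \prod_(i <- s) Ex P (fun w => Y i w ^+ p).
Proof.
move=> us; apply: (Ex_prod_indep (f := fun i w => Y i w ^+ p) indY) => //.
- by move=> i; exact: bmeasX.
- move=> i; apply: (smeas_comp (g := fun x => x ^+ p)) => //.
  exact: joint_sigma_smeas.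
Qed.

Lemma prod_lim_cvg w : (fun n => \prod_(i < n) Y i w) @ \oo --> limn (fun n => \prod_(i < n) Y i w).
Proof.
apply: nonincreasing_is_cvgn.
  apply/nonincreasing_seqP => n; rewrite big_ord_recr/= ler_piMr//.
    by apply: prodr_ge0 => i _; case/andP: (Y01 i w).
  by case/andP: (Y01 n w).
exists 0 => _ [n _ <-]; apply: prodr_ge0 => i _; by case/andP: (Y01 i w).
Qed.

Lemma prod_bmeas n : bmeas (fun w => \prod_(i < n) Y i w).
Proof. by apply: bmeas_prod. Qed.

Lemma prod_norm_le1 n w : `|\prod_(i < n) Y i w| <= 1.
Proof.
rewrite ger0_norm; last by apply: prodr_ge0 => i _; case/andP: (Y01 i w).
exact: prodr_ile1.
Qed.

Lemma measurable_prod_lim : measurable_fun setT (fun w => limn (fun n => \prod_(i < n) Y i w)).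
Proof.
apply: (measurable_fun_cvg (h := fun n w => \prod_(i < n) Y i w)).
  by move=> n; have [] := prod_bmeas n.
by move=> w _; exact: prod_lim_cvg.
Qed.

Lemma measurable_prod_ext : measurable_fun setT (fun w => prod_ext (N w) (Y ^~ w)).
Proof.
apply: (@measurable_option_case _ _ _ N (fun o w => prod_ext o (Y ^~ w))) => // -[k|] /=.
  by have [] := prod_bmeas k.
exact: measurable_prod_lim.
Qed.

Lemma bmeas_prod_fin p : bmeas (fun w => prod_fin (N w) (fun i => Y i w ^+ p)).
Proof.
apply: bmeas01.
  apply: (@measurable_prod_fin _ _ _ N (fun i w => Y i w ^+ p)) => // i.
  by have [] := bmeasX p (bY i).
move=> w; apply: prod_fin01 => i; have /andP[? ?] := Y01 i w.
by rewrite exprn_ge0// exprn_ile1.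
Qed.

(** The product of the first [n] factors has mean [m ^+ n], which tends to 0; the infinite product
    is nonnegative with mean 0, hence almost surely 0. *)
Lemma prod_ext_fin m : m < 1 -> (forall i, Ex P (Y i) = m) ->
  {ae P, forall w, prod_ext (N w) (Y ^~ w) = prod_fin (N w) (Y ^~ w)}.
Proof.
move=> m1 EY.
have m0 : 0 <= m by rewrite -(EY 0%N) Ex_ge0// => w; case/andP: (Y01 0%N w).
pose L w := limn (fun n => \prod_(i < n) Y i w).
have E n : Ex P (fun w => \prod_(i < n) Y i w) = m ^+ n.
  transitivity (Ex P (fun w => \prod_(i <- iota 0 n) Y i w ^+ 1)).
    by apply: eq_Ex => w; rewrite prod_iota.
  rewrite Ex_prod_pow ?iota_uniq//.
  under eq_bigr => i _ do rewrite (_ : Ex _ _ = m) ?EY//.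
  by rewrite big_const_seq count_predT size_iota iter_mulr mulr1.
have L0 w : 0 <= L w.
  apply: limr_ge; first exact: prod_lim_cvg.
  by apply: nearW => n; apply: prodr_ge0 => i _; case/andP: (Y01 i w).
have L1 w : L w <= 1.
  apply: limr_le; first exact: prod_lim_cvg.
  by apply: nearW => n; exact: prodr_ile1.
have EL : Ex P L = 0.
  apply: (@eq_cvgn_lim _ (fun n => Ex P (fun w => \prod_(i < n) Y i w)) (fun n => m ^+ n)) => //.
    apply: (@Ex_cvg _ _ _ _ _ _ 1).
    - by move=> n; have [] := prod_bmeas n.
    - exact: measurable_prod_lim.
    - by move=> n w; exact: prod_norm_le1.
    - by apply: aeW => w; exact: prod_lim_cvg.
  by apply: cvg_expr; rewrite ger0_norm.
have := Ex_eq0 measurable_prod_lim L0 _ EL; case.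
  by exists 1 => w; rewrite ger0_norm ?L0 ?L1.
move=> Z [mZ PZ hZ]; exists Z; split => // w /= h; apply: hZ => /= h'; apply: h.
by case: (N w).
Qed.

(** Serves to exclude mean 1: the recursion would then give the value 0 almost surely. *)
Lemma prod_ext1 : (forall i, Ex P (Y i) = 1) ->
  {ae P, forall w, prod_ext (N w) (Y ^~ w) = 1}.
Proof.
move=> EY.
have h i : {ae P, forall w, Y i w = 1}.
  have bi : bmeas (fun w => 1 - Y i w) by apply: bmeasB => //; exact: bmeas_cst.
  have : {ae P, forall w, 1 - Y i w = 0}.
    apply: Ex_eq0; [exact: bi.1| |exact: bi.2|].
      by move=> w; rewrite subr_ge0; case/andP: (Y01 i w).
    by rewrite ExB//; [rewrite Ex_cst EY subrr|exact: bmeas_cst].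
  by apply: filterS => w /eqP; rewrite subr_eq0 => /eqP <-.
have : {ae P, forall w, forall i, Y i w = 1} by apply/ae_foralln.
apply: filterS => w hw; case: (N w) => [k|] /=.
  by rewrite big1// => i _.
have -> : (fun m => \prod_(i < m) Y i w) = fun=> 1.
  by apply/funext => n; rewrite big1.
exact: lim_cst.
Qed.

Lemma prod_ext01 w : 0 <= prod_ext (N w) (Y ^~ w) <= 1.
Proof.
have p01 n : 0 <= \prod_(i < n) Y i w <= 1.
  apply/andP; split; last exact: prodr_ile1.
  by apply: prodr_ge0 => i _; case/andP: (Y01 i w).
case: (N w) => [k|] /=; first exact: p01.
by apply/andP; split; [apply: limr_ge|apply: limr_le]; try exact: prod_lim_cvg;
  apply: nearW => n; case/andP: (p01 n).
Qed.

Hypothesis indN : independent_sigma P (joint_sigma setT Y) (g_sigma_algebra_preimage N).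
Variable mom : nat -> R.
Hypothesis momE : forall i p, Ex P (fun w => Y i w ^+ p) = mom p.
Hypothesis mom1 : mom 1%N < 1.

Lemma mom_range p : 0 <= mom p.+1 < 1.
Proof.
rewrite -(momE 0%N); apply/andP; split.
  by apply: Ex_ge0 => w; rewrite exprn_ge0//; case/andP: (Y01 0%N w).
apply: le_lt_trans mom1; rewrite -(momE 0%N).
apply: Ex_le; [exact: bmeasX..|move=> w].
have /andP[y0 y1] := Y01 0%N w.
by rewrite exprS expr1 ler_piMr// exprn_ile1.
Qed.

(** The exponent must be positive: for exponent 0 the left side is the probability that [N] is
    finite, the right side is 1. *)
Lemma Ex_prod_fin p : Ex P (fun w => prod_fin (N w) (fun i => Y i w ^+ p.+1)) = pgf N (mom p.+1).
Proof.
apply: (pgf_prod_fin (Y := fun i w => Y i w ^+ p.+1)).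
- exact: mom_range.
- by move=> i; exact: bmeasX.
- exact: bmeas_prod_fin.
move=> k.
have sN : sigma_algebra setT (g_sigma_algebra_preimage N).
  by apply: sigma_algebra_preimage; exact: sigma_algebra_measurable.
have Nm : g_sigma_algebra_preimage N `<=` @measurable d Omega.
  by move=> _ [A mA <-]; rewrite setTI; exact: preimage_measurable.
have h1 : smeas (joint_sigma setT Y) (fun w => \prod_(i < k) Y i w ^+ p.+1).
  apply: (smeas_prod (f := fun (i : 'I_k) w => Y i w ^+ p.+1)); first exact: joint_sigma_sigma_algebra.
  move=> i _; apply: (smeas_comp (g := fun x => x ^+ p.+1)) => //.
  exact: joint_sigma_smeas.
have b1 : bmeas (\1_(N @^-1` [set Some k]) : Omega -> R).
  by apply: bmeas_indic; exact: measurable_fiber.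
have h2 : smeas (g_sigma_algebra_preimage N) (\1_(N @^-1` [set Some k]) : Omega -> R).
  move=> B mB; exists [set o | B (\1_[set Some k] o)] => //.
  by rewrite setTI; apply/seteqP; split=> w; rewrite /preimage /= !indicE;
    congr (B (_%:R)); congr nat_of_bool; apply/idP/idP; rewrite !inE.
rewrite (Ex_indep (joint_sigma_sigma_algebra setT Y) sN _ Nm indN h1 _ h2 b1).
- rewrite Ex_indic; last exact: measurable_fiber.
  congr (_ * _).
  transitivity (Ex P (fun w => \prod_(i <- iota 0 k) Y i w ^+ p.+1)).
    by apply: eq_Ex => w; rewrite prod_iota.
  rewrite Ex_prod_pow ?iota_uniq//.
  under eq_bigr => i _ do rewrite momE.
  by rewrite big_const_seq count_predT size_iota iter_mulr mulr1.
- exact: joint_sigma_measurable.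
- by apply: (@bmeas_prod _ _ _ _ _ (fun (i : 'I_k) w => Y i w ^+ p.+1)) => i; exact: bmeasX.
Qed.

Lemma Ex_moment_step p :
  Ex P (fun w => (1 - prod_fin (N w) (Y ^~ w)) ^+ p) = moment_step N mom p.
Proof.
have bq : bmeas (fun w => prod_fin (N w) (Y ^~ w)).
  by have := bmeas_prod_fin 1; under eq_fun do under eq_fun do rewrite expr1.
transitivity (Ex P (fun w => \sum_(j < p.+1) ((-1) ^+ j *+ 'C(p, j)) * prod_fin (N w) (Y ^~ w) ^+ j)).
  apply: eq_Ex => w; rewrite exprBn; apply: eq_bigr => j _.
  by rewrite expr1n mulr1 mulrnAl.
have bj j : bmeas (fun w => prod_fin (N w) (Y ^~ w) ^+ j) by exact: bmeasX.
rewrite Ex_sum; last by move=> j; apply: bmeasM => //; exact: bmeas_cst.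
apply: eq_bigr => -[j jp] _ /=; rewrite ExZ// mulrnAl; congr (_ * _ *+ _).
(* The term [j = 0] is 1 on both sides, also where [N] is infinite. *)
case: j {jp} => [|j].
  have -> : mom 0%N = 1 by rewrite -(momE 0%N) -[RHS](Ex_cst P 1); apply: eq_Ex => w; rewrite expr0.
  by rewrite pgf1 -[RHS](Ex_cst P 1); apply: eq_Ex => w; rewrite expr0.
rewrite -Ex_prod_fin; apply: eq_Ex => w; case: (N w) => [k|] /=.
  by rewrite prodrXl.
by rewrite expr0n.
Qed.

End one_step.

(** * The tree recursion with a constant boundary condition *)

Definition past n : set tree := [set v | (size v < n)%N].
Definition level n : set tree := [set u | size u = n].
Definition subtree (u : tree) : set tree := [set v | prefix u v].

Lemma subtree_rcons u i : subtree (rcons u i) `<=` subtree u.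
Proof. by move=> v; apply: prefix_trans; exact: prefix_rcons. Qed.

Lemma subtree_disjoint u v : size u = size v -> u != v -> subtree u `&` subtree v = set0.
Proof.
move=> uv neq; rewrite -subset0 => w [/prefixP[s ws] /prefixP[t]].
rewrite ws => /eqP; rewrite eqseq_cat// => /andP[/eqP uE _].
by move: neq; rewrite uE eqxx.
Qed.

Lemma subtree_past n u : size u = n -> subtree u `&` past n = set0.
Proof.
by move=> un; rewrite -subset0 => v [/size_prefix]; rewrite un /past /= leqNgt => /negP.
Qed.

Lemma smeas_indic {d} {Omega : measurableType d} {R : realType} (F : set (set Omega)) A :
  sigma_algebra setT F -> F A -> smeas F (\1_A : Omega -> R).
Proof.
move=> sF; rewrite -(sigma_algebra_id sF) => FA; apply/smeasP.
exact: (@measurable_indic _ (g_sigma_algebraType F)).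
Qed.

Section tree_recursion.
Context {d} {Omega : measurableType d} {R : realType} {P : probability Omega R}.
Variables (Nt : tree -> {RV P >-> option nat}) (mu : R).
Hypothesis mu01 : 0 < mu < 1.

Fixpoint iterf k (u : tree) w : R :=
  if k is k'.+1 then 1 - prod_fin (Nt u w) (fun i => iterf k' (rcons u i) w) else mu.

Lemma iterf01 k u w : 0 <= iterf k u w <= 1.
Proof.
elim: k u => [|k IH] u /=; first by case/andP: mu01 => /ltW -> /ltW ->.
have := @prod_fin01 R (Nt u w) _ (fun i => IH (rcons u i)); lra.
Qed.

(** Both restrictions matter: the subtree gives independence between vertices of one level, the
    bound on the generations gives the conditioning. *)
Lemma smeas_iterf k u :
  smeas (joint_sigma (subtree u `&` past (size u + k)) Nt) (iterf k u).
Proof.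
elim: k u => [|k IH] u; apply/smeasP; first exact: measurable_cst.
apply: measurable_funB; first exact: measurable_cst.
apply: (@measurable_prod_fin _ (g_sigma_algebraType _) _ (Nt u) (iterf k \o rcons u)).
  move=> _ A mA; rewrite setTI; apply: joint_sigma_preimage => //; split.
    by rewrite /subtree /= prefix_refl.
  by rewrite /past /= addnS ltnS leq_addr.
move=> i; apply/smeasP => B mB; apply: (joint_sigmaS _ (IH _ B mB)) => v [/= uv vn].
by split; [exact: subtree_rcons uv|move: vn; rewrite /past /= size_rcons addSnnS].
Qed.

Lemma smeas_iterf_past k u : smeas (joint_sigma (past (size u + k)) Nt) (iterf k u).
Proof. by move=> B mB; apply: (joint_sigmaS _ (smeas_iterf mB)) => v []. Qed.

Lemma bmeas_iterf k u : bmeas (iterf k u).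
Proof.
apply: bmeas01; last exact: iterf01.
apply: smeasW (smeas_iterf (u:=u) (k:=k)); exact: joint_sigma_measurable.
Qed.

Lemma pastS m n : (m <= n)%N -> past m `<=` past n.
Proof. by move=> mn v; rewrite /past /= => /leq_trans; apply. Qed.

(** The working form of a solution: the range holds everywhere, infinite products count as 0, and of
    the common law only the mean is kept, which is all that the conditional means depend on. *)
Record reg_solution (X : tree -> {RV P >-> R}) : Prop := RegSolution {
  rs_range : forall u w, 0 <= X u w <= 1 ;
  rs_indep : forall n, mutually_independent (level n) X ;
  rs_indep_past : forall n, independent_sigma P (joint_sigma (level n) X) (joint_sigma (past n) Nt) ;
  rs_rde : forall u, {ae P, forall w, X u w = 1 - prod_fin (Nt u w) (fun i => X (rcons u i) w)} ;
  rs_mean : forall u, Ex P (X u) = mu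
}.

(** A state in the expansion of a product over level [m]: the vertices of [J2] still wait at that
    level, while [J1] lists the daughters produced so far. *)
Definition mixed (Z Z' : tree -> Omega -> R) (J1 J2 : seq tree) (A : set Omega) w :=
  \prod_(v <- J1) Z v w * \prod_(u <- J2) Z' u w * \1_A w.

Definition children (u : tree) j : seq tree := [seq rcons u i | i <- iota 0 j].

Lemma bmeas_mixed Z Z' J1 J2 A : (forall u, bmeas (Z u)) -> (forall u, bmeas (Z' u)) ->
  measurable A -> bmeas (mixed Z Z' J1 J2 A).
Proof.
move=> bZ bZ' mA; apply: bmeasM; last exact: bmeas_indic.
by apply: bmeasM; exact: bmeas_prod.
Qed.

(** On the event that the offspring number of [u] is [o], the recursion is affine: the factor at [u]
    becomes 1, which removes [u], minus the product over its daughters, which replaces [u] by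
    them. *)
Lemma mixed_piece Z Z' J1 J2 A u o : (forall u, bmeas (Z u)) -> (forall u, bmeas (Z' u)) ->
  measurable A ->
  {ae P, forall w, Z' u w = 1 - prod_fin (Nt u w) (fun i => Z (rcons u i) w)} ->
  Ex P (fun w => mixed Z Z' J1 (u :: J2) A w * \1_(Nt u @^-1` [set o]) w) =
  Ex P (mixed Z Z' J1 J2 (A `&` Nt u @^-1` [set o])) -
    (if o is Some j then
       Ex P (mixed Z Z' (J1 ++ children u j) J2 (A `&` Nt u @^-1` [set o])) else 0).
Proof.
move=> bZ bZ' mA rde.
have mo : measurable (Nt u @^-1` [set o]) by exact: measurable_fiber.
have mB : measurable (A `&` Nt u @^-1` [set o]) by exact: measurableI.
have bm K L := bmeas_mixed K L bZ bZ' mB.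
have bL : bmeas (fun w => mixed Z Z' J1 (u :: J2) A w * \1_(Nt u @^-1` [set o]) w).
  by apply: bmeasM; [exact: bmeas_mixed|exact: bmeas_indic].
case: o mo mB bm bL => [j|] mo mB bm bL.
  rewrite -ExB//; apply: Ex_ae; [exact: bL.1|exact: (bmeasB (bm _ _) (bm _ _)).1|].
  apply: filterS rde => w Zw; rewrite /mixed indicI/= big_cons Zw big_cat/= big_map prod_iota.
  rewrite [\1_(Nt u @^-1` _) w]indicE.
  have [NE|NE] := pselect (Nt u w = Some j); last by rewrite memNset// !mulr0 subrr.
  by rewrite NE mem_set//=; ring.
rewrite subr0; apply: Ex_ae; [exact: bL.1|exact: (bm _ _).1|].
apply: filterS rde => w Zw; rewrite /mixed indicI/= big_cons Zw.
rewrite [\1_(Nt u @^-1` _) w]indicE.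
have [NE|NE] := pselect (Nt u w = None); last by rewrite memNset// !mulr0.
by rewrite NE mem_set//=; ring.
Qed.

Section mean_field.
Variable X : tree -> {RV P >-> R}.
Hypothesis regX : reg_solution X.

Let bX u : bmeas (X u). Proof. by apply: bmeas01 => //; exact: (rs_range regX). Qed.

(* Conditionally on the first [m + k] generations of [Nt], the variables at
   level [m] are independent with conditional means [iterf k]. *)
Lemma mean_field k m (J : seq tree) A : uniq J -> {in J, forall u, size u = m} ->
  joint_sigma (past (m + k)) Nt A ->
  Ex P (fun w => \prod_(u <- J) X u w * \1_A w) =
  Ex P (fun w => \prod_(u <- J) iterf k u w * \1_A w).
Proof.
have sF D := joint_sigma_sigma_algebra D Nt.
elim: k m J A => [|k IH] m J A uJ Jm FA.
  have mA := joint_sigma_measurable FA.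
  rewrite addn0 in FA.
  have sX : smeas (joint_sigma (level m) X) (fun w => \prod_(u <- J) X u w).
    apply: (smeas_prod (f := fun u w => X u w)); first exact: joint_sigma_sigma_algebra.
    by move=> u uj; apply: joint_sigma_smeas; exact: Jm.
  rewrite (Ex_indep (joint_sigma_sigma_algebra _ X) (sF (past m)) _ _ (rs_indep_past regX (n:=m)) sX _
    (smeas_indic _ FA)) ?Ex_indic//.
  - rewrite /= ExZ; last exact: bmeas_indic.
    rewrite Ex_indic//; congr (_ * _).
    rewrite (Ex_prod_indep (f := fun u => X u) (rs_indep regX (n:=m)))//.
      by apply: eq_bigr => u _; exact: (rs_mean regX).
    by move=> u; exact: joint_sigma_smeas.
  - exact: joint_sigma_measurable.
  - exact: joint_sigma_measurable.
  - exact: bmeas_prod.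
  - exact: bmeas_indic.
pose X' u : Omega -> R := X u.
(* An inner induction expands the vertices of [J2] one at a time; that their daughters are not yet
   in [J1] keeps the list of produced vertices free of repetitions. *)
suff h (J2 J1 : seq tree) B : uniq J1 -> uniq J2 -> {in J1, forall v, size v = m.+1} ->
    {in J2, forall u, size u = m} -> {in J2, forall u, forall i, rcons u i \notin J1} ->
    joint_sigma (past (m + k.+1)) Nt B ->
    Ex P (mixed X' X' J1 J2 B) = Ex P (mixed (iterf k) (iterf k.+1) J1 J2 B).
  have := h J [::] A isT uJ _ Jm _ FA.
  rewrite /mixed /=.
  under eq_Ex do rewrite big_nil mul1r; under [in RHS]eq_Ex do rewrite big_nil mul1r.
  by apply.
move=> {uJ Jm FA A J}.
elim: J2 J1 B => [|u J2 IH2] J1 B uJ1 uJ2 s1 s2 nc FB.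
  rewrite /mixed; under eq_Ex do rewrite big_nil mulr1; under [RHS]eq_Ex do rewrite big_nil mulr1.
  by apply: (IH m.+1) => //; rewrite addSnnS.
have mB := joint_sigma_measurable FB.
have bX' v : bmeas (X' v) by exact: bX.
have bi k' v := bmeas_iterf k' v.
have su : size u = m by apply: s2; rewrite mem_head.
apply: (Ex_pieces (N := Nt u)); [exact: bmeas_mixed..|move=> o].
rewrite !mixed_piece//; last 2 first.
  by apply: aeW.
  exact: (rs_rde regX).
(* The offspring number of a vertex at level [m] is known from the first [m + k + 1] generations, so
   the test set stays in the same past. *)
have FBo : joint_sigma (past (m + k.+1)) Nt (B `&` Nt u @^-1` [set o]).
  apply: (@measurableI _ (g_sigma_algebraType _)) => //.
  apply: joint_sigma_preimage => //; rewrite /past /= su addnS ltnS leq_addr//.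
move: uJ2 => /= /andP[uJ2 uJ2'].
have s2' : {in J2, forall v, size v = m} by move=> v vJ; apply: s2; rewrite inE vJ orbT.
have nc' : {in J2, forall v, forall i, rcons v i \notin J1}.
  by move=> v vJ; apply: nc; rewrite inE vJ orbT.
congr (_ - _); first exact: IH2.
case: o FBo => // j FBo; apply: IH2 => //.
- rewrite cat_uniq uJ1 map_inj_uniq ?iota_uniq ?andbT//=; last first.
    by move=> a b /rcons_inj[].
  by apply/hasPn => _ /mapP[i _ ->]; apply: nc; rewrite mem_head.
- move=> v; rewrite mem_cat => /orP[/s1//|/mapP[i _ ->]].
  by rewrite size_rcons su.
- move=> v vJ i; rewrite mem_cat negb_or nc'//=; apply/mapP => -[i' _ /rcons_inj[vu _]].
  by move: uJ2; rewrite -vu vJ.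
Qed.

Lemma mean_field1 k u A : joint_sigma (past (size u + k)) Nt A ->
  Ex P (fun w => X u w * \1_A w) = Ex P (fun w => iterf k u w * \1_A w).
Proof.
move=> FA; have := @mean_field k (size u) [:: u] A isT _ FA.
under eq_Ex do rewrite big_seq1; under [in RHS]eq_Ex do rewrite big_seq1.
by apply => v; rewrite inE => /eqP ->.
Qed.

End mean_field.

Definition pasts : set (set Omega) := \bigcup_n joint_sigma (past n) Nt.

Lemma pasts_setI : setI_closed pasts.
Proof.
move=> A B [m _ Am] [n _ Bn]; exists (maxn m n) => //.
apply: (@measurableI _ (g_sigma_algebraType _)).
  by apply: (joint_sigmaS _ Am); apply: pastS; exact: leq_maxl.
by apply: (joint_sigmaS _ Bn); apply: pastS; exact: leq_maxr.
Qed.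

Lemma pasts_set_algebra : set_algebra pasts.
Proof.
split.
- by exists 0%N => //; exact: sigma_algebra0.
- by move=> A [n _ An]; exists n => //; exact: sigma_algebraC.
- move=> A B [m _ Am] [n _ Bn]; exists (maxn m n) => //.
  apply: (@measurableU _ (g_sigma_algebraType _)).
    by apply: (joint_sigmaS _ Am); apply: pastS; exact: leq_maxl.
  by apply: (joint_sigmaS _ Bn); apply: pastS; exact: leq_maxr.
- by move=> A [n _ An]; exact: joint_sigma_measurable An.
Qed.

Lemma sub_pasts : joint_sigma setT Nt `<=` <<s pasts>>.
Proof.
apply: smallest_sub; first exact: smallest_sigma_algebra.
move=> _ [u _ [A mA <-]]; apply: sub_sigma_algebra; exists (size u).+1 => //.
by rewrite setTI; apply: joint_sigma_preimage => //; rewrite /past /=.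
Qed.

(** On each finite past both sides are given by the same [iterf]; the pasts form a pi-system
    generating the whole sigma-algebra. *)
Lemma reg_solution_agree X X' u A : reg_solution X -> reg_solution X' ->
  joint_sigma setT Nt A ->
  Ex P (fun w => X u w * \1_A w) = Ex P (fun w => X' u w * \1_A w).
Proof.
move=> regX regX' /sub_pasts FA; apply: (Ex_pi pasts_setI) FA.
- by case: pasts_set_algebra.
- by apply: bmeas01 => //; exact: (rs_range regX).
- by apply: bmeas01 => //; exact: (rs_range regX').
- by rewrite (rs_mean regX) (rs_mean regX').
move=> {}A [n _ An].
have An' : joint_sigma (past (size u + n)) Nt A.
  by apply: (joint_sigmaS _ An); apply: pastS; exact: leq_addl.
by rewrite (mean_field1 regX An') (mean_field1 regX' An').
Qed.

End tree_recursion.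

(** * Convergence to the conditional solution *)

Lemma expr_lipschitz {R : realType} p (x y : R) : 0 <= x <= 1 -> 0 <= y <= 1 ->
  `|x ^+ p - y ^+ p| <= p%:R * `|x - y|.
Proof.
move=> /andP[x0 x1] /andP[y0 y1]; elim: p => [|p IH].
  by rewrite !expr0 subrr normr0 mul0r.
have -> : x ^+ p.+1 - y ^+ p.+1 = x * (x ^+ p - y ^+ p) + (x - y) * y ^+ p.
  by rewrite !exprS; ring.
rewrite (le_trans (ler_normD _ _))// -natr1 [leRHS]mulrDl mul1r lerD//.
  by rewrite normrM (ger0_norm x0) (le_trans _ IH)// ler_piMl.
by rewrite normrM ler_piMr// ger0_norm ?exprn_ge0// exprn_ile1.
Qed.

Lemma prod_fin_lipschitz {R : realType} o (x y : nat -> R) :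
  (forall i, 0 <= x i <= 1) -> (forall i, 0 <= y i <= 1) ->
  `|prod_fin o x - prod_fin o y| <= if o is Some k then \sum_(i < k) `|x i - y i| else 0.
Proof.
move=> x01 y01; case: o => [k|] /=; last by rewrite subrr normr0.
elim: k => [|k IH]; first by rewrite !big_ord0 subrr normr0.
rewrite !big_ord_recr/=.
set a := \prod_(i < k) x i; set b := \prod_(i < k) y i.
have -> : a * x k - b * y k = (a - b) * x k + b * (x k - y k) by ring.
rewrite (le_trans (ler_normD _ _))// lerD//.
  rewrite normrM (le_trans _ IH)// ler_piMr//; have /andP[? ?] := x01 k.
  by rewrite ger0_norm.
rewrite normrM ler_piMl// ger0_norm; first by apply: prodr_ile1 => i _; exact: y01.
by apply: prodr_ge0 => i _; case/andP: (y01 i).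
Qed.

Section clamp.
Context {R : realType}.

Definition clamp (x : R) : R := Num.max 0 (Num.min 1 x).

Lemma clamp01 x : 0 <= clamp x <= 1.
Proof. by rewrite /clamp le_max lexx/= ge_max ler01 ge_min lexx. Qed.

Lemma clamp_id x : 0 <= x <= 1 -> clamp x = x.
Proof. by move=> /andP[x0 x1]; rewrite /clamp min_r// max_r. Qed.

Lemma measurable_clamp : measurable_fun setT clamp.
Proof. by apply: measurable_maxr => //; apply: measurable_minr. Qed.

(** Projecting onto [0, 1] does not increase the distance to a point of [0, 1]. *)
Lemma clamp_dist x y : 0 <= x <= 1 -> `|x - clamp y| <= `|x - y|.
Proof.
move=> /andP[x0 x1]; rewrite /clamp.
case: (leP 1 y) => y1.
  rewrite max_r// ler0_norm ?subr_le0// ler0_norm; lra.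
case: (leP 0 y) => // y0; rewrite subr0 !ger0_norm; lra.
Qed.

End clamp.

Section moments_recursion.
Context {d} {Omega : measurableType d} {R : realType} {P : probability Omega R}.
Variables (N : {RV P >-> option nat}) (Nt : tree -> {RV P >-> option nat}).
Hypothesis Nt_iid : iid_copies N Nt.

Lemma tree_moment_step (Y : nat -> {RV P >-> R}) u (mom : nat -> R) p :
  (forall i w, 0 <= Y i w <= 1) -> mutually_independent setT Y ->
  independent_sigma P (joint_sigma setT Y) (g_sigma_algebra_preimage (Nt u)) ->
  (forall i p, Ex P (fun w => Y i w ^+ p) = mom p) -> mom 1%N < 1 ->
  Ex P (fun w => (1 - prod_fin (Nt u w) (Y ^~ w)) ^+ p) = moment_step N mom p.
Proof.
move=> Y01 indY indN momE mom1.
rewrite (Ex_moment_step Y01 indY indN momE mom1).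
apply: (moment_step_same_law (N := Nt u)); first exact: Nt_iid.2.
  by rewrite -(momE 0%N) -[RHS](Ex_cst P 1); apply: eq_Ex => w; rewrite expr0.
by move=> j; exact: (mom_range Y01 momE mom1).
Qed.

Lemma preimage_sub_joint_sigma (D : set tree) u : D u ->
  g_sigma_algebra_preimage (Nt u) `<=` joint_sigma D Nt.
Proof. by move=> Du _ [A mA <-]; rewrite setTI; exact: joint_sigma_preimage. Qed.

Lemma children_mutually_independent (Y : nat -> {RV P >-> R}) (n : nat) (X : tree -> {RV P >-> R}) u :
  mutually_independent (level n) X -> (size u).+1 = n -> (forall i, Y i = X (rcons u i)) ->
  mutually_independent setT Y.
Proof.
move=> indX un YX.
apply: (approx_mutually_independent (block := fun i => [set rcons u i]) indX).
- by move=> i _ _ ->; rewrite /level /= size_rcons.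
- move=> i _ B mB; apply: sub_approx; first exact: joint_sigma_measurable.
  by rewrite YX; apply: joint_sigma_preimage.
- move=> i j _ _ ij; rewrite -subset0 => _ [-> /= /rcons_inj[ji]].
  by move: ij; rewrite ji eqxx.
Qed.

Lemma reg_solution_moments (mu : R) (X : tree -> {RV P >-> R}) (mom : nat -> R) p :
  mu < 1 -> reg_solution Nt mu X -> (forall u p, Ex P (fun w => X u w ^+ p) = mom p) ->
  mom p = moment_step N mom p.
Proof.
move=> mu1 regX momE.
have bX u : bmeas (X u) by apply: bmeas01 => //; exact: (rs_range regX).
have <- := @tree_moment_step (fun i => X [:: i]) [::] mom p.
- rewrite -(momE [::]); apply: Ex_ae.
  + by have [] := bmeasX p (bX [::]).
  + apply: (@measurable_funX _ _ R setT _ p); apply: measurable_funB; first exact: measurable_cst.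
    exact: (@measurable_prod_fin _ _ _ (Nt [::]) (fun i w => X [:: i] w)).
  + by apply: filterS (rs_rde regX [::]) => w ->.
- by move=> i w; exact: (rs_range regX).
- by apply: (children_mutually_independent (u := [::]) (rs_indep regX (n:=1%N))).
- move=> A B FA FB; apply: (rs_indep_past regX (n:=1%N)).
    have sub : joint_sigma setT (fun i : nat => X [:: i]) `<=` joint_sigma (level 1) X.
      apply: smallest_sub; first exact: joint_sigma_sigma_algebra.
      by move=> _ [i _ [C mC <-]]; rewrite setTI; exact: joint_sigma_preimage.
    exact: sub.
  exact: preimage_sub_joint_sigma FB.
- by move=> i q; exact: momE.
- by rewrite -(momE [::]); under eq_Ex do rewrite expr1; rewrite (rs_mean regX).
Qed.

Variable mu : R.
Hypothesis mu01 : 0 < mu < 1.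
Hypothesis muH : pgf N mu = 1 - mu.

(** The moments of [iterf k u]. They involve neither the vertex nor the tree, hence the limits have
    the same moments at all vertices. *)
Fixpoint iter_moment k : nat -> R :=
  if k is k'.+1 then moment_step N (iter_moment k') else fun p => mu ^+ p.

Lemma iter_moment1 k : iter_moment k 1%N = mu.
Proof.
elim: k => [|k IH] /=; first by rewrite expr1.
rewrite /moment_step 2!big_ord_recr big_ord0/= IH muH.
have -> : iter_moment k 0%N = 1.
  case: k {IH} => [|k] /=; first by rewrite expr0.
  rewrite /moment_step big_ord_recr big_ord0/= add0r expr0 mul1r.
  elim: k => [|k IH] /=; first by rewrite expr0 pgf1.
  by rewrite /moment_step big_ord_recr big_ord0/= add0r expr0 mul1r bin0 mulr1n IH pgf1.
by rewrite pgf1 expr0 expr1 bin0 bin1 !mulr1n; ring.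
Qed.

Definition iter_rv k u : {RV P >-> R} := mfun_of (bmeas_iterf Nt mu01 k u).1.

Lemma iter_mutually_independent k u : mutually_independent setT (fun i => iter_rv k (rcons u i)).
Proof.
apply: (approx_mutually_independent (block := fun i => subtree (rcons u i)) Nt_iid.1) => //.
- move=> i _ B mB; apply: sub_approx; first exact: joint_sigma_measurable.
  by apply: (joint_sigmaS _ (smeas_iterf mu mB)) => v [].
- move=> i j _ _ ij; apply: subtree_disjoint; first by rewrite !size_rcons.
  by apply: contraNneq ij => /rcons_inj[->].
Qed.

Lemma Ex_iterf_pow k u p : Ex P (fun w => iterf Nt mu k u w ^+ p) = iter_moment k p.
Proof.
elim: k u p => [|k IH] u p /=; first exact: Ex_cst.
apply: (@tree_moment_step (fun i => iter_rv k (rcons u i))).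
- by move=> i w; exact: iterf01.
- exact: iter_mutually_independent.
- have sub : joint_sigma setT (fun i => iter_rv k (rcons u i)) `<=`
      joint_sigma (\bigcup_i subtree (rcons u i)) Nt.
    apply: smallest_sub; first exact: joint_sigma_sigma_algebra.
    move=> _ [i _ [C mC <-]]; rewrite setTI.
    by apply: (joint_sigmaS _ (smeas_iterf mu mC)) => v [uv _]; exists i.
  move=> A B /sub FA /(preimage_sub_joint_sigma (D := [set u]) erefl) FB.
  apply: (joint_sigma_indep Nt_iid.1 _ _ _ FA FB) => //.
  rewrite -subset0 => v [[i _] + vu]; rewrite vu /subtree /= => /size_prefix.
  by rewrite size_rcons ltnn.
- by move=> i q; exact: IH.
- by rewrite iter_moment1; case/andP: mu01.
Qed.

End moments_recursion.

Section conditional_solution.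
Context {d} {Omega : measurableType d} {R : realType} {P : probability Omega R}.
Variables (N : {RV P >-> option nat}) (Nt : tree -> {RV P >-> option nat}) (mu : R).
Hypothesis Nt_iid : iid_copies N Nt.
Hypothesis mu01 : 0 < mu < 1.
Hypothesis muH : pgf N mu = 1 - mu.
Variables X C : tree -> {RV P >-> R}.
Hypothesis regX : reg_solution Nt mu X.
Hypothesis C01 : forall u w, 0 <= C u w <= 1.
Hypothesis C_smeas : forall u, smeas (joint_sigma setT Nt) (C u).
Hypothesis CX : forall u A, joint_sigma setT Nt A ->
  Ex P (fun w => C u w * \1_A w) = Ex P (fun w => X u w * \1_A w).

Let bC u : bmeas (C u). Proof. exact: bmeas01. Qed.

(** A simple function approximates [f] uniformly, and each of its level sets is close in [sdist] to
    an event of some finite past. *)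
Lemma pasts_dense f e : smeas (joint_sigma setT Nt) f -> bmeas f -> 0 < e ->
  exists n g, [/\ smeas (joint_sigma (past n) Nt) g, bmeas g &
    Ex P (fun w => `|f w - g w|) <= e].
Proof.
move=> Ff bf e0.
have e20 : 0 < e / 2 by rewrite divr_gt0.
have [n [A [c [FA fA]]]] := indic_approx (joint_sigma_sigma_algebra setT Nt) Ff bf.2 e20.
(* The total weight of the coefficients: an error of [e / 2 / (K + 1)] per set adds up to at most
   [e / 2]. *)
pose K := \sum_(i < n) `|c i|.
have K0 : 0 <= K by apply: sumr_ge0.
have K1 : 0 < K + 1 by rewrite ltr_wpDl.
have h i : exists A' : set Omega * nat, joint_sigma (past A'.2) Nt A'.1 /\
    sdist P (A i) A'.1 <= e / 2 / (K + 1).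
  have [_ ap] := approx_gen P (pasts_set_algebra Nt) (sub_pasts (FA i)).
  by have [A' [m _ Am] AA'] := ap _ (divr_gt0 e20 K1); exists (A', m).
have [A' A'P] := choice h.
pose m := \max_(i < n) (A' i).2.
have mA i : measurable (A i) by exact: joint_sigma_measurable (FA i).
have mA' i : measurable (A' i).1 by exact: joint_sigma_measurable (A'P i).1.
pose g w : R := \sum_(i < n) c i * \1_((A' i).1) w.
have bg : bmeas g.
  by apply: bmeas_sum => i; apply: bmeasM; [exact: bmeas_cst|exact: bmeas_indic].
exists m, g; split => //.
  rewrite -(sigma_algebra_id (joint_sigma_sigma_algebra (past m) Nt)); apply/smeasP.
  apply: (@measurable_sum _ (g_sigma_algebraType _) R setT 'I_n _ (fun i w => c i * \1_((A' i).1) w)) => i.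
  apply: measurable_funM; first exact: measurable_cst.
  apply: measurable_indic; apply: sub_sigma_algebra.
  by apply: (joint_sigmaS _ (A'P i).1); apply: pastS; exact: (leq_bigmax (F := fun i : 'I_n => (A' i).2)).
have bi i : bmeas (fun w => `|c i| * `|\1_(A i) w - \1_((A' i).1) w|).
  by apply: bmeasM; [exact: bmeas_cst|exact: bmeas_sdist].
apply: (@le_trans _ _ (Ex P (fun w => e / 2 + \sum_(i < n) `|c i| * `|\1_(A i) w - \1_((A' i).1) w|))).
  apply: Ex_le.
  - by apply: bmeas_norm; exact: bmeasB.
  - by apply: bmeasD; [exact: bmeas_cst|exact: bmeas_sum].
  move=> w; rewrite (le_trans (ler_distD (\sum_(i < n) c i * \1_(A i) w) _ _))// lerD//.
  rewrite /g -sumrB (le_trans (ler_norm_sum _ _ _))//; apply: ler_sum => i _.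
  by rewrite -mulrBr normrM.
rewrite ExD; [|exact: bmeas_cst|exact: bmeas_sum].
rewrite Ex_cst Ex_sum// [leRHS]splitr lerD//.
apply: (@le_trans _ _ (\sum_(i < n) `|c i| * (e / 2 / (K + 1)))).
  apply: ler_sum => i _; rewrite ExZ; last exact: bmeas_sdist.
  by rewrite ler_wpM2l//; exact: (A'P i).2.
rewrite -mulr_suml -/K mulrCA ler_piMr ?(ltW e20)//.
by rewrite ler_pdivrMr// mul1r lerDl.
Qed.

(* [iterf k u] is the L2-projection of [C u] on the first generations. *)
Lemma iterf_projection k u g : smeas (joint_sigma (past (size u + k)) Nt) g -> bmeas g ->
  Ex P (fun w => (C u w - iterf Nt mu k u w) ^+ 2) <= Ex P (fun w => (C u w - g w) ^+ 2).
Proof.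
move=> Fg bg; set it := iterf Nt mu k u.
have bit : bmeas it by exact: bmeas_iterf.
have sF := joint_sigma_sigma_algebra (past (size u + k)) Nt.
have orth : Ex P (fun w => C u w * (it w - g w)) = Ex P (fun w => it w * (it w - g w)).
  apply: (Ex_agree sF) => //.
  - exact: joint_sigma_measurable.
  - move=> A FA; rewrite CX; last exact: (joint_sigmaS _ FA).
    exact: (mean_field1 mu01 regX).
  - apply/smeasP; apply: measurable_funB; apply/smeasP => //.
    exact: smeas_iterf_past.
  - exact: bmeasB.
have -> : Ex P (fun w => (C u w - g w) ^+ 2) = Ex P (fun w => (C u w - it w) ^+ 2 +
    (it w - g w) ^+ 2 + (2 * (C u w * (it w - g w)) - 2 * (it w * (it w - g w)))).
  by apply: eq_Ex => w; ring.
have bd : bmeas (fun w => it w - g w) by exact: bmeasB.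
have b1 : bmeas (fun w => (C u w - it w) ^+ 2) by apply: bmeasX; exact: bmeasB.
have b2 : bmeas (fun w => (it w - g w) ^+ 2) by apply: bmeasX.
have b3 : bmeas (fun w => C u w * (it w - g w)) by apply: bmeasM.
have b4 : bmeas (fun w => it w * (it w - g w)) by apply: bmeasM.
have b3' : bmeas (fun w => 2 * (C u w * (it w - g w))) by apply: bmeasM => //; exact: bmeas_cst.
have b4' : bmeas (fun w => 2 * (it w * (it w - g w))) by apply: bmeasM => //; exact: bmeas_cst.
rewrite ExD; [|exact: bmeasD|exact: bmeasB].
rewrite ExD// ExB// ExZ// ExZ// orth subrr addr0 lerDl.
by apply: Ex_ge0 => w; exact: sqr_ge0.
Qed.

(** Instead of martingale convergence: [C u] is close in L1 to a function of a finite past. After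
    clamping, squared distances are at most distances, and the projection [iterf] does at least as
    well as that function. *)
Lemma iterf_cvg_L2 u e : 0 < e ->
  exists k0, forall k, (k0 <= k)%N -> Ex P (fun w => (C u w - iterf Nt mu k u w) ^+ 2) <= e.
Proof.
move=> e0; have [n [g [Fg bg Cg]]] := pasts_dense (C_smeas u) (bC u) e0.
exists n => k nk.
have bcg : bmeas (clamp \o g).
  apply: bmeas01 => [|w]; last exact: clamp01.
  by apply: measurableT_comp; [exact: measurable_clamp|exact: bg.1].
apply: (@le_trans _ _ (Ex P (fun w => (C u w - (clamp \o g) w) ^+ 2))).
  apply: iterf_projection => // B mB.
  have := smeas_comp measurable_clamp Fg mB.
  apply: joint_sigmaS; apply: pastS; rewrite (leq_trans nk)// leq_addl//.
apply: le_trans Cg; apply: Ex_le.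
- by apply: bmeasX; exact: bmeasB.
- by apply: bmeas_norm; exact: bmeasB.
move=> w; apply: le_trans (clamp_dist (g w) (C01 u w)); rewrite /=.
have /andP[c0 c1] := C01 u w; have /andP[g0 g1] := clamp01 (g w).
rewrite -[leLHS]real_normK ?num_real// expr2 ler_piMr//.
by rewrite ler_norml; apply/andP; split; lra.
Qed.

Lemma iterf_cvg_L1 u e : 0 < e ->
  exists k0, forall k, (k0 <= k)%N -> Ex P (fun w => `|C u w - iterf Nt mu k u w|) <= e.
Proof.
move=> e0; have [k0 h] := iterf_cvg_L2 u (mulr_gt0 e0 e0).
exists k0 => k /h{}h.
have bd : bmeas (fun w => C u w - iterf Nt mu k u w) by apply: bmeasB => //; exact: bmeas_iterf.
have bd2 := bmeasX 2 bd.
have bz : bmeas (fun w => (2 * e)^-1 * (C u w - iterf Nt mu k u w) ^+ 2).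
  by apply: bmeasM => //; exact: bmeas_cst.
apply: (@le_trans _ _ (Ex P (fun w => e / 2 + (2 * e)^-1 * (C u w - iterf Nt mu k u w) ^+ 2))).
  apply: Ex_le; [exact: bmeas_norm|by apply: bmeasD => //; exact: bmeas_cst|move=> w].
  rewrite -[(C u w - _) ^+ 2]real_normK ?num_real//.
  set y := `| _ |.
  (* AM-GM: [y <= e / 2 + y ^+ 2 / (2 * e)] *)
  rewrite -subr_ge0; have -> : e / 2 + (2 * e)^-1 * y ^+ 2 - y = (2 * e)^-1 * (y - e) ^+ 2.
    by field; rewrite gt_eqF.
  by rewrite mulr_ge0 ?sqr_ge0// invr_ge0 mulr_ge0// ltW.
rewrite ExD//; last exact: bmeas_cst.
rewrite Ex_cst ExZ// [leRHS]splitr lerD//.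
rewrite ler_pdivrMl; last by rewrite mulr_gt0.
by have -> : 2 * e * (e / 2) = e * e by field.
Qed.

Lemma cond_moment u p : iter_moment N mu k p @[k --> \oo] --> Ex P (fun w => C u w ^+ p).
Proof.
apply/cvgrPdist_le => e e0.
have p0 : (0 : R) < p%:R + 1 by rewrite ltr_wpDl.
have [k0 h] := iterf_cvg_L1 u (divr_gt0 e0 p0).
exists k0 => // k /h{}h /=.
rewrite -(Ex_iterf_pow Nt_iid mu01 muH k u).
have bit : bmeas (iterf Nt mu k u) by exact: bmeas_iterf.
have b1 : bmeas (fun w => C u w ^+ p - iterf Nt mu k u w ^+ p) by apply: bmeasB; exact: bmeasX.
have b2 : bmeas (fun w => `|C u w - iterf Nt mu k u w|) by apply: bmeas_norm; exact: bmeasB.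
rewrite -ExB; [|exact: bmeasX..].
apply: (le_trans (Ex_norm P b1)).
apply: (@le_trans _ _ (Ex P (fun w => p%:R * `|C u w - iterf Nt mu k u w|))).
  apply: Ex_le; [exact: bmeas_norm|by apply: bmeasM => //; exact: bmeas_cst|move=> w].
  by apply: expr_lipschitz => //; exact: iterf01.
rewrite ExZ// (le_trans (ler_wpM2l _ h))//.
by rewrite mulrCA ler_piMr ?(ltW e0)// ler_pdivrMr// mul1r lerDl.
Qed.

(** The functions [iterf] satisfy the recursion exactly, and it passes to the L1 limit. The number
    of daughters being unbounded, this is done on each event where it is fixed. *)
Lemma cond_rde u : {ae P, forall w, C u w = 1 - prod_fin (Nt u w) (fun i => C (rcons u i) w)}.
Proof.
pose h w := C u w - (1 - prod_fin (Nt u w) (fun i => C (rcons u i) w)).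
have bpr : bmeas (fun w => prod_fin (Nt u w) (fun i => C (rcons u i) w)).
  apply: bmeas01; last by move=> w; apply: prod_fin01.
  exact: (@measurable_prod_fin _ _ _ (Nt u) (fun i w => C (rcons u i) w)).
have bh : bmeas h by apply: bmeasB => //; apply: bmeasB => //; exact: bmeas_cst.
suff : {ae P, forall w, `|h w| = 0}.
  by apply: filterS => w /normr0_eq0 /eqP; rewrite subr_eq0 => /eqP.
have bnh := bmeas_norm bh.
apply: Ex_eq0; [exact: bnh.1|by []|exact: bnh.2|].
rewrite -[RHS](Ex_cst P 0); apply: (Ex_pieces (N := Nt u)) => // [|o]; first exact: bmeas_cst.
have b1 : bmeas (\1_(Nt u @^-1` [set o]) : Omega -> R) by apply: bmeas_indic; exact: measurable_fiber.
have -> : Ex P (fun w => cst 0 w * \1_(Nt u @^-1` [set o]) w) = 0.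
  by rewrite -[RHS](Ex_cst P 0); apply: eq_Ex => w; rewrite /= mul0r.
have bn1 : bmeas (fun w => `|h w| * \1_(Nt u @^-1` [set o]) w) by exact: bmeasM.
apply/eqP; rewrite eq_le Ex_ge0 ?andbT; last by move=> w; rewrite mulr_ge0.
apply/ler_addgt0Pr => e e0; rewrite add0r.
(* Only [j] daughters enter on this event, none if the number is infinite. With [u] itself there are
   [j + 1] errors, each kept below [e / (j + 1)]. *)
pose j := if o is Some j then j else 0%N.
have oj (F : nat -> R) : (if o is Some k then \sum_(i < k) F i else 0) <= \sum_(i < j) F i.
  by rewrite /j; case: (o) => [//|]; rewrite big_ord0.
have j0 : (0 : R) < j.+1%:R by rewrite ltr0n.
have ej0 := divr_gt0 e0 j0.
have [kf kfP] := choice (fun i => iterf_cvg_L1 (rcons u i) ej0).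
have [k1 k1P] := iterf_cvg_L1 u ej0.
pose k := maxn k1 (\max_(i < j) kf i).
have hk : Ex P (fun w => `|C u w - iterf Nt mu k.+1 u w|) <= e / j.+1%:R.
  by apply: k1P; rewrite leqW// leq_maxl.
have hi (i : 'I_j) : Ex P (fun w => `|C (rcons u i) w - iterf Nt mu k (rcons u i) w|) <= e / j.+1%:R.
  by apply: kfP; rewrite (leq_trans _ (leq_maxr _ _))// (leq_bigmax (F := fun i : 'I_j => kf i)).
have bk k' v : bmeas (fun w => `|C v w - iterf Nt mu k' v w|).
  by apply: bmeas_norm; apply: bmeasB => //; exact: bmeas_iterf.
have bs : bmeas (fun w => \sum_(i < j) `|C (rcons u i) w - iterf Nt mu k (rcons u i) w|).
  by apply: bmeas_sum.
apply: (@le_trans _ _ (Ex P (fun w => `|C u w - iterf Nt mu k.+1 u w| +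
    \sum_(i < j) `|C (rcons u i) w - iterf Nt mu k (rcons u i) w|))).
  apply: Ex_le => //; first exact: bmeasD.
  move=> w; rewrite indicE.
  have [NE|NE] := pselect (Nt u w = o); last first.
    by rewrite memNset// mulr0 addr_ge0// sumr_ge0.
  rewrite mem_set// mulr1.
  have -> : h w = (C u w - iterf Nt mu k.+1 u w) +
      (prod_fin (Nt u w) (fun i => C (rcons u i) w) -
       prod_fin (Nt u w) (fun i => iterf Nt mu k (rcons u i) w)).
    by rewrite /h /=; ring.
  rewrite (le_trans (ler_normD _ _))// lerD//.
  rewrite (le_trans (prod_fin_lipschitz _ _ _))//; first by move=> i; exact: iterf01.
  by rewrite NE; exact: (oj (fun i => `|C (rcons u i) w - iterf Nt mu k (rcons u i) w|)).
rewrite ExD// Ex_sum//.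
apply: (@le_trans _ _ (e / j.+1%:R + \sum_(i < j) e / j.+1%:R)).
  by rewrite lerD//; apply: ler_sum => i _; exact: hi.
rewrite sumr_const card_ord -mulrS -[e / _ *+ _]mulr_natr divfK// gt_eqF//.
Qed.

(** [C u] is an L1 limit of the functions [iterf k u], which read only the subtree of [u]. *)
Lemma cond_smeas_subtree u : smeas (approx P (joint_sigma (subtree u) Nt)) (C u).
Proof.
apply: smeas_approx => //.
- exact: joint_sigma_sigma_algebra.
- exact: joint_sigma_measurable.
move=> e /(iterf_cvg_L1 u)[k /(_ k (leqnn k)) h].
exists (iterf Nt mu k u) => //; split; last exact: bmeas_iterf.
by move=> B mB; apply: (joint_sigmaS _ (smeas_iterf mu mB)) => v [].
Qed.

End conditional_solution.

(** * Tree solutions are regular *)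

Section moment_step_values.
Context {d} {Omega : measurableType d} {R : realType} {P : probability Omega R}.
Variables (N : {RV P >-> option nat}) (mom : nat -> R).
Hypothesis mom0 : mom 0%N = 1.

Lemma moment_step1 : moment_step N mom 1 = 1 - pgf N (mom 1%N).
Proof.
rewrite /moment_step 2!big_ord_recr big_ord0/= mom0 pgf1 bin0 bin1 !mulr1n.
by rewrite expr0 expr1; ring.
Qed.

Lemma moment_step2 : moment_step N mom 2 = 1 - 2 * pgf N (mom 1%N) + pgf N (mom 2%N).
Proof.
rewrite /moment_step 3!big_ord_recr big_ord0/= mom0 pgf1 bin0 bin1 binn !mulr1n.
by rewrite expr0 expr1 -mulr_natl; ring.
Qed.

(** Only the last binomial term involves the moment of order [p]; what remains is a function of the
    lower moments. *)
Lemma moment_step_last (mom' : nat -> R) p : (forall j, (j < p)%N -> mom j = mom' j) ->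
  moment_step N mom p - (-1) ^+ p * pgf N (mom p) =
  moment_step N mom' p - (-1) ^+ p * pgf N (mom' p).
Proof.
move=> h; rewrite /moment_step !big_ord_recr/= binn !mulr1n !addrK.
by apply: eq_bigr => -[j jp] _ /=; rewrite h.
Qed.

End moment_step_values.

Section clamped.
Context {d} {Omega : measurableType d} {R : realType} {P : probability Omega R}.
Context {I : choiceType}.
Implicit Types X : I -> {RV P >-> R}.

Lemma measurable_clamp_comp (f : {RV P >-> R}) : measurable_fun setT (clamp \o f).
Proof. exact: measurableT_comp measurable_clamp (measurable_funP f). Qed.

Definition clamp_rv (f : {RV P >-> R}) : {RV P >-> R} := mfun_of (measurable_clamp_comp f).

Lemma clamp_rv01 f w : 0 <= clamp_rv f w <= 1.
Proof. exact: clamp01. Qed.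

Lemma clamp_rv_ae (f : {RV P >-> R}) : {ae P, forall w, 0 <= f w <= 1} ->
  {ae P, forall w, clamp_rv f w = f w}.
Proof. by apply: filterS => w; exact: clamp_id. Qed.

Lemma measurable_preimage_clamp (A : set R) : measurable A -> measurable (clamp @^-1` A).
Proof. by move=> mA; rewrite -[X in measurable X]setTI; exact: measurable_clamp. Qed.

Lemma clamp_mutually_independent D X : mutually_independent D X ->
  mutually_independent D (fun i => clamp_rv (X i)).
Proof.
move=> indX J A JD mA.
by apply: (indX J (fun i => clamp @^-1` A i)) => // i; exact: measurable_preimage_clamp.
Qed.

Lemma clamp_joint_sigma D X : joint_sigma D (fun i => clamp_rv (X i)) `<=` joint_sigma D X.
Proof.
apply: smallest_sub; first exact: joint_sigma_sigma_algebra.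
move=> _ [i Di [A mA <-]]; rewrite setTI.
exact: (joint_sigma_preimage (X:=X) Di (measurable_preimage_clamp mA)).
Qed.

End clamped.

Section tree_solutions.
Context {d} {Omega : measurableType d} {R : realType} {P : probability Omega R}.
Variables (N : {RV P >-> option nat}) (Nt : tree -> {RV P >-> option nat}).
Hypothesis N_pos : {ae P, forall w, N w <> Some 0%N}.
Hypothesis Nt_iid : iid_copies N Nt.

Lemma Ex_same_law_pow (f g : {RV P >-> R}) p :
  (forall w, 0 <= f w <= 1) -> (forall w, 0 <= g w <= 1) ->
  same_law (distribution P f) (distribution P g) ->
  Ex P (fun w => f w ^+ p) = Ex P (fun w => g w ^+ p).
Proof.
move=> f01 g01 fg; apply: (@Ex_same_law _ _ _ _ _ _ _ f g (fun x => x ^+ p) fg) => //.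
  by apply: (bmeasX p (bmeas01 _ f01)).
by apply: (bmeasX p (bmeas01 _ g01)).
Qed.

Lemma tree_solution_reg (X : tree -> {RV P >-> R}) : tree_solution Nt X ->
  exists mu : R, [/\ 0 < mu < 1, pgf N mu = 1 - mu,
    reg_solution Nt mu (fun u => clamp_rv (X u)) &
    forall u p, Ex P (fun w => clamp_rv (X u) w ^+ p) =
      Ex P (fun w => clamp_rv (X [::]) w ^+ p)].
Proof.
move=> solX; pose X' u := clamp_rv (X u); pose mu := Ex P (X' [::]).
have X01 u w : 0 <= X' u w <= 1 by exact: clamp_rv01.
have bX u : bmeas (X' u) by apply: bmeas01.
have momE u p : Ex P (fun w => X' u w ^+ p) = Ex P (fun w => X' [::] w ^+ p).
  apply: Ex_same_law_pow => // A mA.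
  exact: (ts_law solX u [::] (measurable_preimage_clamp mA)).
have mean u : Ex P (X' u) = mu.
  rewrite /mu; have := momE u 1%N.
  by under eq_Ex do rewrite expr1; under [in RHS]eq_Ex do rewrite expr1.
have X'X u : {ae P, forall w, X' u w = X u w} by apply: clamp_rv_ae; exact: (ts_range solX).
have ind n : mutually_independent (level n) X'.
  by apply: clamp_mutually_independent; exact: (ts_indep solX).
have past_ind n : independent_sigma P (joint_sigma (level n) X') (joint_sigma (past n) Nt).
  by move=> A B /clamp_joint_sigma FA FB; exact: (ts_indep_past solX FA FB).
have rde u : {ae P, forall w, X' u w = 1 - prod_ext (Nt u w) (fun i => X' (rcons u i) w)}.
  have : {ae P, forall w, forall i, X' (rcons u i) w = X (rcons u i) w}.
    by apply/ae_foralln => i; exact: X'X.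
  apply: filterS3 (X'X u) (ts_rde solX u) => w -> -> h.
  by congr (1 - prod_ext _ _); apply/funext => i; rewrite h.
have indc u : mutually_independent setT (fun i => X' (rcons u i)).
  by apply: (children_mutually_independent (u := u) (ind (size u).+1)).
(* With mean 1 all daughters of the root would be almost surely 1, and the root almost surely 0. *)
have mu1 : mu < 1.
  rewrite lt_neqAle; apply/andP; split; last first.
    rewrite /mu -[leRHS](Ex_cst P 1); apply: Ex_le => //; first exact: bmeas_cst.
    by move=> w; case/andP: (X01 [::] w).
  apply/eqP => mu1.
  have EX i : Ex P (X' (rcons [::] i)) = 1 by rewrite mean.
  have := prod_ext1 (Nt [::]) (fun i => X01 (rcons [::] i)) EX.
  move=> h; have : Ex P (X' [::]) = Ex P (cst 0).
    apply: Ex_ae => //.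
    by apply: filterS2 (rde [::]) h => w -> ->; rewrite subrr.
  by rewrite Ex_cst -/mu mu1 => /eqP; rewrite oner_eq0.
have reg : reg_solution Nt mu X'.
  split => // u.
  have := prod_ext_fin (Nt u) (fun i => X01 (rcons u i)) (indc u) mu1 (fun i => mean (rcons u i)).
  by apply: filterS2 (rde u) => w -> ->.
pose mom p := Ex P (fun w => X' [::] w ^+ p).
have mom0 : mom 0%N = 1.
  by rewrite /mom -[RHS](Ex_cst P 1); apply: eq_Ex => w; rewrite expr0.
have mom1 : mom 1%N = mu by rewrite /mom /mu; under eq_Ex do rewrite expr1.
have muE : mom 1%N = 1 - pgf N (mom 1%N).
  by rewrite -moment_step1//; exact: (reg_solution_moments Nt_iid 1 mu1 reg momE).
have muH : pgf N mu = 1 - mu by move: muE; rewrite mom1; lra.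
exists mu; split => //; rewrite mu1 andbT lt_neqAle; apply/andP; split.
  (* The mean is not 0 since [pgf N 0 = 0]; this is where an offspring number 0 is excluded. *)
  apply/eqP => mu0; move: muH; rewrite -mu0 pgf0// subr0 => /eqP.
  by rewrite eq_sym oner_eq0.
by apply: Ex_ge0 => w; case/andP: (X01 [::] w).
Qed.

(** The function [pgf N x + x] is strictly increasing on [0, 1). *)
Lemma pgf_fixed_unique (m m' : R) : 0 < m < 1 -> 0 < m' < 1 ->
  pgf N m = 1 - m -> pgf N m' = 1 - m' -> m = m'.
Proof.
move=> /andP[m0 m1] /andP[m'0 m'1] Hm Hm'.
have [mm|mm|//] := ltgtP m m'.
  by have := pgf_le N (ltW m0) (ltW mm) m'1; lra.
by have := pgf_le N (ltW m'0) (ltW mm) m1; lra.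
Qed.

End tree_solutions.

(** * Conditional probabilities and completion *)

Section conditional_probability.
Context {d} {Omega : measurableType d} {R : realType} (P : probability Omega R).
Variables (F : set (set Omega)) (E : set Omega) (Y : {RV P >-> R}).
Hypotheses (Fm : F `<=` measurable) (mE : measurable E).
Hypothesis condY : is_cond_prob F E Y.

Lemma cond_prob_smeas : smeas F Y.
Proof. by move=> B mB; apply: condY.1; exists B => //; rewrite setTI. Qed.

Let A n : set Omega := Y @^-1` `[1 + n.+1%:R^-1, +oo[.
Let B n : set Omega := Y @^-1` `]-oo, - n.+1%:R^-1].

(** On [A n] the integral of [Y] is at least [(1 + 1 / (n + 1)) * P (A n)], yet it equals
    [P (A n & E)], at most [P (A n)]; so [A n] is null. On [B n] the integral would be negative
    unless [B n] is null. *)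
Lemma cond_prob_range : {ae P, forall w, 0 <= Y w <= 1}.
Proof.
have FA n : F (A n) by apply: cond_prob_smeas; exact: measurable_itv.
have FB n : F (B n) by apply: cond_prob_smeas; exact: measurable_itv.
have mA n := Fm (FA n); have mB n := Fm (FB n).
have e0 n : (0 : R) < n.+1%:R^-1 by rewrite invr_gt0.
have mY D : measurable_fun D (fun w => (Y w)%:E).
  by apply/measurable_EFinP; apply: measurable_funTS; exact: measurable_funP.
have PA n : P (A n) = 0%E.
  have h : ((1 + n.+1%:R^-1)%:E * P (A n) <= P (A n `&` E))%E.
    rewrite -(condY.2 _ (FA n)) -integral_cst//; apply: ge0_le_integral => //.
      by move=> w _; rewrite lee_fin addr_ge0// ltW.
    by move=> w; rewrite /A /= in_itv/= andbT lee_fin.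
  have h2 : (P (A n `&` E) <= P (A n))%E.
    by apply: le_measure; rewrite ?inE//; exact: measurableI.
  have := le_trans h h2; rewrite !prE// -EFinM lee_fin => h3.
  have h4 := pr_ge0 P (A n); congr EFin; apply/eqP; rewrite eq_le h4 andbT.
  by move: h3; rewrite mulrDl mul1r gerDl pmulr_rle0.
have PB n : P (B n) = 0%E.
  have Bneg w : B n w -> n.+1%:R^-1 <= - Y w by rewrite /B /= in_itv/= lerNr.
  have h : (n.+1%:R^-1%:E * P (B n) <= \int[P]_(w in B n) (- Y w)%:E)%E.
    rewrite -integral_cst//; apply: ge0_le_integral => //.
    - by move=> w _; rewrite lee_fin ltW.
    - apply/measurable_EFinP; apply: measurable_funTS.
      by apply: measurableT_comp => //; exact: measurable_funP.
  have h2 : (\int[P]_(w in B n) (- Y w)%:E <= 0)%E.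
    have e : (\int[P]_(w in B n) (Y w)%:E = - \int[P]_(w in B n) (- Y w)%:E)%E.
      rewrite -integral_ge0N.
        by apply: eq_integral => w _; rewrite -EFinN opprK.
      by move=> w /Bneg h'; rewrite lee_fin (le_trans _ h')// ltW.
    by rewrite -[leLHS]oppeK -e oppe_le0 (condY.2 _ (FB n)).
  have := le_trans h h2; rewrite prE// -EFinM lee_fin => h3.
  have h4 := pr_ge0 P (B n); congr EFin; apply/eqP; rewrite eq_le h4 andbT.
  by move: h3; rewrite pmulr_rle0.
have hA : {ae P, forall w, forall n, ~ A n w}.
  by apply/ae_foralln => n; exists (A n); split => [//||w /=]; [exact: PA|exact: contrapT].
have hB : {ae P, forall w, forall n, ~ B n w}.
  by apply/ae_foralln => n; exists (B n); split => [//||w /=]; [exact: PB|exact: contrapT].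
apply: filterS2 hA hB => w nA nB; apply/andP; split.
  rewrite leNgt; apply/negP => Y0.
  have Y0' : 0 < - Y w by rewrite oppr_gt0.
  apply: (nB (Num.truncn (- Y w)^-1)); rewrite /B /= in_itv/= lerNr.
  rewrite invf_ple ?posrE//; exact/ltW/truncnS_gt.
rewrite leNgt; apply/negP => Y1.
have Y1' : 0 < Y w - 1 by rewrite subr_gt0.
apply: (nA (Num.truncn (Y w - 1)^-1)); rewrite /A /= in_itv/= andbT -lerBrDl.
rewrite invf_ple ?posrE//; exact/ltW/truncnS_gt.
Qed.

Lemma cond_prob_clamp D : F D ->
  Ex P (fun w => clamp_rv Y w * \1_D w) = pr P (D `&` E).
Proof.
move=> FD; have mD := Fm FD.
rewrite /pr -(condY.2 _ FD) /Ex /Rintegral; congr fine.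
rewrite [RHS]integral_mkcond; apply: ae_eq_integral => //.
- apply/measurable_EFinP; apply: measurable_funM; first exact: measurable_funP.
  exact: measurable_indic.
- apply: (measurable_restrictT _ _).1 => //.
  by apply/measurable_EFinP; apply: measurable_funTS; exact: measurable_funP.
- apply: filterS (clamp_rv_ae cond_prob_range) => w /= -> _.
  by rewrite patchE indicE; case: ifP => _; rewrite ?mulr1 ?mulr0.
Qed.

End conditional_probability.

Section completion.
Context {d} {Omega : measurableType d} {R : realType} (P : probability Omega R).
Variable F : set (set Omega).
Hypothesis sF : sigma_algebra setT F.

Lemma completed_sigma_intro (A A' : set Omega) : F A' ->
  P.-negligible (A `+` A') -> completed_sigma P F A.
Proof.
move=> FA' nAA'; pose TG := g_sigma_algebraType (F `|` [set A | P.-negligible A]).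
have neg B : P.-negligible B -> completed_sigma P F B.
  by move=> nB; apply: sub_sigma_algebra; right.
have -> : A = (A' `\` (A' `\` A)) `|` (A `\` A').
  apply/seteqP; split=> [w Aw|w [[A'w h]|[]//]].
    have [A'w|A'w] := pselect (A' w); [left|by right].
    by split => // -[].
  by apply: contrapT => nA; apply: h.
apply: (@measurableU _ TG).
  apply: (@measurableD _ TG); first by apply: sub_sigma_algebra; left.
  by apply: neg; apply: negligibleS nAA' => w [A'w nA]; right.
by apply: neg; apply: negligibleS nAA' => w [Aw nA]; left.
Qed.

(** The sets that differ from a member of [F] by a negligible set already form a sigma-algebra. *)
Lemma completed_sigma_elim (A : set Omega) : completed_sigma P F A ->
  exists2 A', F A' & P.-negligible (A `+` A').
Proof.
pose G := [set A | exists2 A', F A' & P.-negligible (A `+` A')].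
suff : completed_sigma P F `<=` G by apply.
have [F0 FC FU] := sF.
apply: smallest_sub; last first.
  move=> B [FB|nB]; first by exists B => //; rewrite setYK; exact: negligible_set0.
  by exists set0 => //; rewrite setY0.
split.
- by exists set0 => //; rewrite setY0; exact: negligible_set0.
- move=> B [B' FB' nB]; exists (setT `\` B'); first exact: FC.
  apply: negligibleS nB => w; rewrite /setY !setTD /= => -[[nB nnB]|[nB' nnB]].
    by right; split => //; apply: contrapT.
  by left; split => //; apply: contrapT.
- move=> B hB; have [B' B'P] := choice (fun n => (exists2P _ _).1 (hB n)).
  exists (\bigcup_n B' n); first by apply: FU => n; have [] := B'P n.
  apply: (@negligibleS _ _ _ _ (\bigcup_n (B n `+` B' n))); last first.
    by apply: negligible_bigcup => n; have [] := B'P n.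
  move=> w [[[n _ Bw] nB']|[[n _ B'w] nB]]; exists n => //.
    by left; split => // B'w; apply: nB'; exists n.
  by right; split => // Bw; apply: nB; exists n.
Qed.

Lemma completed_smeas_lt (X Y : Omega -> R) :
  smeas (completed_sigma P F) X -> smeas (completed_sigma P F) Y ->
  exists2 A, F A & P.-negligible ([set w | X w < Y w] `+` A).
Proof.
move=> /smeasP mX /smeasP mY; apply: completed_sigma_elim.
have h := measurable_fun_ltr mX mY measurableT (Y := [set true]) I.
by rewrite setTI in h.
Qed.

Lemma smeas_completed (X : Omega -> R) : smeas F X -> smeas (completed_sigma P F) X.
Proof. by move=> FX B mB; apply: sub_sigma_algebra; left; exact: FX. Qed.

Hypothesis Fm : F `<=` measurable.

Lemma Ex_agree_negligible (X Y : Omega -> R) A A' : bmeas X -> bmeas Y ->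
  measurable A -> F A' -> P.-negligible (A `+` A') ->
  (forall B, F B -> Ex P (fun w => X w * \1_B w) = Ex P (fun w => Y w * \1_B w)) ->
  Ex P (fun w => X w * \1_A w) = Ex P (fun w => Y w * \1_A w).
Proof.
move=> bX bY mA FA' nAA' XY; have mA' := Fm FA'.
have AE Z : bmeas Z -> Ex P (fun w => Z w * \1_A w) = Ex P (fun w => Z w * \1_A' w :> R).
  move=> bZ; apply: Ex_ae; [exact: (bmeasM bZ (bmeas_indic mA)).1|exact: (bmeasM bZ (bmeas_indic mA')).1|].
  apply: negligibleS nAA' => w /= h; rewrite /setY /=; apply: contrapT => h2; apply: h.
  congr (_ * _); rewrite !indicE; congr (_%:R); congr nat_of_bool; apply/idP/idP; rewrite !inE => h3.
    by apply: contrapT => h4; apply: h2; left.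
  by apply: contrapT => h4; apply: h2; right.
by rewrite !AE// XY.
Qed.

(** The two integrals are compared on the event [X < Y], which is a member of [F] up to a negligible
    set. *)
Lemma completed_le (X Y : Omega -> R) : bmeas X -> bmeas Y ->
  smeas (completed_sigma P F) X -> smeas (completed_sigma P F) Y ->
  (forall B, F B -> Ex P (fun w => X w * \1_B w) = Ex P (fun w => Y w * \1_B w)) ->
  {ae P, forall w, Y w <= X w}.
Proof.
move=> bX bY FX FY XY; have [A' FA' nA] := completed_smeas_lt FX FY.
set A := [set w | X w < Y w] in nA.
(* A set of the completion may fail to be measurable; here measurability comes from [X] and [Y]
   being measurable on the whole space. *)
have mA : measurable A.
  have h := measurable_fun_ltr bX.1 bY.1 measurableT (Y := [set true]) I.
  by rewrite setTI in h.
have bd : bmeas (fun w => (Y w - X w) * \1_A w).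
  by apply: bmeasM; [exact: bmeasB|exact: bmeas_indic].
have : {ae P, forall w, (Y w - X w) * \1_A w = 0}.
  apply: Ex_eq0; [exact: bd.1| |exact: bd.2|].
    move=> w; rewrite indicE; have [Aw|nAw] := pselect (A w); last by rewrite memNset// mulr0.
    by rewrite mem_set// mulr1 subr_ge0 ltW.
  have -> : Ex P (fun w => (Y w - X w) * \1_A w) = Ex P (fun w => Y w * \1_A w - X w * \1_A w).
    by apply: eq_Ex => w; rewrite mulrBl.
  rewrite ExB; [|by apply: bmeasM => //; exact: bmeas_indic..].
  by rewrite (Ex_agree_negligible bX bY mA FA' nA XY) subrr.
apply: filterS => w; rewrite leNgt => h; apply/negP => XYw; move: h.
by rewrite indicE mem_set// mulr1 => /eqP; rewrite subr_eq0 gt_eqF.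
Qed.

Lemma completed_unique (X Y : Omega -> R) : bmeas X -> bmeas Y ->
  smeas (completed_sigma P F) X -> smeas (completed_sigma P F) Y ->
  (forall B, F B -> Ex P (fun w => X w * \1_B w) = Ex P (fun w => Y w * \1_B w)) ->
  {ae P, forall w, X w = Y w}.
Proof.
move=> bX bY FX FY XY.
have h1 := completed_le bX bY FX FY XY.
have h2 := completed_le bY bX FY FX (fun B FB => esym (XY B FB)).
by apply: filterS2 h1 h2 => w YX XY'; apply/eqP; rewrite eq_le XY'.
Qed.

End completion.

(** * Independent variables of a given law *)

Section uniform.
Context {d} {Omega : measurableType d} {R : realType} {P : probability Omega R}.
Variables (X : nat -> {RV P >-> R}) (p : R) (s : nat -> nat).
Hypothesis indX : mutually_independent setT X.
Hypothesis p01 : 0 < p < 1.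
Hypothesis Xp : forall i, pr P (X i @^-1` [set 1]) = p.
Hypothesis s_inj : injective s.

Let digit n : set Omega := X (s n) @^-1` [set 1].

(* Left end points and lengths of the nested intervals obtained by splitting
   an interval in the ratio [p : 1 - p] and keeping the left part when the
   next digit is 1. *)
Fixpoint seg_lo_len n w : R * R :=
  if n is m.+1 then
    let: (a, l) := seg_lo_len m w in
    (a + (1 - \1_(digit m) w) * (p * l),
     \1_(digit m) w * (p * l) + (1 - \1_(digit m) w) * ((1 - p) * l))
  else (0, 1).

Definition seg_lo n w := (seg_lo_len n w).1.
Definition seg_len n w := (seg_lo_len n w).2.

Lemma seg_loS n w : seg_lo n.+1 w = seg_lo n w + (1 - \1_(digit n) w) * (p * seg_len n w).
Proof. by rewrite /seg_lo /seg_len /=; case: (seg_lo_len n w). Qed.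

Lemma seg_lenS n w : seg_len n.+1 w =
  \1_(digit n) w * (p * seg_len n w) + (1 - \1_(digit n) w) * ((1 - p) * seg_len n w).
Proof. by rewrite /seg_len /=; case: (seg_lo_len n w). Qed.

Lemma digit_cases n w :
  (digit n w /\ \1_(digit n) w = 1 :> R) \/ (~ digit n w /\ \1_(digit n) w = 0 :> R).
Proof.
rewrite indicE; have [h|h] := pselect (digit n w); [left|right].
  by rewrite mem_set.
by rewrite memNset.
Qed.

Let rho := Num.max p (1 - p).

Lemma rho01 : 0 <= rho < 1.
Proof.
have /andP[p0 p1] := p01.
by rewrite /rho le_max gt_max; apply/andP; split; [apply/orP; left|apply/andP; split]; lra.
Qed.

Lemma seg_len_bounds n w : 0 < seg_len n w <= rho ^+ n.
Proof.
have /andP[p0 p1] := p01.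
elim: n => [|n /andP[IH1 IH2]]; first by rewrite expr0 /seg_len /= ltr01 lexx.
have pr1 : p <= rho by rewrite /rho le_max lexx.
have pr2 : 1 - p <= rho by rewrite /rho le_max lexx orbT.
have q0 : 0 < 1 - p by rewrite subr_gt0.
rewrite seg_lenS exprS.
case: (digit_cases n w) => -[_ ->]; rewrite ?subrr ?subr0 ?mul1r ?mul0r ?addr0 ?add0r;
  by rewrite mulr_gt0//= ler_pM// ltW.
Qed.

Lemma seg_lo_le m n w : (m <= n)%N -> seg_lo m w <= seg_lo n w.
Proof.
have /andP[p0 p1] := p01.
elim: n => [|n IH]; first by rewrite leqn0 => /eqP ->.
rewrite leq_eqVlt => /predU1P[->//|]; rewrite ltnS => /IH h.
apply: (le_trans h); rewrite seg_loS lerDl.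
have /andP[l0 _] := seg_len_bounds n w.
by case: (digit_cases n w) => -[_ ->]; rewrite ?subrr ?subr0 ?mul1r ?mul0r// mulr_ge0// ltW.
Qed.

Lemma seg_hi_le m n w : (m <= n)%N ->
  seg_lo n w + seg_len n w <= seg_lo m w + seg_len m w.
Proof.
have /andP[p0 p1] := p01.
elim: n => [|n IH]; first by rewrite leqn0 => /eqP ->.
rewrite leq_eqVlt => /predU1P[->//|]; rewrite ltnS => /IH h.
apply: le_trans h; rewrite seg_loS seg_lenS.
have /andP[l0 _] := seg_len_bounds n w.
by case: (digit_cases n w) => -[_ ->]; nra.
Qed.

(** The common point of the nested intervals, as in a binary expansion with biased digits. Reading
    the digits along [s] allows independent copies from one sequence, using disjoint ranges. *)
Definition unif w := limn (fun n => seg_lo n w).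

Lemma seg_lo_bounds n w : 0 <= seg_lo n w <= 1.
Proof.
apply/andP; split; first by have := seg_lo_le w (leq0n n).
have := seg_hi_le w (leq0n n); have /andP[l0 _] := seg_len_bounds n w.
by rewrite /seg_lo /seg_len /=; move: l0; rewrite /seg_len; lra.
Qed.

Lemma unif_cvg w : (fun n => seg_lo n w) @ \oo --> unif w.
Proof.
apply: nondecreasing_is_cvgn; first by move=> m n; exact: seg_lo_le.
by exists 1 => _ [n _ <-]; case/andP: (seg_lo_bounds n w).
Qed.

Lemma unif_bounds n w : seg_lo n w <= unif w <= seg_lo n w + seg_len n w.
Proof.
apply/andP; split.
  apply: limr_ge; first exact: unif_cvg.
  by exists n => // m; exact: seg_lo_le.
apply: limr_le; first exact: unif_cvg.
exists n => // m /= nm; apply: le_trans (seg_hi_le w nm).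
by rewrite lerDl ltW//; case/andP: (seg_len_bounds m w).
Qed.

Lemma unif01 w : 0 <= unif w <= 1.
Proof. by have := unif_bounds 0 w; rewrite /seg_lo /seg_len /= add0r. Qed.

Let before n : set nat := s @` `I_n.

Lemma digit_before m n : (m < n)%N -> joint_sigma (before n) X (digit m).
Proof. by move=> mn; apply: joint_sigma_preimage; [exists m|exact: measurable_set1]. Qed.

Lemma smeas_seg m n : (m <= n)%N ->
  smeas (joint_sigma (before n) X) (seg_lo m) /\ smeas (joint_sigma (before n) X) (seg_len m).
Proof.
elim: m => [_|m IH mn]; first by split; apply/smeasP; exact: measurable_cst.
have [/smeasP mlo /smeasP mlen] := IH (ltnW mn).
have /smeasP md := smeas_indic (R:=R) (joint_sigma_sigma_algebra (before n) X) (digit_before mn).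
have mc (c : R) : measurable_fun [set: g_sigma_algebraType
  (\bigcup_(i in before n) g_sigma_algebra_preimage (X i))] (cst c) by exact: measurable_cst.
split; apply/smeasP.
  have -> : seg_lo m.+1 = (fun w => seg_lo m w + (1 - \1_(digit m) w) * (p * seg_len m w)).
    by apply/funext => w; exact: seg_loS.
  apply: measurable_funD => //; apply: measurable_funM; first exact: measurable_funB.
  exact: measurable_funM.
have -> : seg_len m.+1 = (fun w => \1_(digit m) w * (p * seg_len m w) +
    (1 - \1_(digit m) w) * ((1 - p) * seg_len m w)).
  by apply/funext => w; exact: seg_lenS.
apply: measurable_funD; apply: measurable_funM => //; [exact: measurable_funM|exact: measurable_funB|].
exact: measurable_funM.
Qed.

Lemma smeas_unif : smeas (joint_sigma (range s) X) unif.
Proof.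
apply/smeasP; apply: (@measurable_fun_cvg _ (g_sigma_algebraType _) _ _ seg_lo); last first.
  by move=> w _; exact: unif_cvg.
move=> n; apply/smeasP => B mB; have [h _] := smeas_seg (leqnn n).
by apply: (joint_sigmaS _ (h B mB)) => _ [k _ <-]; exists k.
Qed.

Lemma measurable_unif : measurable_fun setT unif.
Proof. by apply: smeasW smeas_unif; exact: joint_sigma_measurable. Qed.

(** Lengths are positive, so the inverse is the power [-1]. *)
Lemma measurable_seg_len_inv d0 (T : measurableType d0) (f : T -> Omega) n :
  measurable_fun setT (seg_len n \o f) -> measurable_fun setT (fun w => (seg_len n (f w))^-1).
Proof.
move=> ml; have -> : (fun w => (seg_len n (f w))^-1) = (@powR R ^~ (-1)) \o (seg_len n \o f).
  by apply/funext => w /=; rewrite powR_inv1// ltW//; case/andP: (seg_len_bounds n (f w)).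
by apply: measurableT_comp => //; exact: measurable_powR.
Qed.

(* The conditional probability of [unif <= t] given the first [n] digits. *)
Definition seg_frac t n w : R := clamp ((t - seg_lo n w) / seg_len n w).

(** [clamp] is the uniform distribution function; the interval is split at [p] and the distribution
    functions of both parts are averaged with their weights. *)
Lemma clamp_split (y : R) :
  p * clamp (y / p) + (1 - p) * clamp ((y - p) / (1 - p)) = clamp y.
Proof.
have /andP[p0 p1] := p01; have q0 : 0 < 1 - p by rewrite subr_gt0.
have c1 (x : R) : 1 <= x -> clamp x = 1 by move=> x1; rewrite /clamp min_l// max_r.
have c0 (x : R) : x <= 0 -> clamp x = 0.
  by move=> x0; rewrite /clamp min_r ?max_l// (le_trans x0).
have [y0|y0] := leP y 0.
  rewrite !c0 ?mulr0 ?addr0//; first by rewrite pmulr_lle0 ?invr_gt0//; lra.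
  by rewrite pmulr_lle0 ?invr_gt0.
have [y1|y1] := leP 1 y.
  rewrite !c1//; [lra|by rewrite ler_pdivlMr// mul1r; lra|by rewrite ler_pdivlMr// mul1r; lra].
rewrite [RHS]clamp_id; last by rewrite !ltW.
have [yp|yp] := leP y p.
  rewrite [clamp (y / p)]clamp_id; last first.
    by apply/andP; split; [rewrite divr_ge0// ltW|rewrite ler_pdivrMr// mul1r].
  rewrite c0; last by rewrite pmulr_lle0 ?invr_gt0//; lra.
  by rewrite mulr0 addr0 mulrC divfK// gt_eqF.
rewrite c1; last by rewrite ler_pdivlMr// mul1r ltW.
rewrite clamp_id; last first.
  by apply/andP; split; [rewrite divr_ge0//; lra|rewrite ler_pdivrMr// mul1r; lra].
by rewrite mulr1 mulrC divfK ?gt_eqF//; ring.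
Qed.

(** [seg_frac t] is a martingale started at [t]: the next digit is independent of the earlier ones,
    and averaging over it is [clamp_split]. *)
Lemma Ex_seg_frac t n : 0 <= t <= 1 -> Ex P (seg_frac t n) = t.
Proof.
move=> t01; have /andP[p0 p1] := p01; have q0 : 0 < 1 - p by rewrite subr_gt0.
elim: n => [|n IH].
  rewrite -[RHS](Ex_cst P); apply: eq_Ex => w.
  by rewrite /seg_frac /seg_lo /seg_len /= subr0 divr1 clamp_id.
have [/smeasP mlo /smeasP mlen] := smeas_seg (leqnn n).
pose G := \bigcup_(i in before n) g_sigma_algebra_preimage (X i).
have sc (g : Omega -> R) : measurable_fun [set: g_sigma_algebraType G] (g : g_sigma_algebraType G -> R) ->
    smeas (joint_sigma (before n) X) (fun w => clamp (g w)).
  by move=> mg; apply: (smeas_comp measurable_clamp); apply/smeasP.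
have bc (g : Omega -> R) : smeas (joint_sigma (before n) X) (fun w => clamp (g w)) ->
    bmeas (fun w => clamp (g w)).
  move=> sg; apply: bmeas01; last by move=> w; exact: clamp01.
  by apply: smeasW sg; exact: joint_sigma_measurable.
have mc (c : R) : measurable_fun [set: g_sigma_algebraType G] (cst c) by exact: measurable_cst.
have minv : measurable_fun [set: g_sigma_algebraType G] (fun w => (seg_len n w)^-1).
  exact: (@measurable_seg_len_inv _ (g_sigma_algebraType G) id n mlen).
pose y w := (t - seg_lo n w) / seg_len n w.
have my : measurable_fun [set: g_sigma_algebraType G] y.
  by apply: measurable_funM => //; exact: measurable_funB.
pose g1 w := clamp (y w / p); pose g0 w := clamp ((y w - p) / (1 - p)).
have s1 : smeas (joint_sigma (before n) X) g1.
  by apply: sc; apply: measurable_funM.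
have s0 : smeas (joint_sigma (before n) X) g0.
  by apply: sc; apply: measurable_funM => //; exact: measurable_funB.
have b1 : bmeas g1 by exact: bc s1.
have b0 : bmeas g0 by exact: bc s0.
have md : measurable (digit n) by apply: preimage_measurable; exact: measurable_set1.
have bd : bmeas (\1_(digit n) : Omega -> R) by exact: bmeas_indic.
have sd : smeas (joint_sigma [set s n] X) (\1_(digit n) : Omega -> R).
  apply: smeas_indic; first exact: joint_sigma_sigma_algebra.
  by apply: joint_sigma_preimage => //; exact: measurable_set1.
have ind : independent_sigma P (joint_sigma (before n) X) (joint_sigma [set s n] X).
  apply: joint_sigma_indep indX _ _ _ => //.
  by rewrite -subset0 => _ [[k /= kn <-]] /s_inj kE; rewrite kE ltnn in kn.
have E g : smeas (joint_sigma (before n) X) g -> bmeas g ->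
    Ex P (fun w => g w * \1_(digit n) w) = Ex P g * p.
  move=> sg bg; rewrite (Ex_indep (joint_sigma_sigma_algebra _ X) (joint_sigma_sigma_algebra _ X)
    _ _ ind sg bg sd bd); [|exact: joint_sigma_measurable..].
  by rewrite Ex_indic// Xp.
have -> : Ex P (seg_frac t n.+1) =
    Ex P (fun w => g1 w * \1_(digit n) w + (g0 w - g0 w * \1_(digit n) w)).
  apply: eq_Ex => w; rewrite /seg_frac seg_loS seg_lenS.
  have /andP[l0 _] := seg_len_bounds n w.
  case: (digit_cases n w) => -[_ ->].
    rewrite !mulr1 !mul1r subrr !mul0r !addr0 subrr addr0 /g1 /y.
    by congr clamp; field; rewrite !gt_eqF.
  rewrite !mulr0 !mul0r subr0 !mul1r !add0r subr0 /g0 /y.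
  congr clamp; field; rewrite !gt_eqF//.
have b1d : bmeas (fun w => g1 w * \1_(digit n) w) by exact: bmeasM.
have b0d : bmeas (fun w => g0 w * \1_(digit n) w) by exact: bmeasM.
rewrite ExD//; last exact: bmeasB.
rewrite ExB// !E// -[RHS]IH.
transitivity (Ex P (fun w => p * g1 w + (1 - p) * g0 w)).
  rewrite ExD; [|by apply: bmeasM => //; exact: bmeas_cst..].
  by rewrite !ExZ//; ring.
by apply: eq_Ex => w; rewrite /g1 /g0 clamp_split.
Qed.

(** [seg_frac u n] is 1 when the [n]-th interval lies below [u] and 0 when it lies above. The
    interval has length at most [rho ^+ n], so this compares [u] with the distribution function at
    [u - rho ^+ n] and [u + rho ^+ n]. *)
Lemma unif_law t : 0 <= t <= 1 -> pr P (unif @^-1` `]-oo, t]) = t.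
Proof.
have mU (u : R) : measurable (unif @^-1` `]-oo, u]).
  by rewrite -[X in measurable X]setTI; apply: measurable_unif => //; exact: measurable_itv.
have /andP[r0 r1] := rho01.
have bfrac u n : bmeas (seg_frac u n).
  apply: bmeas01; last by move=> w; exact: clamp01.
  have [m1 m2] := smeas_seg (leqnn n).
  have sm := joint_sigma_measurable (D := before n) (X := X).
  apply: measurableT_comp; first exact: measurable_clamp.
  apply: measurable_funM; first by apply: measurable_funB => //; exact: smeasW sm m1.
  exact: (@measurable_seg_len_inv _ Omega id n (smeasW sm m2)).
have up u n : 0 <= u <= 1 -> pr P (unif @^-1` `]-oo, u - rho ^+ n]) <= u.
  move=> u01; rewrite -[leRHS](Ex_seg_frac n u01) -Ex_indic//.
  apply: Ex_le => //; first exact: bmeas_indic.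
  move=> w; rewrite indicE; case: (boolP (w \in _)) => [|_]; last first.
    by have /andP[] := clamp01 ((u - seg_lo n w) / seg_len n w).
  rewrite inE /= in_itv/= => uw; rewrite /seg_frac /clamp min_l ?max_r//.
  have /andP[l0 lr] := seg_len_bounds n w; have /andP[h1 h2] := unif_bounds n w.
  by rewrite ler_pdivlMr// mul1r; lra.
have lw u n : 0 <= u <= 1 -> u <= pr P (unif @^-1` `]-oo, u + rho ^+ n]).
  move=> u01; rewrite -[leLHS](Ex_seg_frac n u01) -Ex_indic//.
  apply: Ex_le => //; first exact: bmeas_indic.
  move=> w; rewrite indicE; case: (boolP (w \in _)) => [_|].
    by have /andP[] := clamp01 ((u - seg_lo n w) / seg_len n w).
  rewrite notin_setE /= in_itv/= => /negP; rewrite -ltNge => uw.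
  have /andP[l0 lr] := seg_len_bounds n w; have /andP[h1 h2] := unif_bounds n w.
  rewrite /seg_frac /clamp min_r ?max_l//.
    by rewrite pmulr_lle0 ?invr_gt0//; lra.
  by rewrite (@le_trans _ _ 0)// pmulr_lle0 ?invr_gt0//; lra.
have cv : (fun n => rho ^+ n) @ \oo --> (0 : R) by apply: cvg_expr; rewrite ger0_norm.
move=> /andP[t0 t1]; apply/eqP; rewrite eq_le; apply/andP; split.
  have [->|tn1] := eqVneq t 1; first exact: pr_le1.
  have t1' : t < 1 by rewrite lt_neqAle tn1.
  apply/ler_addgt0Pr => e e0.
  (* The [1 - t] keeps the shifted point [t + rho ^+ n] in [0, 1], where [Ex_seg_frac] applies. *)
  have m0 : 0 < Num.min e (1 - t) by rewrite lt_min e0 subr_gt0.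
  have /cvgrPdist_le /(_ _ m0)[n _ /(_ n (leqnn n))] := cv.
  rewrite sub0r normrN ger0_norm ?exprn_ge0// le_min => /andP[h1 h2].
  have u01 : 0 <= t + rho ^+ n <= 1.
    by rewrite addr_ge0 ?exprn_ge0//=; lra.
  have := up _ n u01; rewrite addrK => /le_trans; apply; lra.
have [<-|tn0] := eqVneq 0 t; first exact: pr_ge0.
have t0' : 0 < t by rewrite lt_neqAle tn0.
apply/ler_addgt0Pr => e e0.
have m0 : 0 < Num.min e t by rewrite lt_min e0.
have /cvgrPdist_le /(_ _ m0)[n _ /(_ n (leqnn n))] := cv.
rewrite sub0r normrN ger0_norm ?exprn_ge0// le_min => /andP[h1 h2].
have rn0 : 0 <= rho ^+ n by rewrite exprn_ge0.
have u01 : 0 <= t - rho ^+ n <= 1 by apply/andP; split; lra.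
by have := lw _ n u01; rewrite subrK; lra.
Qed.

End uniform.

(** * The quantile function of a law on [0, 1] *)

Section quantile.
Context {R : realType} (nu : probability R R).
Hypothesis nu01 : nu [set` `[0, 1]] = 1%E.

Definition cdf_on (x : R) : R := pr nu `]-oo, x].

Lemma cdf_on_le x y : x <= y -> cdf_on x <= cdf_on y.
Proof.
move=> xy; apply: pr_le; [exact: measurable_itv..|].
by move=> z /=; rewrite !in_itv/= => /le_trans; apply.
Qed.

Lemma cdf_on_ge1 x : 1 <= x -> cdf_on x = 1.
Proof.
move=> x1; apply/eqP; rewrite eq_le pr_le1/=; last exact: measurable_itv.
have <- : pr nu [set` `[0, 1]] = 1 by rewrite /pr nu01.
apply: pr_le; [exact: measurable_itv..|move=> z /=; rewrite !in_itv/= => /andP[_ z1]].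
exact: le_trans x1.
Qed.

Lemma cdf_on_lt0 x : x < 0 -> cdf_on x = 0.
Proof.
move=> x0; apply/eqP; rewrite eq_le pr_ge0 andbT.
have mI : measurable [set` `[(0:R), 1]] by exact: measurable_itv.
have -> : (0 : R) = pr nu (~` [set` `[0, 1]]) by rewrite pr_setC// /pr nu01 subrr.
apply: pr_le; [exact: measurable_itv|exact: measurableC|].
move=> z /=; rewrite !in_itv/= => zx; apply/negP; rewrite negb_and -ltNge.
by rewrite (le_lt_trans zx).
Qed.

Lemma cdf_on_right x : cdf_on (x + n.+1%:R^-1) @[n --> \oo] --> cdf_on x.
Proof.
have mI y : measurable (`]-oo, y] : set R) by exact: measurable_itv.
rewrite /cdf_on; under eq_fun do rewrite -Ex_indic//.
rewrite -Ex_indic//; apply: (@Ex_cvg _ _ _ _ _ _ 1) => //.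
- by move=> n z; rewrite indicE; case: (_ \in _); rewrite /= ?normr0 ?normr1.
- apply: aeW => z; apply: cvg_near_cst.
  have [zx|xz] := leP z x.
    apply: nearW => n; rewrite !indicE !mem_set//= in_itv/=//.
    by rewrite (le_trans zx)// lerDl.
  near=> n; rewrite !indicE !memNset//= in_itv/=; apply/negP; rewrite -ltNge//.
  rewrite -ltrBrDl invf_plt ?posrE ?subr_gt0//.
  near: n; apply: filterS (nbhs_infty_gtr (z - x)^-1) => n.
  by move=> /lt_trans; apply; rewrite ltr_nat.
Unshelve. all: by end_near.
Qed.

Definition quantile_set u : set R := [set x | 0 <= x <= 1 /\ Num.min u 1 <= cdf_on x].

(* Truncating [u] at 1 keeps the set nonempty, hence [inf] meaningful. *)
Definition quantile u : R := inf (quantile_set u).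

Lemma quantile_has_inf u : has_inf (quantile_set u).
Proof.
split; last by exists 0 => x [/andP[]].
by exists 1; split; rewrite ?lexx ?ler01// cdf_on_ge1// ge_min lexx orbT.
Qed.

Lemma quantile01 u : 0 <= quantile u <= 1.
Proof.
have [ne lb] := quantile_has_inf u; apply/andP; split.
  by apply: lb_le_inf => // x [/andP[]].
apply: ge_inf => //; split; rewrite ?lexx ?ler01//.
by rewrite cdf_on_ge1// ge_min lexx orbT.
Qed.

(** Right continuity of the distribution function makes the infimum attained, so the quantile
    function is its generalized inverse. *)
Lemma quantile_le u x : 0 <= x <= 1 -> (quantile u <= x) = (Num.min u 1 <= cdf_on x).
Proof.
move=> x01; have hi := quantile_has_inf u; apply/idP/idP => h; last first.
  by apply: ge_inf; [case: hi|split].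
have cv := @cdf_on_right x; rewrite -(cvg_lim _ cv)//.
apply: limr_ge; [exact: cvgP cv|apply: nearW => n].
have e0 : (0 : R) < n.+1%:R^-1 by rewrite invr_gt0.
have [z [_ zF] zq] := inf_adherent e0 hi.
apply: (le_trans zF); apply: cdf_on_le.
by rewrite ltW// (lt_le_trans zq)// lerD2r.
Qed.

Lemma measurable_quantile : measurable_fun setT quantile.
Proof.
apply: (measurability _ (@RGenOInfty.measurableE R)) => _ [_ [x ->] <-].
rewrite setTI; have [x0|x0] := ltP x 0.
  rewrite (_ : _ @^-1` _ = setT)//; apply/seteqP; split => // u _ /=.
  by rewrite in_itv/= andbT (lt_le_trans x0)//; case/andP: (quantile01 u).
have [x1|x1] := leP 1 x.
  rewrite (_ : _ @^-1` _ = set0)//; apply/seteqP; split => // u /=.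
  by rewrite in_itv/= andbT ltNge (le_trans _ x1)//; case/andP: (quantile01 u).
have E : quantile @^-1` `]x, +oo[ = [set u | cdf_on x < Num.min u 1].
  have e u : (x < quantile u) = (cdf_on x < Num.min u 1) by rewrite !ltNge quantile_le// x0 ltW.
  by apply/seteqP; split => u /=; rewrite in_itv/= andbT e.
rewrite E (_ : [set _ | _] = (fun u => Num.min u 1) @^-1` `]cdf_on x, +oo[); last first.
  by apply/seteqP; split => u /=; rewrite in_itv/= andbT.
rewrite -[X in measurable X]setTI; apply: measurable_minr => //; exact: measurable_itv.
Qed.

End quantile.

Section iid.
Context {d} {Omega : measurableType d} {R : realType} {P : probability Omega R}.
Variables (X : nat -> {RV P >-> R}) (p : R).
Hypothesis indX : mutually_independent setT X.
Hypothesis p01 : 0 < p < 1.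
Hypothesis Xp : forall i, pr P (X i @^-1` [set 1]) = p.

Lemma iid_exists (nu : probability R R) : nu [set` `[0, 1]] = 1%E ->
  exists Z : nat -> {RV P >-> R}, [/\ forall i w, 0 <= Z i w <= 1,
    mutually_independent setT Z,
    forall i, same_law (distribution P (Z i)) nu &
    joint_sigma setT Z `<=` joint_sigma setT X].
Proof.
(* The coding of pairs cuts the index set into infinitely many disjoint infinite rows; row [i]
   supplies the digits of the [i]-th uniform variable. *)
move=> nu01; pose s (i j : nat) : nat := choice.pickle (i, j).
have s_inj i : injective (s i) by move=> j k /(pcan_inj (@choice.pickleK _)) [].
pose U i := unif X p (s i).
have mU i : measurable_fun setT (U i) by exact: measurable_unif.
have mZ i : measurable_fun setT (quantile nu \o U i).
  by apply: measurableT_comp => //; exact: measurable_quantile.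
pose Z i : {RV P >-> R} := mfun_of (mZ i).
have sZ i : smeas (joint_sigma (range (s i)) X) (Z i).
  by apply: (smeas_comp (measurable_quantile nu01)); exact: smeas_unif.
exists Z; split.
- by move=> i w; exact: quantile01.
- apply: (approx_mutually_independent (block := fun i => range (s i)) indX) => //.
    by move=> i _ B mB; apply: sub_approx; [exact: joint_sigma_measurable|exact: sZ].
  move=> i j _ _ ij; rewrite -subset0 => _ [[k _ <-] [l _ /(pcan_inj (@choice.pickleK _)) [ji _]]].
  by move: ij; rewrite ji eqxx.
- move=> i; apply: cdf_law => t.
  have U01 w : 0 <= U i w <= 1 by exact: unif01.
  have mt : measurable (Z i @^-1` `]-oo, t]).
    by apply: preimage_measurable; exact: measurable_itv.
  transitivity (pr P (Z i @^-1` `]-oo, t]))%:E; first by rewrite -prE.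
  transitivity (cdf_on nu t)%:E; last by rewrite /cdf_on -prE//; exact: measurable_itv.
  congr EFin; have [t0|t0] := ltP t 0.
    rewrite cdf_on_lt0// (_ : _ @^-1` _ = set0) ?/pr ?measure0//.
    apply/seteqP; split => // w /=; rewrite in_itv/= leNgt (lt_le_trans t0)//.
    by case/andP: (quantile01 nu01 (U i w)).
  have [t1|t1] := leP 1 t.
    rewrite cdf_on_ge1// (_ : _ @^-1` _ = setT) ?pr_setT//.
    apply/seteqP; split => // w _ /=; rewrite in_itv/= (le_trans _ t1)//.
    by case/andP: (quantile01 nu01 (U i w)).
  have F01 : 0 <= cdf_on nu t <= 1.
    by rewrite pr_ge0/= pr_le1//; exact: measurable_itv.
  rewrite -[RHS](unif_law indX p01 Xp (s_inj i) F01); congr pr.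
  have e w : (quantile nu (U i w) <= t) = (U i w <= cdf_on nu t).
    rewrite (quantile_le nu01); last by rewrite t0 ltW.
    by rewrite min_l//; case/andP: (U01 w).
  by apply/seteqP; split => w /=; rewrite !in_itv/= e.
- apply: smallest_sub; first exact: joint_sigma_sigma_algebra.
  move=> _ [i _ [B mB <-]]; rewrite setTI.
  by apply: (joint_sigmaS _ (sZ i B mB)).
Qed.

End iid.

(** * Invariant laws and their moments *)

Section strict_convexity.
Context {R : realType} (H : R -> R).
Hypothesis scH : strictly_convex_on [set` `[0, 1[] H.

(** Strict convexity at three points, cleared of denominators for use in linear arithmetic. *)
Lemma chord_lt x y z : 0 <= x -> x < y -> y < z -> z < 1 ->
  (z - x) * H y < (z - y) * H x + (y - x) * H z.
Proof.
move=> x0 xy yz z1; have xz : 0 < z - x by rewrite subr_gt0 (lt_trans xy).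
pose t := (z - y) / (z - x).
have t01 : 0 < t < 1.
  apply/andP; split; first by rewrite divr_gt0// subr_gt0.
  by rewrite ltr_pdivrMr// mul1r ltrD2l ltrN2.
have Dx : [set` `[0, 1[] x by rewrite /= in_itv/= x0; lra.
have Dz : [set` `[0, 1[] z by rewrite /= in_itv/=; lra.
have nxz : x != z by rewrite lt_eqF// (lt_trans xy).
have := scH Dx Dz nxz t01.
have tE : t * (z - x) = z - y by rewrite /t divfK// gt_eqF.
have -> : t * x + (1 - t) * z = y by nra.
rewrite -(ltr_pM2l xz).
have -> : (z - x) * (t * H x + (1 - t) * H z) =
    t * (z - x) * H x + ((z - x) - t * (z - x)) * H z by ring.
by rewrite tE; nra.
Qed.

Lemma no_three_roots x y z : 0 <= x -> x < y -> y < z -> z < 1 ->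
  H x - x = H y - y -> H y - y = H z - z -> False.
Proof. by move=> x0 xy yz z1 h1 h2; have := chord_lt x0 xy yz z1; nra. Qed.

(** [H x - x] is strictly convex; taking equal values at [b < c], it is strictly decreasing to the
    left of [b], hence injective there. *)
Lemma root_left_unique x y b c : 0 <= x -> x < y -> y <= b -> b < c -> c < 1 ->
  H x - x = H y - y -> H b - b = H c - c -> False.
Proof.
move=> x0 xy; rewrite le_eqVlt => /predU1P[yb|yb].
  by move: xy; rewrite yb => xb bc c1 h1 h2; exact: (no_three_roots x0 xb bc c1 h1 h2).
move=> bc c1 h1 h2.
have k1 := chord_lt x0 xy yb (lt_trans bc c1).
have k2 := chord_lt (ltW (le_lt_trans x0 xy)) yb bc c1.
have hxy : 0 < y - x by rewrite subr_gt0.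
have hcb : 0 < c - b by rewrite subr_gt0.
(* Equal values at [x < y] force a larger value at [b] than at [y]; equal values at [b < c] force
   the opposite. *)
have e1 : (y - x) * (H x - x) < (y - x) * (H b - b) by nra.
have e2 : (c - b) * (H b - b) < (c - b) * (H y - y) by nra.
move: e1 e2; rewrite !ltr_pM2l//; lra.
Qed.

End strict_convexity.

Section invariance.
Context {d} {Omega : measurableType d} {R : realType} {P : probability Omega R}.
Variables (N : {RV P >-> option nat}) (nu : probability R R).
Hypothesis nu01 : nu [set` `[0, 1]] = 1%E.

(** The identity on the space [(R, nu)], clamped so that its range is [0, 1] everywhere: a variable
    of law [nu]. *)
Definition nu_rv : {RV nu >-> R} := mfun_of measurable_clamp.

Definition nu_moment p : R := Ex nu (fun x => nu_rv x ^+ p).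

Lemma nu_rv_ae : {ae nu, forall x, nu_rv x = x}.
Proof.
have mI : measurable (`[(0:R), 1]%classic) by exact: measurable_itv.
exists (~` `[(0:R), 1]%classic); split; first exact: measurableC.
  by have := probability_setC nu mI; rewrite nu01 subee.
move=> x /= h xI; apply: h; rewrite /nu_rv /=; apply: clamp_id.
by move: xI; rewrite in_itv.
Qed.

Lemma nu_rv_law : same_law (distribution nu nu_rv) nu.
Proof.
move=> A mA; have mA' := preimage_measurable nu_rv mA.
rewrite /distribution /pushforward !prE//; congr EFin.
apply: pr_negligible => //; apply: negligibleS nu_rv_ae => x /= h.
by rewrite /setY /= /preimage /= => e; move: h; rewrite e => -[[]|[]].
Qed.

Let b_nu : bmeas nu_rv.
Proof. by apply: bmeas01 => [|x]; [exact: measurable_clamp|exact: clamp01]. Qed.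

Lemma nu_moment0 : nu_moment 0 = 1.
Proof. by rewrite -[RHS](Ex_cst nu 1); apply: eq_Ex => x; rewrite expr0. Qed.

Lemma nu_moment_le p q : (p <= q)%N -> nu_moment q <= nu_moment p.
Proof.
move=> pq; apply: Ex_le; [exact: bmeasX..|move=> x].
by have /andP[c0 c1] := clamp01 x; rewrite ler_wiXn2l.
Qed.

Lemma nu_moment_ge0 p : 0 <= nu_moment p.
Proof. by apply: Ex_ge0 => x; rewrite exprn_ge0//; case/andP: (clamp01 x). Qed.

Lemma nu_moment_sqr : nu_moment 1 ^+ 2 <= nu_moment 2.
Proof.
have : 0 <= Ex nu (fun x => (nu_rv x - nu_moment 1) ^+ 2) by apply: Ex_ge0 => x; exact: sqr_ge0.
have -> : Ex nu (fun x => (nu_rv x - nu_moment 1) ^+ 2) =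
    Ex nu (fun x => (nu_rv x ^+ 2 - 2 * nu_moment 1 * nu_rv x ^+ 1) + cst (nu_moment 1 ^+ 2) x).
  by apply: eq_Ex => x; rewrite /=; ring.
have bX2 := bmeasX 2 b_nu; have bX1 := bmeasX 1 b_nu.
have bm : bmeas (fun x => 2 * nu_moment 1 * nu_rv x ^+ 1) by apply: bmeasM => //; exact: bmeas_cst.
rewrite ExD; [|exact: bmeasB|exact: bmeas_cst].
rewrite ExB// ExZ// Ex_cst -/(nu_moment 2) -/(nu_moment 1); lra.
Qed.

Lemma rv_nu_moment d' (Omega' : measurableType d') (P' : probability Omega' R)
    (X : {RV P' >-> R}) p : (forall w, 0 <= X w <= 1) -> same_law (distribution P' X) nu ->
  Ex P' (fun w => X w ^+ p) = nu_moment p.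
Proof.
move=> X01 Xnu; have h : same_law (distribution P' X) (distribution nu nu_rv).
  by move=> A mA; rewrite (Xnu A mA); apply/esym/nu_rv_law.
apply: (@Ex_same_law _ _ _ _ _ _ _ X nu_rv (fun x => x ^+ p) h) => //.
  by apply: (bmeasX p (bmeas01 _ X01)).
exact: bmeasX p b_nu.
Qed.

Lemma law_of_moments d' (Omega' : measurableType d') (P' : probability Omega' R)
    (Z : Omega' -> R) : measurable_fun setT Z -> (forall w, 0 <= Z w <= 1) ->
  (forall p, Ex P' (fun w => Z w ^+ p) = nu_moment p) ->
  same_law (pushforward P' Z) nu.
Proof.
move=> mZ Z01 ZE A mA; rewrite -(nu_rv_law mA).
by apply: (@moments_law _ _ _ P' _ _ nu Z nu_rv) => //; exact: clamp01.
Qed.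

Lemma invariant_law_of_moments : nu_moment 1 < 1 ->
  (forall p, nu_moment p = moment_step N nu_moment p) -> invariant_law N nu.
Proof.
move=> m1 mE d' Omega' P' N' X N'N X01 indX Xnu indN'.
have EX i p : Ex P' (fun w => X i w ^+ p) = nu_moment p by exact: rv_nu_moment.
have EX1 i : Ex P' (X i) = nu_moment 1.
  by rewrite -(EX i 1%N); apply: eq_Ex => w; rewrite expr1.
apply: law_of_moments.
- apply: measurable_funB; first exact: measurable_cst.
  exact: measurable_prod_ext.
- by move=> w; have := prod_ext01 N' X01 w; lra.
move=> p; rewrite mE (moment_step_same_law (N' := N')) ?nu_moment0//; last 2 first.
- by move=> A mA; apply/esym/N'N.
- by move=> j; rewrite nu_moment_ge0/= (le_lt_trans (nu_moment_le (ltn0Sn j))).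
rewrite -(Ex_moment_step X01 indX indN' EX m1); apply: Ex_ae.
- apply: (@measurable_funX _ _ R setT _ p); apply: measurable_funB; first exact: measurable_cst.
  exact: measurable_prod_ext.
- apply: (@measurable_funX _ _ R setT _ p); apply: measurable_funB; first exact: measurable_cst.
  exact: (@measurable_prod_fin _ _ _ N' (fun i w => X i w)).
by apply: filterS (prod_ext_fin N' X01 indX m1 EX1) => w ->.
Qed.

Lemma invariant_law_moments (N' : {RV P >-> option nat}) (Z : nat -> {RV P >-> R}) :
  same_law (distribution P N') (distribution P N) ->
  (forall i w, 0 <= Z i w <= 1) -> mutually_independent setT Z ->
  (forall i, same_law (distribution P (Z i)) nu) ->
  independent_sigma P (joint_sigma setT Z) (g_sigma_algebra_preimage N') ->
  invariant_law N nu ->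
  nu_moment 1 < 1 /\ (forall p, nu_moment p = moment_step N nu_moment p).
Proof.
move=> N'N Z01 indZ Znu indN' inv.
have EZ i p : Ex P (fun w => Z i w ^+ p) = nu_moment p by exact: rv_nu_moment.
have EZ1 i : Ex P (Z i) = nu_moment 1.
  by rewrite -(EZ i 1%N); apply: eq_Ex => w; rewrite expr1.
have mV : measurable_fun setT (fun w => 1 - prod_ext (N' w) (Z ^~ w)).
  by apply: measurable_funB; [exact: measurable_cst|exact: measurable_prod_ext].
pose V : {RV P >-> R} := mfun_of mV.
have V01 w : 0 <= V w <= 1 by have := prod_ext01 N' Z01 w; rewrite /V /=; lra.
have Vnu : same_law (distribution P V) nu by exact: (inv _ _ P N' Z N'N Z01 indZ Znu indN').
have EV p : Ex P (fun w => V w ^+ p) = nu_moment p by exact: rv_nu_moment.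
have m1 : nu_moment 1 < 1.
  rewrite lt_neqAle; apply/andP; split; last by rewrite -nu_moment0; exact: nu_moment_le.
  apply/eqP => m1; have h := prod_ext1 N' Z01 (fun i => etrans (EZ1 i) m1).
  have : Ex P (fun w => V w ^+ 1) = Ex P (cst 0).
    apply: Ex_ae => //.
    by apply: filterS h => w; rewrite /V /= => ->; rewrite subrr expr0n.
  by rewrite EV Ex_cst m1 => /eqP; rewrite oner_eq0.
split => // p; rewrite -(moment_step_same_law _ N'N) ?nu_moment0//; last first.
  by move=> j; rewrite nu_moment_ge0/= (le_lt_trans (nu_moment_le (ltn0Sn j))).
rewrite -(Ex_moment_step Z01 indZ indN' EZ m1) -EV; apply: Ex_ae.
- exact: (@measurable_funX _ _ R setT _ p).
- apply: (@measurable_funX _ _ R setT _ p); apply: measurable_funB; first exact: measurable_cst.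
  exact: (@measurable_prod_fin _ _ _ N' (fun i w => Z i w)).
by apply: filterS (prod_ext_fin N' Z01 indZ m1 EZ1) => w; rewrite /V /= => ->.
Qed.

(** On [0, 1] the difference [x - x ^+ 2] is nonnegative; with mean 0 it vanishes almost surely, and
    all positive powers of [x] coincide. *)
Lemma nu_moment_two_values p : nu_moment 2 = nu_moment 1 -> nu_moment p.+1 = nu_moment 1.
Proof.
move=> h; have b1 := bmeasX 1 b_nu; have b2 := bmeasX 2 b_nu.
have bd : bmeas (fun x => nu_rv x ^+ 1 - nu_rv x ^+ 2) by exact: bmeasB.
have : {ae nu, forall x, nu_rv x ^+ 1 - nu_rv x ^+ 2 = 0}.
  apply: Ex_eq0; [exact: bd.1| |exact: bd.2|].
    move=> x; rewrite subr_ge0; have /andP[c0 c1] := clamp01 x.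
    by rewrite ler_wiXn2l.
  by rewrite ExB// -/(nu_moment 1) -/(nu_moment 2) h subrr.
move=> ae; apply: Ex_ae; [exact: (bmeasX p.+1 b_nu).1|exact: b1.1|].
apply: filterS ae => x /eqP; rewrite subr_eq0 => /eqP e.
by elim: p => // p IH; rewrite exprS IH -exprS -e.
Qed.

End invariance.

(** * The conditional solution and its moments *)

Section conditional_tree_solution.
Context {d} {Omega : measurableType d} {R : realType} {P : probability Omega R}.
Variables (N : {RV P >-> option nat}) (Nt : tree -> {RV P >-> option nat}) (mu : R).
Hypothesis Nt_iid : iid_copies N Nt.
Hypothesis mu01 : 0 < mu < 1.
Hypothesis muH : pgf N mu = 1 - mu.
Variables X C : tree -> {RV P >-> R}.
Hypothesis regX : reg_solution Nt mu X.
Hypothesis C01 : forall u w, 0 <= C u w <= 1.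
Hypothesis C_smeas : forall u, smeas (joint_sigma setT Nt) (C u).
Hypothesis CX : forall u A, joint_sigma setT Nt A ->
  Ex P (fun w => C u w * \1_A w) = Ex P (fun w => X u w * \1_A w).

Let bX u : bmeas (X u). Proof. by apply: bmeas01 => //; exact: (rs_range regX). Qed.
Let bC u : bmeas (C u). Proof. exact: bmeas01. Qed.

(** The subtrees rooted at level [n] are disjoint from each other and from the earlier
    generations. *)
Lemma approx_level_independent (Y : tree -> {RV P >-> R}) n :
  (forall u, smeas (approx P (joint_sigma (subtree u) Nt)) (Y u)) ->
  mutually_independent (level n) Y /\
  independent_sigma P (joint_sigma (level n) Y) (joint_sigma (past n) Nt).
Proof.
move=> aY; split.
  apply: (approx_mutually_independent (block := subtree) Nt_iid.1) => //.
  by move=> u v un vn; apply: subtree_disjoint; rewrite un vn.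
move=> A B /(approx_joint_sigma (fun u _ => aY u) (subset_refl (A := level n))) aA pB.
have aB := sub_approx P (joint_sigma_measurable (X:=Nt)) pB.
have := approx_independent Nt_iid.1 (@subsetT _ _) (@subsetT _ _) _ aA aB; apply.
rewrite -subset0 => v [[u un uv] vn].
by have : (subtree u `&` past n) v by []; rewrite subtree_past.
Qed.

Lemma cond_reg_solution : reg_solution Nt mu C.
Proof.
have aC u : smeas (approx P (joint_sigma (subtree u) Nt)) (C u).
  exact: (cond_smeas_subtree mu01 regX C01 C_smeas CX).
split => //.
- by move=> n; have [] := approx_level_independent n aC.
- by move=> n; have [] := approx_level_independent n aC.
- exact: (cond_rde mu01 regX).
- move=> u; rewrite -(rs_mean regX u).
  have FT : joint_sigma setT Nt setT.
    exact: (@measurableT _ (g_sigma_algebraType _)).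
  transitivity (Ex P (fun w => C u w * \1_setT w)).
    by apply: eq_Ex => w; rewrite indicT mulr1.
  by rewrite (CX u FT); apply: eq_Ex => w; rewrite indicT mulr1.
Qed.

Lemma cond_moments u p : Ex P (fun w => C u w ^+ p) = Ex P (fun w => C [::] w ^+ p).
Proof.
have h v := @cond_moment _ _ _ _ _ _ _ Nt_iid mu01 muH _ _ regX C01 C_smeas CX v p.
exact: (eq_cvgn_lim (h u) (h [::]) (fun=> erefl)).
Qed.

(** [Y'] is needed because the given family agrees only almost surely with its clamped version. Null
    modifications do not affect [approx], so independence survives; equality of moments gives
    equality of laws. *)
Lemma tree_solution_of_reg (Y Y' : tree -> {RV P >-> R}) :
  reg_solution Nt mu Y ->
  (forall u v p, Ex P (fun w => Y u w ^+ p) = Ex P (fun w => Y v w ^+ p)) ->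
  (forall u, smeas (approx P (joint_sigma (subtree u) Nt)) (Y u)) ->
  (forall u, {ae P, forall w, Y u w = Y' u w}) -> tree_solution Nt Y'.
Proof.
move=> regY momY aY YY'; have mu1 : mu < 1 by case/andP: mu01.
have aY' u : smeas (approx P (joint_sigma (subtree u) Nt)) (Y' u).
  move=> B mB; have mYB := preimage_measurable (Y u) mB.
  have mYB' := preimage_measurable (Y' u) mB.
  split => // e /((aY u B mB).2 e)[A' FA' AA']; exists A' => //.
  have mA' := joint_sigma_measurable FA'.
  apply: le_trans (sdist_triangle _ mYB' mYB mA') _.
  rewrite (_ : sdist P (Y' u @^-1` B) (Y u @^-1` B) = 0) ?add0r//.
  rewrite -[RHS](Ex_cst P 0); apply: Ex_ae => //; first exact: (bmeas_sdist mYB' mYB).1.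
  apply: filterS (YY' u) => w e'; rewrite !indicE.
  have -> : (w \in Y' u @^-1` B) = (w \in Y u @^-1` B).
    by apply/idP/idP; rewrite !inE /preimage /= e'.
  by rewrite subrr normr0.
split.
- by move=> u; apply: filterS (YY' u) => w <-; exact: (rs_range regY).
- by move=> n; have [] := approx_level_independent n aY'.
- by move=> n; have [] := approx_level_independent n aY'.
- move=> u.
  have h : {ae P, forall w, forall i, Y (rcons u i) w = Y' (rcons u i) w}.
    by apply/ae_foralln => i; exact: YY'.
  have indc : mutually_independent setT (fun i => Y (rcons u i)).
    by apply: (children_mutually_independent (u := u) (rs_indep regY (n := (size u).+1))).
  have h2 := prod_ext_fin (Nt u) (fun i => rs_range regY (rcons u i)) indc mu1
    (fun i => rs_mean regY (rcons u i)).
  have h3 := rs_rde regY u.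
  apply: filterS3 (YY' u) h (filterI h2 h3) => w <- hw [e2 ->]; rewrite -e2.
  by congr (1 - prod_ext _ _); apply/funext => i.
- move=> u v A mA; rewrite /distribution /pushforward.
  have mP (f : {RV P >-> R}) : measurable (f @^-1` A) by exact: preimage_measurable.
  have e t : pr P (Y' t @^-1` A) = pr P (Y t @^-1` A).
    apply: pr_negligible => //; apply: negligibleS (YY' t) => w /= h e'; move: h.
    by rewrite /setY /preimage /= e' => -[[]|[]].
  rewrite !prE// !e; congr EFin; rewrite /pr; congr fine.
  apply: moments_law => //; first exact: (rs_range regY u).
  exact: (rs_range regY v).
Qed.

Lemma cond_tree_solution (C' : tree -> {RV P >-> R}) :
  (forall u, {ae P, forall w, C u w = C' u w}) -> tree_solution Nt C'.
Proof.
apply: tree_solution_of_reg; first exact: cond_reg_solution.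
  by move=> u v p; rewrite !(cond_moments _ p).
by move=> u; exact: (cond_smeas_subtree mu01 regX).
Qed.

Let c p := Ex P (fun w => C [::] w ^+ p).

Lemma cond_moment_step p : c p = moment_step N c p.
Proof.
apply: (reg_solution_moments Nt_iid _ _ cond_reg_solution); first by case/andP: mu01.
by move=> u q; exact: cond_moments.
Qed.

Lemma cond_moment0 : c 0 = 1.
Proof. by rewrite -[RHS](Ex_cst P 1); apply: eq_Ex => w; rewrite expr0. Qed.

Lemma cond_moment1 : c 1 = mu.
Proof. by rewrite -(rs_mean cond_reg_solution [::]); apply: eq_Ex => w; rewrite expr1. Qed.

Lemma cond_moment_le p q : (p <= q)%N -> c q <= c p.
Proof.
move=> pq; apply: Ex_le; [exact: bmeasX..|move=> x].
by have /andP[c0 c1] := C01 [::] x; rewrite ler_wiXn2l.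
Qed.

Lemma cond_moment_ge0 p : 0 <= c p.
Proof. by apply: Ex_ge0 => x; rewrite exprn_ge0//; case/andP: (C01 [::] x). Qed.

Lemma cond_moment2_root : pgf N (c 2) - c 2 = pgf N mu - mu.
Proof.
have := cond_moment_step 2; rewrite moment_step2 ?cond_moment0// cond_moment1 muH; lra.
Qed.

Lemma cond_moment2_le x : mu ^+ 2 <= x -> x < 1 -> 1 - 2 * pgf N mu + pgf N x <= x -> c 2 <= x.
Proof.
move=> mx x1 fx; have cv := @cond_moment _ _ _ _ _ _ _ Nt_iid mu01 muH _ _ regX C01 C_smeas CX [::] 2.
have mom0 k : iter_moment N mu k 0 = 1.
  rewrite -(Ex_iterf_pow Nt_iid mu01 muH k [::]) -[RHS](Ex_cst P 1).
  by apply: eq_Ex => w; rewrite expr0.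
have h k : 0 <= iter_moment N mu k 2 <= x.
  apply/andP; split.
    rewrite -(Ex_iterf_pow Nt_iid mu01 muH k [::]).
    by apply: Ex_ge0 => w; exact: sqr_ge0.
  elim: k => [|k IH] //=; rewrite moment_step2// iter_moment1//.
  apply: le_trans fx; rewrite lerD2l; apply: pgf_le => //.
  rewrite -(Ex_iterf_pow Nt_iid mu01 muH k [::]).
  by apply: Ex_ge0 => w; exact: sqr_ge0.
rewrite -[c 2](cvg_lim _ cv)//; apply: limr_le; first exact: cvgP cv.
by apply: nearW => k; case/andP: (h k).
Qed.

Hypothesis scH : strictly_convex_on [set` `[0, 1[] (pgf N).

Lemma cond_moment2_lt : 1 < derive1 (pgf N) mu -> c 2 < mu.
Proof.
move=> H1; have /andP[mu0 mu1] := mu01.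
have mm : mu ^+ 2 < mu by rewrite expr2 gtr_pMr.
have e0 : 0 < derive1 (pgf N) mu - 1 by rewrite subr_gt0.
(* Near [mu] the slope of the chord from [x] to [mu] exceeds 1, which says exactly that the
   second-moment map does not increase [x]; [x > mu ^+ 2] places it above the starting point. *)
have [x /andP[mx xmu] hx] := derive1_left_slope (pgf_derivable (N:=N) mu01) mm e0.
apply: (le_lt_trans _ xmu); apply: cond_moment2_le; [exact: ltW|lra|].
have xm0 : 0 < mu - x by rewrite subr_gt0; lra.
have : 1 < (pgf N mu - pgf N x) / (mu - x) by move: hx; rewrite ltr_norml; lra.
by rewrite ltr_pdivlMr// mul1r muH; lra.
Qed.

(** The chord from [b] to [mu] has slope 1. The slope from the midpoint to [mu] is already some
    [sl > 1], and slopes to [mu] increase towards it, so the derivative is at least [sl]. *)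
Lemma derive1_gt1 b : 0 <= b < mu -> pgf N b - b = pgf N mu - mu -> 1 < derive1 (pgf N) mu.
Proof.
move=> /andP[b0 bmu] Hb; have /andP[mu0 mu1] := mu01.
pose y := (b + mu) / 2.
have [by_ ymu] : b < y /\ y < mu by rewrite /y; split; lra.
have ky := chord_lt scH b0 by_ ymu mu1.
have y0 : 0 <= y by lra.
pose sl := (pgf N mu - pgf N y) / (mu - y).
have my0 : 0 < mu - y by rewrite subr_gt0.
have sl1 : 1 < sl.
  have bE : b = 2 * y - mu by rewrite /y; field.
  have k2 : (mu - y) * (2 * pgf N y) < (mu - y) * (pgf N b + pgf N mu).
    by move: ky; rewrite [in mu - b]bE [in y - b]bE; lra.
  by move: k2 Hb; rewrite ltr_pM2l// ltr_pdivlMr// mul1r; lra.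
rewrite ltNge; apply/negP => H1.
have e0 : 0 < sl - 1 by rewrite subr_gt0.
have [x /andP[yx xmu] hx] := derive1_left_slope (pgf_derivable (N:=N) mu01) ymu e0.
have mx0 : 0 < mu - x by rewrite subr_gt0.
have kx := chord_lt scH y0 yx xmu mu1.
have : sl <= (pgf N mu - pgf N x) / (mu - x).
  rewrite ler_pdivlMr// /sl mulrAC ler_pdivrMr//; nra.
by move: hx; rewrite ltr_norml; lra.
Qed.

Lemma cond_moment2_cases : c 2 = mu \/ c 2 < mu.
Proof.
have : c 2 <= mu by rewrite -cond_moment1; exact: cond_moment_le.
by rewrite le_eqVlt => /predU1P[->|]; [left|right].
Qed.

Lemma cond_moment2_eq : derive1 (pgf N) mu <= 1 -> c 2 = mu.
Proof.
move=> H1; case: cond_moment2_cases => // c2.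
have c2' : 0 <= c 2 < mu by rewrite cond_moment_ge0.
by have := derive1_gt1 c2' cond_moment2_root; rewrite ltNge H1.
Qed.

Lemma moments_determined (m : nat -> R) : m 0 = 1 -> m 1 < 1 -> (forall p, 0 <= m p) ->
  (forall p q, (p <= q)%N -> m q <= m p) -> m 1 ^+ 2 <= m 2 ->
  {ae P, forall w, N w <> Some 0%N} ->
  (forall p, m p = moment_step N m p) ->
  m 1 = mu /\ (m 2 = mu \/ forall p, m p = c p).
Proof.
move=> m0 m1lt mge0 mle mJ N_pos mE; have /andP[mu0 mu1] := mu01.
have m1H : pgf N (m 1) = 1 - m 1 by have := mE 1%N; rewrite moment_step1//; lra.
have m1gt : 0 < m 1.
  rewrite lt_neqAle mge0 andbT; apply/eqP => m10; move: m1H.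
  by rewrite -m10 pgf0// subr0 => /eqP; rewrite eq_sym oner_eq0.
have m1E : m 1 = mu.
  by apply: (@pgf_fixed_unique _ _ _ _ N) => //; rewrite m1gt.
split => //; have [m2|m2] := eqVneq (m 2) mu; [by left|right].
have m2lt : m 2 < mu by rewrite lt_neqAle m2 -m1E mle.
have m2H : pgf N (m 2) - m 2 = pgf N mu - mu.
  by have := mE 2%N; rewrite moment_step2// m1E muH; lra.
(* [m 2] is a fixed point of the second-moment map and at least [mu ^+ 2] by Jensen's inequality. *)
have c2le : c 2 <= m 2.
  apply: cond_moment2_le; [by rewrite -m1E|lra|].
  by have := mE 2%N; rewrite moment_step2// m1E => {2}->.
have c2E : c 2 = m 2.
  apply/eqP; rewrite eq_le c2le/= leNgt; apply/negP => c2lt.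
  apply: (@no_three_roots _ (pgf N) scH (c 2) (m 2) mu) => //.
    exact: cond_moment_ge0.
  by rewrite cond_moment2_root m2H.
elim/ltn_ind => -[|[|[|p]]] IH; rewrite ?m0 ?cond_moment0 ?m1E ?cond_moment1//.
(* With equal lower moments, this compares [x + pgf N x] for odd orders and [x - pgf N x] for even
   ones. *)
have ml := moment_step_last N IH.
rewrite -mE -cond_moment_step in ml.
(* Moments decrease with the order, so both candidates lie in the range left of [m 2] where
   [pgf N x - x] is injective. *)
have mp2 : m p.+3 <= m 2 by exact: mle.
have cp2 : c p.+3 <= m 2 by rewrite -c2E; exact: cond_moment_le.
have root x y : 0 <= x -> x < y -> y <= m 2 -> pgf N x - x = pgf N y - y -> False.
  by move=> x0 xy y2 h; exact: (root_left_unique scH x0 xy y2 m2lt mu1 h m2H).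
have mono x y : 0 <= x -> x <= y -> y <= m 2 -> pgf N x <= pgf N y.
  by move=> x0 xy y2; apply: pgf_le => //; lra.
case: (ltgtP (m p.+3) (c p.+3)) => // lt.
- have h := mono _ _ (mge0 p.+3) (ltW lt) cp2.
  have := root _ _ (mge0 p.+3) lt cp2.
  move: ml; rewrite -signr_odd; case: (odd p.+3); rewrite ?expr0 ?expr1 => ml r; last by exfalso; apply: r; lra.
  by lra.
- have h := mono _ _ (cond_moment_ge0 p.+3) (ltW lt) mp2.
  have := root _ _ (cond_moment_ge0 p.+3) lt mp2.
  move: ml; rewrite -signr_odd; case: (odd p.+3); rewrite ?expr0 ?expr1 => ml r; last by exfalso; apply: r; lra.
  by lra.
Qed.

Hypothesis Xdisc : forall u, {ae P, forall w, X u w = 0 \/ X u w = 1}.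

Lemma disc_sqr u p : Ex P (fun w => X u w ^+ p.+1) = mu.
Proof.
rewrite -(rs_mean regX u); apply: Ex_ae => //; first exact: (bmeasX p.+1 (bX u)).1.
by apply: filterS (Xdisc u) => w [->|->]; rewrite ?expr0n// expr1n.
Qed.

(** [E[X C] = E[C ^+ 2]] since [C] is a conditional expectation, so [E[(X - C) ^+ 2] = mu - 2 * mu +
    mu = 0]. *)
Lemma cond_disc_eq u : c 2 = mu -> {ae P, forall w, X u w = C u w}.
Proof.
move=> c2; have sF := joint_sigma_sigma_algebra setT Nt.
have XC : Ex P (fun w => X u w * C u w) = mu.
  rewrite -c2 /c -(cond_moments u); transitivity (Ex P (fun w => C u w * C u w)); last first.
    by apply: eq_Ex => w; rewrite expr2.
  apply/esym/(Ex_agree sF _ (bC u) (bX u) _ (C_smeas u) (bC u)); last exact: CX.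
  exact: joint_sigma_measurable.
have bd : bmeas (fun w => (X u w - C u w) ^+ 2) by apply: bmeasX; exact: bmeasB.
have : {ae P, forall w, (X u w - C u w) ^+ 2 = 0}.
  apply: Ex_eq0; [exact: bd.1|by move=> w; exact: sqr_ge0|exact: bd.2|].
  have -> : Ex P (fun w => (X u w - C u w) ^+ 2) =
      Ex P (fun w => (X u w ^+ 2 - 2 * (X u w * C u w)) + C u w ^+ 2).
    by apply: eq_Ex => w; ring.
  have b1 := bmeasX 2 (bX u); have b2 := bmeasX 2 (bC u).
  have b3 : bmeas (fun w => 2 * (X u w * C u w)).
    by apply: bmeasM; [exact: bmeas_cst|exact: bmeasM].
  rewrite ExD//; last exact: bmeasB.
  rewrite ExB// ExZ; last exact: bmeasM.
  by rewrite XC disc_sqr cond_moments -/(c 2) c2; ring.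
by apply: filterS => w /eqP; rewrite sqrf_eq0 subr_eq0 => /eqP.
Qed.

End conditional_tree_solution.

Lemma distribution_ae {d} {Omega : measurableType d} {R : realType} {P : probability Omega R}
    (X Y : {RV P >-> R}) : {ae P, forall w, X w = Y w} ->
  same_law (distribution P X) (distribution P Y).
Proof.
move=> XY A mA; have mX := preimage_measurable X mA; have mY := preimage_measurable Y mA.
rewrite /distribution /pushforward !prE//; congr EFin; apply: pr_negligible => //.
apply: negligibleS XY => w /= h e; move: h; rewrite /setY /preimage /= e.
by move=> -[[]|[]].
Qed.

Lemma same_law_sym {d} {T : measurableType d} {R : realType} (p q : set T -> \bar R) :
  same_law p q -> same_law q p.
Proof. by move=> pq A mA; rewrite pq. Qed.

Lemma same_law_trans {d} {T : measurableType d} {R : realType} (p q r : set T -> \bar R) :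
  same_law p q -> same_law q r -> same_law p r.
Proof. by move=> pq qr A mA; rewrite pq// qr. Qed.

(** * The discrete solution, its conditional probabilities, and the theorem *)

Section discrete_conditional.
Context {d} {Omega : measurableType d} {R : realType} {P : probability Omega R}.
Variables (N : {RV P >-> option nat}) (Nt : tree -> {RV P >-> option nat}).
Variables (S C : tree -> {RV P >-> R}).
Hypothesis N_pos : {ae P, forall w, N w <> Some 0%N}.
Hypothesis Nt_iid : iid_copies N Nt.
Hypothesis S_discrete : discrete_solution Nt S.
Hypothesis C_cond : forall u, is_cond_prob (joint_sigma setT Nt) (S u @^-1` [set 1]) (C u).

Let sF := joint_sigma_sigma_algebra setT Nt.
Let Fm : joint_sigma setT Nt `<=` measurable := @joint_sigma_measurable _ _ _ _ _ _ _ setT Nt.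
Let S' u := clamp_rv (S u).
Let C' u := clamp_rv (C u).

Lemma discrete_event u : measurable (S u @^-1` [set 1]).
Proof. by apply: preimage_measurable; exact: measurable_set1. Qed.

Lemma clamp_cond_ae u : {ae P, forall w, C' u w = C u w}.
Proof. by apply: clamp_rv_ae; apply: cond_prob_range Fm (discrete_event u) (C_cond u). Qed.

Lemma clamp_disc_ae u : {ae P, forall w, S' u w = S u w}.
Proof. by apply: clamp_rv_ae; exact: (ts_range S_discrete.1). Qed.

Lemma clamp_disc01 u : {ae P, forall w, S' u w = 0 \/ S' u w = 1}.
Proof. by apply: filterS2 (clamp_disc_ae u) (S_discrete.2 u) => w ->. Qed.

Lemma clamp_cond_smeas u : smeas (joint_sigma setT Nt) (C' u).
Proof. by apply: (smeas_comp measurable_clamp); exact: cond_prob_smeas (C_cond u). Qed.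

Lemma clamp_cond_agree u A : joint_sigma setT Nt A ->
  Ex P (fun w => C' u w * \1_A w) = Ex P (fun w => S' u w * \1_A w).
Proof.
move=> FA; have mE := discrete_event u; have mA := Fm FA.
rewrite (cond_prob_clamp Fm mE (C_cond u) FA) -Ex_indic; last exact: measurableI.
have bS : bmeas (S' u) by apply: bmeas01 => // w; exact: clamp_rv01.
apply: Ex_ae.
- by apply: measurable_indic; exact: measurableI.
- exact: (bmeasM bS (bmeas_indic mA)).1.
apply: filterS2 (clamp_disc_ae u) (S_discrete.2 u) => w -> h.
rewrite indicI/= mulrC; congr (_ * _); rewrite indicE.
case: h => h; first by rewrite memNset ?h// => e; move: e h => /= -> /eqP; rewrite oner_eq0.
by rewrite mem_set.
Qed.

(** All solutions have the same mean, hence the same conditional means given [Nt]; an endogenous one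
    equals its own conditional mean. *)
Lemma endogenous_unique (X : tree -> {RV P >-> R}) : tree_solution Nt X ->
  endogenous Nt X -> forall u, {ae P, forall w, X u w = C u w}.
Proof.
move=> solX endX u.
have [mu [mu01 muH regS _]] := tree_solution_reg N_pos Nt_iid S_discrete.1.
have [m [m01 mH regX _]] := tree_solution_reg N_pos Nt_iid solX.
have mE : m = mu by exact: (pgf_fixed_unique m01 mu01 mH muH).
rewrite {}mE {m01 mH} in regX.
have bX : bmeas (clamp_rv (X u)) by apply: bmeas01 => // w; exact: clamp_rv01.
have bC : bmeas (C' u) by apply: bmeas01 => // w; exact: clamp_rv01.
have XC : {ae P, forall w, clamp_rv (X u) w = C' u w}.
  apply: (completed_unique sF Fm bX bC).
  - apply: (smeas_comp measurable_clamp) => B mB; apply: (endX u).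
    by exists B => //; rewrite setTI.
  - by apply: smeas_completed; exact: clamp_cond_smeas.
  - by move=> B FB; rewrite clamp_cond_agree// (reg_solution_agree mu01 u regX regS).
apply: filterS3 XC (clamp_cond_ae u) (clamp_rv_ae (ts_range solX u)) => w.
by move=> h1 h2 h3; rewrite -h3 h1 h2.
Qed.

Section with_mean.
Variable mu : R.
Hypotheses (mu01 : 0 < mu < 1) (muH : pgf N mu = 1 - mu).
Hypothesis regS : reg_solution Nt mu S'.
Hypothesis momS : forall u p, Ex P (fun w => S' u w ^+ p) = Ex P (fun w => S' [::] w ^+ p).
Hypothesis scH : strictly_convex_on [set` `[0, 1[] (pgf N).

Let C'01 u w : 0 <= C' u w <= 1. Proof. exact: clamp_rv01. Qed.
Let S'01 u w : 0 <= S' u w <= 1. Proof. exact: clamp_rv01. Qed.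
Let bS u : bmeas (S' u). Proof. exact: bmeas01. Qed.
Let bC u : bmeas (C' u). Proof. exact: bmeas01. Qed.

Lemma discrete_endogenousP : endogenous Nt S <-> derive1 (pgf N) mu <= 1.
Proof.
split=> [endS|H1 u A [B mB <-]].
  rewrite leNgt; apply/negP => H1.
  have := cond_moment2_lt Nt_iid mu01 muH regS C'01 clamp_cond_smeas clamp_cond_agree H1.
  (* If [S] is endogenous it equals [C], whose second moment is then [mu]. *)
  rewrite (_ : Ex _ _ = mu) ?ltxx//.
  rewrite -(disc_sqr regS clamp_disc01 [::] 1); apply: Ex_ae.
  - exact: (bmeasX 2 (bC [::])).1.
  - exact: (bmeasX 2 (bS [::])).1.
  apply: filterS3 (endogenous_unique S_discrete.1 endS [::]) (clamp_cond_ae [::]) (clamp_disc_ae [::]).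
  by move=> w h1 h2 h3; rewrite h2 h3 h1.
have c2 := cond_moment2_eq Nt_iid mu01 muH regS C'01 clamp_cond_smeas clamp_cond_agree scH H1.
have SC := cond_disc_eq Nt_iid mu01 muH regS C'01 clamp_cond_smeas clamp_cond_agree clamp_disc01 u c2.
have SC' : {ae P, forall w, S u w = C' u w} by apply: filterS2 SC (clamp_disc_ae u) => w -> <-.
rewrite setTI; apply: (@completed_sigma_intro _ _ _ _ _ _ (C' u @^-1` B)).
  exact: clamp_cond_smeas.
apply: negligibleS SC' => w /= h e; move: h; rewrite /setY /preimage /= e.
by move=> -[[]|[]].
Qed.

Lemma cond_is_tree_solution : tree_solution Nt C.
Proof.
apply: (cond_tree_solution Nt_iid mu01 muH regS C'01 clamp_cond_smeas clamp_cond_agree).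
exact: clamp_cond_ae.
Qed.

Lemma disc_pr1 u : pr P (S' u @^-1` [set 1]) = mu.
Proof.
have m1 : measurable (S' u @^-1` [set 1]) by apply: preimage_measurable; exact: measurable_set1.
rewrite -(rs_mean regS u) -Ex_indic//; apply: Ex_ae => //.
apply: filterS (clamp_disc01 u) => w h; rewrite indicE.
case: h => h; rewrite [RHS]h; last by rewrite mem_set.
by rewrite memNset// /preimage /= => e; move: h => /=; rewrite [X in X = _]e => /eqP; rewrite oner_eq0.
Qed.

Section invariant_laws.
Variable nu : probability R R.
Hypothesis nu01 : nu [set` `[0, 1]] = 1%E.

Lemma invariant_law_cases : invariant_law N nu ->
  same_law nu (distribution P (S [::])) \/ same_law nu (distribution P (C [::])).
Proof.
(* The discrete variables at level 1 are independent coins of bias [mu], also independent of the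
   offspring number of the root: they supply the randomness for [Z]. *)
move=> inv; pose X i := S' [:: i].
have indX : mutually_independent setT X.
  by apply: (children_mutually_independent (u := [::]) (rs_indep regS (n := 1%N))).
have [Z [Z01 indZ Znu ZX]] := iid_exists indX mu01 (fun i => disc_pr1 [:: i]) nu01.
have sub : joint_sigma setT X `<=` joint_sigma (level 1) S'.
  apply: smallest_sub; first exact: joint_sigma_sigma_algebra.
  by move=> _ [i _ [B mB <-]]; rewrite setTI; exact: joint_sigma_preimage.
have indN : independent_sigma P (joint_sigma setT Z) (g_sigma_algebra_preimage (Nt [::])).
  move=> A B /ZX/sub FA FB; apply: (rs_indep_past regS (n := 1%N)) => //.
  exact: preimage_sub_joint_sigma FB.
have [m1 mE] := invariant_law_moments nu01 (Nt_iid.2 [::]) Z01 indZ Znu indN inv.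
have [m1E [m2|mc]] := moments_determined Nt_iid mu01 muH regS C'01 clamp_cond_smeas
  clamp_cond_agree scH (nu_moment0 nu) m1 (nu_moment_ge0 nu) (fun p q => @nu_moment_le _ nu p q)
  (nu_moment_sqr nu) N_pos mE.
- left; apply: same_law_trans (distribution_ae (clamp_disc_ae [::])).
  apply: same_law_sym; apply: (law_of_moments nu01) => // -[|p].
    by rewrite nu_moment0 -[RHS](Ex_cst P 1); apply: eq_Ex => w; rewrite expr0.
  by rewrite nu_moment_two_values ?m1E//; exact: (disc_sqr regS clamp_disc01).
- right; apply: same_law_trans (distribution_ae (clamp_cond_ae [::])).
  by apply: same_law_sym; apply: (law_of_moments nu01).
Qed.

(** Invariance concerns every probability space carrying suitable variables; the moment equations
    carry over from the tree to each of them. *)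
Lemma tree_law_invariant (X : tree -> {RV P >-> R}) : reg_solution Nt mu X ->
  (forall u p, Ex P (fun w => X u w ^+ p) = Ex P (fun w => X [::] w ^+ p)) ->
  same_law nu (distribution P (X [::])) -> invariant_law N nu.
Proof.
move=> regX momX nuX.
have mX p : Ex P (fun w => X [::] w ^+ p) = nu_moment nu p.
  by apply: (rv_nu_moment nu01 _ (rs_range regX [::])); exact: same_law_sym.
have mu1 : mu < 1 by case/andP: mu01.
apply: (invariant_law_of_moments nu01) => [|p].
  by rewrite -mX -(rs_mean regX [::]) in mu1 *; under eq_Ex do rewrite expr1.
apply: (reg_solution_moments Nt_iid _ mu1 regX) => u q.
by rewrite momX mX.
Qed.

End invariant_laws.

End with_mean.
End discrete_conditional.

Theorem theorem4p2 (R : realType) (d : measure_display)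
    (Omega : measurableType d) (P : probability Omega R)
    (N : {RV P >-> option nat}) (Nt : tree -> {RV P >-> option nat})
    (S C : tree -> {RV P >-> R}) (mu1 : R)
    (N_pos : {ae P, forall w, N w <> Some 0%N})
    (H_strictly_convex : strictly_convex_on [set` `[0, 1[] (pgf N))
    (Nt_iid : iid_copies N Nt)
    (S_discrete : discrete_solution Nt S)
    (C_cond : forall u,
      is_cond_prob (joint_sigma setT Nt) (S u @^-1` [set 1]) (C u))
    (mu1E : forall u, 'E_P[S u]%E = mu1%:E) :
  (endogenous Nt S <-> derive1 (pgf N) mu1 <= 1) /\
  (tree_solution Nt C /\ endogenous Nt C /\
   forall X : tree -> {RV P >-> R}, tree_solution Nt X -> endogenous Nt X ->
     forall u, {ae P, forall w, X u w = C u w}) /\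
  (forall nu : probability R R, nu [set` `[0, 1]] = 1%E ->
     (invariant_law N nu <->
      same_law nu (distribution P (S [::])) \/
      same_law nu (distribution P (C [::])))).
Proof.
have [mu [mu01 muH regS momS]] := tree_solution_reg N_pos Nt_iid S_discrete.1.
have muE : mu = mu1.
  have : Ex P (S [::]) = mu1 by rewrite /Ex /Rintegral; have := mu1E [::]; rewrite unlock => ->.
  move=> <-; rewrite -(rs_mean regS [::]); apply: Ex_ae => //.
  exact: (clamp_disc_ae S_discrete).
rewrite -muE.
have C01 u w : 0 <= clamp_rv (C u) w <= 1 by exact: clamp_rv01.
have Csm := clamp_cond_smeas C_cond.
have Cag := clamp_cond_agree S_discrete C_cond.
split; first exact: (discrete_endogenousP N_pos Nt_iid S_discrete C_cond mu01 muH regS).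
split; [split; last split|].
- exact: (cond_is_tree_solution Nt_iid S_discrete C_cond mu01 muH regS).
- move=> u A CA; apply: sub_sigma_algebra; left; exact: ((C_cond u).1 A CA).
- exact: (endogenous_unique N_pos Nt_iid S_discrete C_cond).
move=> nu nu01; split.
  exact: (invariant_law_cases N_pos Nt_iid S_discrete C_cond mu01 muH regS).
move=> [nuS|nuC].
  apply: (tree_law_invariant Nt_iid mu01 nu01 regS momS).
  apply: same_law_trans nuS _; apply: same_law_sym; apply: distribution_ae.
  exact: (clamp_disc_ae S_discrete).
apply: (tree_law_invariant Nt_iid mu01 nu01
  (cond_reg_solution Nt_iid mu01 regS C01 Csm Cag)).
  by move=> u p; exact: (cond_moments Nt_iid mu01 muH regS C01 Csm Cag).
apply: same_law_trans nuC _; apply: same_law_sym; apply: distribution_ae.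
exact: (clamp_cond_ae C_cond).
Qed.
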